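(* Let $B(\cdot)$ be a standard Brownian bridge on $[0,1]$ and let $$ V=\frac{1}{\frac{\pi^2}{3}-2}\left\{\int_0^1\frac{6B^2(t)}{t(1-t)}\,dt-\left[\int_0^1 6B(t)\,dt\right]^2\right\}-\left[\frac{1}{\frac{\pi^2}{3}-2}\int_0^1 6B(t)\ln\left(\frac{t}{1-t}\right)dt\right]^2 . $$ Let $\{Z_m\}_{m=1}^\infty$ be an infinite sequence of independent identically distributed standard normal random variables. Then $$ V\ \overset{\mathcal D}{=}\ \frac{1}{\frac{\pi^2}{3}-2}\sum_{k=2}^\infty\frac{6}{k(k+1)}Z_k^2-\left[\frac{1}{\frac{\pi^2}{3}-2}\sum_{l=1}^\infty\frac{3\sqrt{4l+1}}{l(l+1)(2l-1)(2l+1)}Z_{2l}\right]^2, $$ where the series converge with probability one.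
   Context: A standard Brownian bridge is a centered Gaussian process $B$ on $[0,1]$ with continuous sample paths and covariance $E[B(s)B(t)]=\min(s,t)-st$. The integrals defining $V$ exist with probability one. The symbol $\overset{\mathcal D}{=}$ denotes equality in distribution. *)

(* Defs.v *)
From HB Require Import structures.
From mathcomp Require Import all_boot all_order all_algebra.
From mathcomp Require Import all_classical all_reals all_analysis.

Set Implicit Arguments.
Unset Strict Implicit.
Unset Printing Implicit Defensive.

Import Order.TTheory GRing.Theory Num.Theory.
Import numFieldTopology.Exports numFieldNormedType.Exports.

Local Open Scope classical_set_scope.
Local Open Scope ring_scope.

Definition has_law (d : measure_display) (T : measurableType d) (R : realType)
    (P : probability T R) (X : T -> R) (mu : set R -> \bar R) : Prop :=
  measurable_fun [set: T] X /\
  forall A : set R, measurable A -> pushforward P X A = mu A.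

Definition eq_in_law (R : realType)
    (d : measure_display) (T : measurableType d) (P : probability T R)
    (d' : measure_display) (T' : measurableType d') (Q : probability T' R)
    (X : T -> R) (Y : T' -> R) : Prop :=
  [/\ measurable_fun [set: T] X, measurable_fun [set: T'] Y &
      forall A : set R, measurable A -> pushforward P X A = pushforward Q Y A].

(* The normal law with mean [m] and standard deviation [s]. The case s = 0 is
   the Dirac mass at [m], whereas the library's [normal_prob m 0] is a dummy
   value (the uniform law on [0, 1]). *)
Definition normal_law (R : realType) (m s : R) (A : set R) : \bar R :=
  if s == 0 then dirac m A else normal_prob m s A.

(* A Gaussian process indexed by [D]: all finite linear combinations of its
   values are normal, possibly degenerate. *)
Definition gaussian_process (R : realType) (d : measure_display)
    (T : measurableType d) (P : probability T R) (D : set R)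
    (X : R -> T -> R) : Prop :=
  (forall t, D t -> measurable_fun [set: T] (X t)) /\
  forall (n : nat) (t a : 'I_n -> R), (forall i, D (t i)) ->
    exists m s : R, 0 <= s /\
      has_law P (fun w => \sum_(i < n) a i * X (t i) w) (normal_law m s).

(* Only the values [B t] with t in [0, 1] are constrained. *)
Definition brownian_bridge (R : realType) (d : measure_display)
    (T : measurableType d) (P : probability T R) (B : R -> T -> R) : Prop :=
  [/\ gaussian_process P `[0, 1] B,
      forall t : R, t \in `[0, 1] -> ('E_P[B t] = 0)%E,
      forall s t : R, s \in `[0, 1] -> t \in `[0, 1] ->
        ('E_P[B s \* B t] = (Num.min s t - s * t)%:E)%E &
      forall w : T, {within `[0, 1], continuous (fun t => B t w)}].

Definition independent_rvs (R : realType) (d : measure_display)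
    (T : measurableType d) (P : probability T R) (D : set nat)
    (X : nat -> T -> R) : Prop :=
  (forall i, D i -> measurable_fun [set: T] (X i)) /\
  forall (J : seq nat) (A : nat -> set R), uniq J ->
    (forall i, i \in J -> D i) -> (forall i, measurable (A i)) ->
    (P (\bigcap_(i in [set` J]) (X i @^-1` A i)) =
     \prod_(i <- J) P (X i @^-1` A i))%E.

(* [Z 0] is unconstrained: the sequence is (Z m) for m >= 1. *)
Definition iid_standard_normal (R : realType) (d : measure_display)
    (T : measurableType d) (P : probability T R) (Z : nat -> T -> R) : Prop :=
  independent_rvs P [set m | (1 <= m)%N] Z /\
  forall m : nat, (1 <= m)%N -> has_law P (Z m) (normal_prob 0 1).

(* The integrands at t = 0 and t = 1 take dummy values, on a null set. *)
Definition quad_integrand (R : realType) (b : R -> R) (t : R) : R :=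
  6 * b t ^+ 2 / (t * (1 - t)).

Definition lin_integrand (R : realType) (b : R -> R) (t : R) : R := 6 * b t.

Definition log_integrand (R : realType) (b : R -> R) (t : R) : R :=
  6 * b t * ln (t / (1 - t)).

Definition V_stat (R : realType) (b : R -> R) : R :=
  let mu := @lebesgue_measure R in
  (pi ^+ 2 / 3 - 2)^-1 *
    (\int[mu]_(t in `[0, 1]) quad_integrand b t
     - (\int[mu]_(t in `[0, 1]) lin_integrand b t) ^+ 2)
  - ((pi ^+ 2 / 3 - 2)^-1 * \int[mu]_(t in `[0, 1]) log_integrand b t) ^+ 2.

Definition quad_term (R : realType) (z : nat -> R) (k : nat) : R :=
  6 / (k%:R * (k%:R + 1)) * z k ^+ 2.

Definition lin_term (R : realType) (z : nat -> R) (l : nat) : R :=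
  3 * Num.sqrt (4 * l%:R + 1)
    / (l%:R * (l%:R + 1) * (2 * l%:R - 1) * (2 * l%:R + 1)) * z (2 * l)%N.

Definition V_series (R : realType) (z : nat -> R) : R :=
  (pi ^+ 2 / 3 - 2)^-1 * limn (fun n => \sum_(2 <= k < n) quad_term z k)
  - ((pi ^+ 2 / 3 - 2)^-1 * limn (fun n => \sum_(1 <= l < n) lin_term z l)) ^+ 2.

(* Main.v *)
Require Import Defs.
From HB Require Import structures.
From mathcomp Require Import all_boot all_order all_algebra.
From mathcomp Require Import all_classical all_reals all_analysis.
From mathcomp Require Import measurable_realfun.
From mathcomp Require Import ring lra.
Import Order.TTheory GRing.Theory Num.Theory.
Import numFieldTopology.Exports numFieldNormedType.Exports.
Local Open Scope classical_set_scope.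
Local Open Scope ring_scope.

Set Implicit Arguments.
Unset Strict Implicit.
Unset Printing Implicit Defensive.

(** The bridge is expanded along the derivatives of the Legendre polynomials of
    [0, 1]. Write [w = t (1 - t)] and let [P_k] be the Legendre polynomial with
    [P_k 0 = 1]; it solves [(w P_k')' = - k (k + 1) P_k], so the [P_k'] are
    orthogonal for the weight [w] ([legendre_green], [legendre_orthogonal],
    [legendre_norm]). Put [xi_k = sqrt (2 k + 1) * int B P_k'].

    Law of the coordinates. For a polynomial [h], the integral [int B h'] is a
    limit of centred Gaussian Riemann-Stieltjes sums, with limiting variance
    [int h ^ 2 - (int h) ^ 2] ([bridge_functional_cos]). As the
    [sqrt (2 k + 1) P_k] are orthonormal and orthogonal to constants, every
    linear combination of the [xi_k] has the same cosine transform as the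
    corresponding combination of the [Z_k] ([bridge_coord_cos],
    [independent_normals_cos]).

    Identities along a path. Bessel's inequality gives
    [sum_(k <= n) xi_k ^ 2 / (k (k + 1)) <= int B ^ 2 / w]. The right-hand side
    has mean at most 1, because [w] is the variance of the bridge, and the
    left-hand side has mean at least [1 - 1 / (n + 1)]. The mean difference tends
    to 0, so almost surely equality holds in the limit ([ae_parseval]). This gives
    the integral of [6 B ^ 2 / w] as a series; its first term is
    [3 xi_1 ^ 2 = (int 6 B) ^ 2], since [P_1' = -2]
    ([cvg_quad_series_path]). By the Cauchy-Schwarz inequality the expansion may
    also be integrated against [ln (t / (1 - t))], whose weighted coefficients are
    0 for odd [k] and [2 / (k (k + 1) - 2)] for even [k]
    ([logit_legendre_odd], [logit_legendre_even]); this gives the linear series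
    in the [xi_2l] ([cvg_lin_series_path]). Hence the statistic of the bridge is
    almost surely the series statistic of the sequence [xi].

    Equality in law. Let [X] be the sum of the quadratic series and [Y] the sum of
    the linear one. The mixed moments of [exp (- X)] and [exp (- Y ^ 2)] are
    limits of means of [exp (- 1/2 * sum of squares of linear forms)]. Such means
    depend only on the cosine transforms of linear combinations, because
    [exp (- l ^ 2 / 2)] is the mean of [cos (l g)] over a standard normal [g]
    ([eq_exp_quad]). Moments determine the law of a pair in the unit square
    ([eq_law_of_moments]), and the statistic is a function of that pair
    ([eq_law_V_series]). *)

(** * Integration and convergence tools *)

Import HBNNSimple.

Section density.
Local Open Scope ereal_scope.
Context d (T : measurableType d) (R : realType).
Variables (mu nu : {measure set T -> \bar R}) (p : T -> R).
Hypothesis mp : measurable_fun [set: T] p.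
Hypothesis p0 : forall x, (0 <= p x)%R.
Hypothesis nuE : forall A, measurable A -> nu A = \int[mu]_(x in A) (p x)%:E.

Let density_nnsfun (h : {nnsfun T >-> R}) :
  \int[nu]_x (h x)%:E = \int[mu]_x ((h x)%:E * (p x)%:E).
Proof.
under [LHS]eq_integral
  do rewrite fimfunE -fsumEFin//.
rewrite ge0_integral_fsum//; last 2 first.
  - by move=> r; exact/measurable_EFinP/measurableT_comp.
  - by move=> r x _; rewrite nnfun_muleindic_ge0.
under [RHS]eq_integral.
  move=> x _; rewrite fimfunE -fsumEFin// ge0_mule_fsuml; last first.
    by move=> r; rewrite nnfun_muleindic_ge0.
  over.
rewrite ge0_integral_fsum//; last 2 first.
  - move=> r; apply/emeasurable_funM; last exact/measurable_EFinP.
    by exact/measurable_EFinP/measurableT_comp.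
  - move=> r x _; apply: mule_ge0; last by rewrite lee_fin.
    by rewrite EFinM; exact: nnfun_muleindic_ge0.
apply: eq_fsbigr => r; rewrite inE => -[t _ htr].
have r0 : (0 <= r)%R by rewrite -htr fun_ge0.
under [LHS]eq_integral do rewrite EFinM.
rewrite [LHS]ge0_integralZl//; last exact/measurable_EFinP.
rewrite integral_indic// setIT nuE//.
under [RHS]eq_integral do rewrite EFinM -muleA.
rewrite [RHS]ge0_integralZl//; last 2 first.
  - by apply/emeasurable_funM; exact/measurable_EFinP.
  - by move=> x _; rewrite mule_ge0 ?lee_fin.
congr (_ * _); rewrite [LHS]integral_mkcond; apply: eq_integral => x _.
by rewrite epatch_indic muleC.
Qed.

(** Monotone convergence through simple functions. *)
Lemma ge0_integral_density (f : T -> \bar R) :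
  measurable_fun [set: T] f -> (forall x, 0 <= f x) ->
  \int[nu]_x f x = \int[mu]_x (f x * (p x)%:E).
Proof.
move=> mf f0; pose g := nnsfun_approx measurableT mf.
have gf x : EFin \o (g ^~ x) @ \oo --> f x by exact: cvg_nnsfun_approx.
have ndg x : {homo (fun n => (g n x)%:E) : n m / (n <= m)%N >-> n <= m}.
  by move=> n m nm; rewrite lee_fin; exact/lefP/nd_nnsfun_approx.
have -> : \int[nu]_x f x = \int[nu]_x limn (fun n => (g n x)%:E).
  by apply: eq_integral => x _; apply/esym/cvg_lim => //; exact: gf.
have -> : \int[mu]_x (f x * (p x)%:E) =
    \int[mu]_x limn (fun n => (g n x)%:E * (p x)%:E).
  apply: eq_integral => x _; apply/esym/cvg_lim => //.
  by apply: cvgeZr => //; exact: gf.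
rewrite monotone_convergence//; last 2 first.
  - by move=> n; exact/measurable_EFinP.
  - by move=> n x _; rewrite lee_fin.
rewrite monotone_convergence//.
- by congr (limn _); apply/funext => n; exact: density_nnsfun.
- by move=> n; apply/emeasurable_funM; exact/measurable_EFinP.
- by move=> n x _; rewrite mule_ge0 ?lee_fin.
- by move=> x _ n m nm; apply: lee_wpmul2r; rewrite ?lee_fin//; exact: ndg.
Qed.

End density.

Section integral_tools.
Context d (T : measurableType d) (R : realType).

Lemma integral_density (mu nu : {measure set T -> \bar R}) (p : T -> R) :
  measurable_fun [set: T] p -> (forall x, 0 <= p x) ->
  (forall A, measurable A -> nu A = \int[mu]_(x in A) (p x)%:E)%E ->
  forall f : T -> \bar R, measurable_fun [set: T] f ->
  (\int[nu]_x f x = \int[mu]_x (f x * (p x)%:E))%E.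
Proof.
move=> mp p0 nuE f mf; rewrite [LHS]integralE [RHS]integralE.
congr (_ - _)%E; rewrite (ge0_integral_density mp p0 nuE)//.
- apply: eq_integral => x _.
  by rewrite !funeposE maxe_pMl ?lee_fin// mul0e.
- exact: measurable_funepos.
- apply: eq_integral => x _.
  by rewrite !funenegE maxe_pMl ?lee_fin// mul0e mulNe.
- exact: measurable_funeneg.
Qed.

Lemma dominated_cvg_Rintegral (mu : {measure set T -> \bar R}) (D : set T)
    (f_ : nat -> T -> R) (f g : T -> R) :
  measurable D -> (forall n, measurable_fun D (f_ n)) -> measurable_fun D f ->
  {ae mu, forall x, D x -> f_ n x @[n --> \oo] --> f x} ->
  mu.-integrable D (EFin \o g) ->
  (forall n x, D x -> `|f_ n x| <= g x) ->
  mu.-integrable D (EFin \o f) /\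
  \int[mu]_(x in D) f_ n x @[n --> \oo] --> \int[mu]_(x in D) f x.
Proof.
move=> mD mf_ mf ff ig fg.
have [||||If _ cvgf] := @dominated_convergence _ _ _ mu _ mD
  (fun n x => (f_ n x)%:E) (EFin \o f) (EFin \o g) _ _ _ ig.
- by move=> n; exact/measurable_EFinP.
- exact/measurable_EFinP.
- by apply: filterS ff => x fx Dx; apply: cvg_EFin; [exact: nearW|exact: fx].
- by apply: aeW => x n Dx; rewrite lee_fin; exact: fg.
split => //; apply: fine_cvg => /=.
by rewrite /Rintegral fineK//; exact: integrable_fin_num.
Qed.

Lemma bounded_integrable (P : {finite_measure set T -> \bar R}) (D : set T)
    (f : T -> R) (M : R) :
  measurable D -> measurable_fun D f -> (forall x, D x -> `|f x| <= M) ->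
  P.-integrable D (EFin \o f).
Proof.
move=> mD mf fM; apply: (le_integrable mD _ _
  (finite_measure_integrable_cst P M mD)); first exact/measurable_EFinP.
by move=> x Dx /=; rewrite lee_fin (le_trans (fM x Dx))// ler_norm.
Qed.

Lemma le_integrableR (mu : {measure set T -> \bar R}) (D : set T)
    (f g : T -> R) :
  measurable D -> measurable_fun D f -> (forall x, D x -> `|f x| <= g x) ->
  mu.-integrable D (EFin \o g) -> mu.-integrable D (EFin \o f).
Proof.
move=> mD mf fg; apply: le_integrable => //; first exact/measurable_EFinP.
by move=> x Dx /=; rewrite lee_fin (le_trans (fg x Dx))// ler_norm.
Qed.

Lemma integrableRD (mu : {measure set T -> \bar R}) (D : set T) (f g : T -> R) :
  measurable D -> mu.-integrable D (EFin \o f) -> mu.-integrable D (EFin \o g) ->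
  mu.-integrable D (EFin \o (fun x => f x + g x)).
Proof. by move=> mD If Ig; apply: (integrableD mD If Ig). Qed.

Lemma integrableRB (mu : {measure set T -> \bar R}) (D : set T) (f g : T -> R) :
  measurable D -> mu.-integrable D (EFin \o f) -> mu.-integrable D (EFin \o g) ->
  mu.-integrable D (EFin \o (fun x => f x - g x)).
Proof. by move=> mD If Ig; apply: (integrableB mD If Ig). Qed.

Lemma integrableRZl (mu : {measure set T -> \bar R}) (D : set T) (k : R)
    (f : T -> R) : measurable D -> mu.-integrable D (EFin \o f) ->
  mu.-integrable D (EFin \o (fun x => k * f x)).
Proof. by move=> mD If; apply: (integrableZl mD k If). Qed.

Lemma Rintegral_sum (mu : {measure set T -> \bar R}) (D : set T) (I : eqType)
    (s : seq I) (f : I -> T -> R) :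
  measurable D -> (forall i, i \in s -> mu.-integrable D (EFin \o f i)) ->
  mu.-integrable D (EFin \o (fun x => \sum_(i <- s) f i x)) /\
  \int[mu]_(x in D) (\sum_(i <- s) f i x) =
    \sum_(i <- s) \int[mu]_(x in D) f i x.
Proof.
move=> mD; elim: s => [|i s IH] si.
  split.
    rewrite (_ : EFin \o _ = cst 0%E); first exact: integrable0.
    by apply/funext => x /=; rewrite big_nil.
  under eq_Rintegral do rewrite big_nil.
  by rewrite Rintegral_cst// mul0r big_nil.
have [|I1 E1] := IH; first by move=> j js; apply: si; rewrite inE js orbT.
have I2 : mu.-integrable D (EFin \o f i) by apply: si; rewrite inE eqxx.
split.
  rewrite (_ : EFin \o _ =
      EFin \o (fun x => f i x + \sum_(i <- s) f i x)).
    exact: integrableRD.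
  by apply/funext => x /=; rewrite big_cons.
under eq_Rintegral do rewrite big_cons.
by rewrite RintegralD// big_cons E1.
Qed.

End integral_tools.

Section calculus_tools.
Context (R : realType).
Implicit Types (f F : R -> R).

Lemma Rintegral_FTC (a b : R) (f F : R -> R) : a <= b ->
  {within `[a, b], continuous f} -> {within `[a, b], continuous F} ->
  (forall x, x \in `]a, b[ -> is_derive x 1 F (f x)) ->
  \int[lebesgue_measure]_(x in `[a, b]) f x = F b - F a.
Proof.
rewrite le_eqVlt => /predU1P[->|ab] cf cF dF.
  by rewrite set_itv1 Rintegral_set1 subrr.
have /(continuous_within_itvP _ ab)[_ Fa Fb] := cF.
rewrite /Rintegral (continuous_FTC2 ab cf (F := F))//.
- by split => // x xab; have [] := dF x xab.
- by move=> x xab; rewrite derive1E; have [] := dF x xab.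
Qed.

Lemma continuous_integrable (a b : R) f : {within `[a, b], continuous f} ->
  (@lebesgue_measure R).-integrable `[a, b] (EFin \o f).
Proof.
by move=> cf; apply: continuous_compact_integrable => //; exact: segment_compact.
Qed.

End calculus_tools.

Lemma cvg0_harmonic_bound (R : realType) (u : nat -> R) (C : R) :
  (forall n, `|u n| <= C * n.+1%:R^-1) -> u n @[n --> \oo] --> 0.
Proof.
move=> uC; have hC : C * n.+1%:R^-1 @[n --> \oo] --> (0:R).
  rewrite -[X in _ --> X](mulr0 C); apply: cvgMr; exact: cvg_harmonic.
apply: (@squeeze_cvgr _ _ _ _ (fun n => - (C * n.+1%:R^-1))
  (fun n => C * n.+1%:R^-1)) => //.
  by apply: nearW => n; rewrite -ler_norml.
by rewrite -[X in _ --> X]oppr0; exact: cvgN.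
Qed.

Section bounded_Fubini.
Context (R : realType) d1 (T1 : measurableType d1) d2 (T2 : measurableType d2).
Variables (P : probability T1 R) (Q : probability T2 R).
Variables (f : T1 * T2 -> R) (M : R).
Hypothesis mf : measurable_fun [set: T1 * T2] f.
Hypothesis fM : forall z, `|f z| <= M.

Lemma bounded_Fubini :
  \int[P]_x \int[Q]_y f (x, y) = \int[Q]_y \int[P]_x f (x, y).
Proof.
have If : (P \x Q)%E.-integrable setT (EFin \o f).
  apply: measurable_bounded_integrable => //.
    rewrite [ltLHS](_ : _ = (P \x Q)%E ([set: T1] `*` [set: T2])); last first.
      by rewrite setXTT.
    rewrite product_measure1E//.
    rewrite [X in (X * _)%E](probability_setT P).
    by rewrite [X in (_ * X)%E](probability_setT Q) mule1 ltry.
  by exists M; split=> [|x Mx y _]; [exact: num_real|exact: le_trans (fM y) (ltW Mx)].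
rewrite /Rintegral.
transitivity (fine (\int[P]_x \int[Q]_y (f (x, y))%:E)).
  congr fine; apply: eq_integral => x _; rewrite fineK//.
  apply: integrable_fin_num => //.
  apply: (@bounded_integrable _ _ _ Q _ (fun y => f (x, y)) M) => //.
  exact: measurableT_comp.
transitivity (fine (\int[Q]_y \int[P]_x (f (x, y))%:E)).
  by congr fine; exact: (Fubini If).
congr fine; apply: eq_integral => y _; rewrite fineK//.
apply: integrable_fin_num => //.
apply: (@bounded_integrable _ _ _ P _ (fun x => f (x, y)) M) => //.
exact: measurableT_comp.
Qed.

End bounded_Fubini.

(** * Normal laws: Stein's identity, moments and characteristic function *)

Section stein.
Context (R : realType) (m s : R).
Hypothesis s0 : s != 0.
Local Notation N := (@normal_prob R m s).
Local Notation p := (normal_pdf m s).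
Local Notation mu := (@lebesgue_measure R).

Let normal_pdfM x : p x = normal_peak s * normal_fun m s x.
Proof. by rewrite normal_pdfE. Qed.

Let is_derive_normal_pdf (x : R) :
  is_derive x (1 : R) p (- ((x - m) / s ^+ 2) * p x).
Proof.
have -> : p = (fun x => normal_peak s * normal_fun m s x).
  by apply/funext => y; rewrite normal_pdfM.
have h : is_derive x (1:R) (fun y : R => - (y - m) ^+ 2 / (s ^+ 2 *+ 2))
    (- ((x - m) / s ^+ 2)).
  apply: is_derive_eq.
  by rewrite /GRing.scale/=; field.
have h2 := @is_derive1_comp R expR
  (fun y : R => - (y - m) ^+ 2 / (s ^+ 2 *+ 2)) x _ _ (is_derive_expR _) h.
rewrite /normal_fun; apply: is_derive_eq; rewrite /normal_fun /GRing.scale/=; ring.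
Qed.

Let continuous_normal_pdf' : continuous p.
Proof. exact: continuous_normal_pdf. Qed.

Let expR_decay (y : R) : 0 <= y -> y * expR (- (2 * y)) <= expR (- y).
Proof.
move=> y0; have -> : - (2 * y) = - y + - y by ring.
rewrite expRD mulrA ler_piMl ?expR_ge0// expRN ler_pdivrMr ?expR_gt0// mul1r.
by apply: le_trans (expR_ge1Dx y); rewrite lerDr.
Qed.

Let sqr_normal_fun x :
  (x - m) ^+ 2 * normal_fun m s x <= 4 * s ^+ 2 * normal_fun m (Num.sqrt 2 * s) x.
Proof.
pose y := (x - m) ^+ 2 / (4 * s ^+ 2).
have s2 : 0 < s ^+ 2 by rewrite exprn_even_gt0.
have y0 : 0 <= y by rewrite divr_ge0 ?sqr_ge0// mulr_ge0 ?ltW.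
have -> : normal_fun m s x = expR (- (2 * y)).
  by rewrite /normal_fun /y; congr expR; field.
have -> : normal_fun m (Num.sqrt 2 * s) x = expR (- y).
  by rewrite /normal_fun /y exprMn sqr_sqrtr//; congr expR; field.
have -> : (x - m) ^+ 2 = 4 * s ^+ 2 * y by rewrite /y; field.
rewrite -(mulrA (4 * s ^+ 2)) ler_wpM2l ?expR_decay//.
by rewrite mulr_ge0// ltW.
Qed.

Let K := 4 * s ^+ 2 * normal_peak s.

Let s2_gt0 : 0 < s ^+ 2. Proof. by rewrite exprn_even_gt0. Qed.

Let K_ge0 : 0 <= K.
Proof. by rewrite /K mulr_ge0 ?normal_peak_ge0// mulr_ge0// ltW. Qed.

Let sqr_normal_pdf_le x : (x - m) ^+ 2 * p x <= K * normal_fun m (Num.sqrt 2 * s) x.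
Proof.
rewrite normal_pdfM /K mulrCA [leRHS]mulrAC mulrC.
by rewrite ler_wpM2r ?normal_peak_ge0// sqr_normal_fun.
Qed.

Let sqr_normal_pdf_ub x : (x - m) ^+ 2 * p x <= K.
Proof.
apply: (le_trans (sqr_normal_pdf_le x)); rewrite ler_piMr//.
rewrite /normal_fun -expR0 ler_expR mulNr oppr_le0 divr_ge0 ?sqr_ge0//.
by rewrite mulrn_wge0// sqr_ge0.
Qed.

Let NE A : measurable A -> (N A = \int[mu]_(x in A) (p x)%:E)%E.
Proof. by []. Qed.

Let mp : measurable_fun [set: R] p. Proof. exact: measurable_normal_pdf. Qed.
Let p0 x : 0 <= p x. Proof. exact: normal_pdf_ge0. Qed.

Lemma integral_normal_prob (f : R -> \bar R) : measurable_fun [set: R] f ->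
  (\int[N]_x f x = \int[mu]_x (f x * (p x)%:E))%E.
Proof. exact: (@integral_density _ (measurableTypeR R) R mu N p mp p0 NE). Qed.

Lemma Rintegral_normal_prob (f : R -> R) : measurable_fun [set: R] f ->
  \int[N]_x f x = \int[mu]_x (f x * p x).
Proof.
move=> mf; rewrite /Rintegral integral_normal_prob//; exact/measurable_EFinP.
Qed.

Let integrable_density (f : R -> R) : N.-integrable [set: R] (EFin \o f) ->
  mu.-integrable [set: R] (EFin \o (fun x => f x * p x)).
Proof.
move=> /integrableP[/measurable_EFinP mf iN]; apply/integrableP; split.
  by apply/measurable_EFinP/measurable_funM.
move: iN; rewrite integral_normal_prob; last first.
  exact/measurableT_comp/measurable_EFinP.
apply: le_lt_trans; rewrite le_eqVlt; apply/orP; left; apply/eqP.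
by apply: eq_integral => x _ /=; rewrite normrM (ger0_norm (p0 x)) EFinM.
Qed.

Lemma normal_sqr_integrable :
  N.-integrable [set: R] (EFin \o (fun x => (x - m) ^+ 2)).
Proof.
have mf : measurable_fun [set: R] (fun x : R => (x - m) ^+ 2).
  by apply: measurable_funX; apply: measurable_funB.
apply/integrableP; split; first exact/measurable_EFinP.
rewrite integral_normal_prob; last first.
  exact/measurableT_comp/measurable_EFinP.
have s20 : Num.sqrt 2 * s != 0 by rewrite mulf_neq0// gt_eqF// sqrtr_gt0.
pose K' := K / normal_peak (Num.sqrt 2 * s).
have K'0 : 0 <= K' by rewrite divr_ge0// normal_peak_ge0.
apply: (@le_lt_trans _ _
    (\int[mu]_x (K'%:E * (normal_pdf m (Num.sqrt 2 * s) x)%:E))%E).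
  apply: ge0_le_integral => //.
  - by move=> x _; rewrite mule_ge0// lee_fin.
  - apply/emeasurable_funM; last exact/measurable_EFinP.
    exact/measurableT_comp/measurable_EFinP.
  - apply/measurable_EFinP/measurable_funM => //.
    exact: measurable_normal_pdf.
  - move=> x _; rewrite /= -EFinM lee_fin ger0_norm ?sqr_ge0//.
    rewrite (normal_pdfE m s20) /K' mulrA divfK ?gt_eqF ?normal_peak_gt0//.
rewrite ge0_integralZl//; last 2 first.
  - by apply/measurable_EFinP; exact: measurable_normal_pdf.
  - by move=> x _; rewrite lee_fin normal_pdf_ge0.
by rewrite integral_normal_pdf mule1 ltry.
Qed.

(** Integration by parts against the density [p], which satisfies
    [p' = - (x - m) / s ^ 2 * p]; the boundary terms vanish because
    [(x - m) ^ 2 * p x] is bounded. *)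
Lemma stein_identity (f g : R -> R) (A : R) :
  (forall x : R, is_derive x (1 : R) f (g x)) -> continuous g ->
  (forall x, `|f x| <= A * (1 + `|x - m|)) -> (forall x, `|g x| <= A) ->
  N.-integrable [set: R] (EFin \o (fun x => (x - m) * f x)) /\
  \int[N]_x ((x - m) * f x) = s ^+ 2 * \int[N]_x g x.
Proof.
move=> fg cg fA gA.
have cf : continuous f.
  move=> x; apply: differentiable_continuous; apply/derivable1_diffP.
  by have [] := fg x.
have A0 : 0 <= A by apply: le_trans (gA 0).
have mf : measurable_fun [set: R] f by exact: continuous_measurable_fun.
have mg : measurable_fun [set: R] g by exact: continuous_measurable_fun.
have mxf : measurable_fun [set: R] (fun x => (x - m) * f x).
  by apply: measurable_funM => //; exact: measurable_funB.
have Ig : N.-integrable [set: R] (EFin \o g).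
  by apply: (@bounded_integrable _ _ _ N _ _ A).
have Ixf : N.-integrable [set: R] (EFin \o (fun x => (x - m) * f x)).
  apply: (@le_integrableR _ _ _ N _ _ (fun x => A * (1 + 2 * (x - m) ^+ 2))) => //.
    move=> x _; rewrite normrM (le_trans (ler_wpM2l (normr_ge0 _) (fA x)))//.
    rewrite mulrCA ler_wpM2l// -(real_normK (num_real (x - m))).
    by move: (`|x - m|) (normr_ge0 (x - m)) => y y0; nra.
  apply: integrableRZl => //; apply: integrableRD => //.
    exact: finite_measure_integrable_cst.
  by apply: integrableRZl => //; exact: normal_sqr_integrable.
split => //; apply/eqP; rewrite -subr_eq0; apply/eqP.
rewrite -RintegralZl// -RintegralB//; last exact: integrableRZl.
pose h x := (x - m) * f x - s ^+ 2 * g x.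
have Ih : N.-integrable [set: R] (EFin \o h).
  by apply: integrableRB => //; exact: integrableRZl.
have mh : measurable_fun [set: R] h.
  by apply: measurable_funB => //; exact: measurable_funM.
have ch : continuous (fun x => h x * p x).
  move=> x; apply: cvgM; last exact: continuous_normal_pdf'.
  apply: cvgB; apply: cvgM; [|exact: cf|exact: cvg_cst|exact: cg].
  by apply: cvgB; [exact: cvg_id|exact: cvg_cst].
rewrite -[LHS]/(\int[N]_x h x) Rintegral_normal_prob//.
have Ihp := integrable_density Ih.
pose J n : set R := `[m - n%:R, m + n%:R]%classic.
have JT (x : R) : \forall n \near \oo, J n x.
  near=> n; rewrite /J/= in_itv/= -ler_distlC.
  by near: n; exact: nbhs_infty_ger.
have mhp : measurable_fun [set: R] (fun x => h x * p x).
  by apply: measurable_funM.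
have [_ cvgJ] : mu.-integrable [set: R] (EFin \o (fun x => h x * p x)) /\
    \int[mu]_x ((fun x => h x * p x) \_ (J n)) x @[n --> \oo]
      --> \int[mu]_x (h x * p x).
  apply: (@dominated_cvg_Rintegral _ _ _ mu [set: R] _ _
    (fun x => `|h x * p x|)) => //.
  - move=> n; apply: (measurable_restrictT _ _).1; first exact: measurable_itv.
    exact: measurable_funTS.
  - apply: aeW => x _; apply: cvg_near_cst.
    by near=> n; rewrite patchE mem_set//; near: n; exact: JT.
  - exact: integrable_abse Ihp.
  - by move=> n x _; rewrite patchE; case: ifP => // _; rewrite normr0.
have JE n : \int[mu]_x ((fun x => h x * p x) \_ (J n)) x =
    - s ^+ 2 * (f (m + n%:R) * p (m + n%:R)) +
    s ^+ 2 * (f (m - n%:R) * p (m - n%:R)).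
  rewrite -Rintegral_mkcond.
  pose G x := - s ^+ 2 * (f x * p x).
  transitivity (G (m + n%:R) - G (m - n%:R)); last by rewrite /G; ring.
  apply: Rintegral_FTC.
  - by rewrite lerD2l lerNl (le_trans _ (ler0n _ n))// oppr_le0.
  - exact: continuous_subspaceT.
  - apply: continuous_subspaceT => x; apply: cvgM; first exact: cvg_cst.
    by apply: cvgM; [exact: cf|exact: continuous_normal_pdf'].
  - move=> x _; have := fg x; have := is_derive_normal_pdf x => ? ?.
    apply: is_derive_eq; rewrite /h /GRing.scale/=.
    by field.
(* Boundary terms are of order [1 / n], since [(x - m) ^ 2 * p x] is at most [K]. *)
have pb n x : `|x - m| = n.+1%:R ->
    `|s ^+ 2 * (f x * p x)| <= (2 * s ^+ 2 * A * K) * n.+1%:R^-1.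
  move=> xn; have n1 : (1:R) <= n.+1%:R by rewrite ler1n.
  have := sqr_normal_pdf_ub x; rewrite -(real_normK (num_real (x - m))) xn => h1.
  rewrite (normrM (s ^+ 2)) (normrM (f x)) (ger0_norm (p0 x)) (ger0_norm (ltW s2_gt0)).
  have h2 := fA x; rewrite xn in h2.
  rewrite ler_pdivlMr ?ltr0n//.
  have := p0 x; have := normr_ge0 (f x); move: (p x) (`|f x|) h1 h2 => P F h1 h2 F0 P0.
  move: (n.+1%:R) n1 h1 h2 => N1 n1 h1 h2.
  have h3 : F * N1 <= 2 * A * N1 ^+ 2.
    have h2' : F <= A * (2 * N1).
      by apply: (le_trans h2); apply: ler_wpM2l => //; lra.
    have -> : 2 * A * N1 ^+ 2 = A * (2 * N1) * N1 by ring.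
    by apply: ler_wpM2r => //; lra.
  have h4 : F * N1 * P <= 2 * A * (N1 ^+ 2 * P).
    by rewrite [2 * A * _]mulrA; apply: ler_wpM2r.
  have h5 : 2 * A * (N1 ^+ 2 * P) <= 2 * A * K by apply: ler_wpM2l; lra.
  have -> : s ^+ 2 * (F * P) * N1 = s ^+ 2 * (F * N1 * P) by ring.
  have -> : 2 * s ^+ 2 * A * K = s ^+ 2 * (2 * A * K) by ring.
  by rewrite ler_pM2l// (le_trans h4).
pose u n := \int[mu]_x ((fun x => h x * p x) \_ (J n.+1)) x.
have u0 : u n @[n --> \oo] --> (0 : R).
  apply: (@cvg0_harmonic_bound _ _ (2 * (2 * s ^+ 2 * A * K))) => n.
  rewrite /u JE; apply: le_trans (ler_normD _ _) _.
  rewrite mulNr normrN -mulrA [leRHS]mulrDl !mul1r.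
  apply: lerD; apply: pb; first by rewrite addrAC subrr add0r normr_nat.
  by rewrite addrAC subrr add0r normrN normr_nat.
rewrite -(cvg_lim (@Rhausdorff R) u0); apply/esym/cvg_lim => //.
rewrite /u (cvg_shiftS (fun n => \int[mu]_x ((fun x => h x * p x) \_ (J n)) x)).
exact: cvgJ.
Unshelve. all: end_near. Qed.

End stein.

Section normal_moments.
Context (R : realType) (m s : R).
Hypothesis s0 : s != 0.
Local Notation N := (@normal_prob R m s).

Lemma normal_mean : N.-integrable [set: R] (EFin \o (fun x => x - m)) /\
  \int[N]_x (x - m) = 0.
Proof.
have [|||I E] := @stein_identity R m s s0 (cst 1) (cst 0) 1 (fun x => _).
- by move=> x; exact: cvg_cst.
- by move=> x; rewrite normr1 mul1r lerDl.
- by move=> x; rewrite normr0.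
have e : (fun x : R => x - m) = (fun x => (x - m) * cst 1 x).
  by apply/funext => x /=; rewrite mulr1.
rewrite e; split => //.
by rewrite -[LHS]/(\int[N]_x ((x - m) * cst 1 x)) E Rintegral_cst// mul0r mulr0.
Qed.

Lemma normal_variance : \int[N]_x ((x - m) ^+ 2) = s ^+ 2.
Proof.
have [||||I E] := @stein_identity R m s s0 (fun x => x - m) (cst 1) 1.
- by move=> x; apply: is_derive_eq; rewrite subr0.
- by move=> x; exact: cvg_cst.
- by move=> x; rewrite mul1r lerDr.
- by move=> x; rewrite normr1.
under eq_Rintegral do rewrite expr2.
by rewrite E Rintegral_cst//= probability_setT /= !mulr1.
Qed.

Let F (c t : R) := \int[N]_x cos (t * (x - m) + c).

Let continuous_affine (t c : R) : continuous (fun x : R => t * (x - m) + c).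
Proof.
move=> x; apply: cvgD; last exact: cvg_cst.
by apply: cvgM; [exact: cvg_cst|apply: cvgB; [exact: cvg_id|exact: cvg_cst]].
Qed.

Let continuous_cos_affine (t c : R) :
  continuous (fun x : R => cos (t * (x - m) + c)).
Proof.
move=> x; apply: (@cvg_comp _ _ _ _ cos); first exact: continuous_affine.
exact: continuous_cos.
Qed.

Let is_derive_F c t : is_derive t (1 : R) (F c) (- s ^+ 2 * t * F c t).
Proof.
pose f (t x : R) := cos (t * (x - m) + c).
have df (u x : R) : is_derive u (1 : R) (f ^~ x)
    (- sin (u * (x - m) + c) * (x - m)).
  have h : is_derive u (1 : R) (fun u : R => u * (x - m) + c) (x - m).
    by apply: is_derive_eq; rewrite /GRing.scale/=; ring.
  exact: (@is_derive1_comp R cos (fun u : R => u * (x - m) + c) u _ _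
    (is_derive_cos _) h).
have d1 u x : partial1of2 f u x = - ((x - m) * sin (u * (x - m) + c)).
  rewrite /partial1of2 derive1E; have [_ ->] := df u x; ring.
have mf u : measurable_fun [set: R] (f u).
  by apply: continuous_measurable_fun; exact: continuous_cos_affine.
have If u : N.-integrable [set: R] (EFin \o f u).
  apply: (@bounded_integrable _ _ _ N _ _ 1); first exact: measurableT.
    exact: mf.
  by move=> x _; exact: cos_max.
have [I1 _] := normal_mean.
have tI : `]t - 1, t + 1[%classic t by rewrite /= in_itv/=; lra.
have ub u x : `]t - 1, t + 1[%classic u -> [set: R] x ->
    `|partial1of2 f u x| <= `|x - m|.
  move=> _ _; rewrite d1 normrN normrM ler_piMr//; exact: sin_max.
have D := @derivable_under_integral R _ _ N f _ measurableT t (t - 1) (t + 1)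
   tI (fun u _ => If u) (fun u x _ _ => @ex_derive _ _ _ _ _ _ _ (df u x))
   (fun x => `|x - m|) (fun x => normr_ge0 _) (integrable_abse I1) ub.
have E := @differentiation_under_integral R _ _ N f _ measurableT t (t - 1) (t + 1)
   tI (fun u _ => If u) (fun u x _ _ => @ex_derive _ _ _ _ _ _ _ (df u x))
   (fun x => `|x - m|) (fun x => normr_ge0 _) (integrable_abse I1) ub.
apply: DeriveDef; first exact: D.
rewrite -derive1E E.
under eq_Rintegral do rewrite d1.
have [||||I2 E2] := @stein_identity R m s s0
  (fun x => - sin (t * (x - m) + c)) (fun x => - (cos (t * (x - m) + c) * t))
  (1 + `|t|).
- move=> x; have h : is_derive x (1 : R) (fun x : R => t * (x - m) + c) t.
    by apply: is_derive_eq; rewrite /GRing.scale/=; ring.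
  have := @is_derive1_comp R sin (fun x : R => t * (x - m) + c) x _ _
    (is_derive_sin _) h => h2.
  exact: is_deriveN.
- move=> x; apply: cvgN; apply: cvgM; last exact: cvg_cst.
  exact: continuous_cos_affine.
- move=> x; rewrite normrN (le_trans (sin_max _))// -[leLHS]mulr1.
  by apply: ler_pM => //; rewrite lerDl.
- move=> x; rewrite normrN normrM ler_wpDl// ler_piMl//; exact: cos_max.
under eq_Rintegral do rewrite -mulrN.
rewrite E2.
transitivity (s ^+ 2 * \int[N]_x (- t * f t x)).
  by congr (_ * _); apply: eq_Rintegral => x _; rewrite /f; ring.
by rewrite RintegralZl// -/(F c t); ring.
Qed.

(** Stein's identity turns differentiation in [t] into multiplication by
    [- s ^ 2 * t]; the phase [c] treats cosine and sine at once. *)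
Lemma normal_cos (t c : R) :
  \int[N]_x cos (t * (x - m) + c) = cos c * expR (- (s ^+ 2 * t ^+ 2 / 2)).
Proof.
pose G (t : R) := F c t * expR (s ^+ 2 * t ^+ 2 / 2).
have dG u : is_derive u (1 : R) G 0.
  have h : is_derive u (1 : R) (fun t : R => s ^+ 2 * t ^+ 2 / 2) (s ^+ 2 * u).
    by apply: is_derive_eq; rewrite /GRing.scale/=; field.
  have h2 := @is_derive1_comp R expR (fun t : R => s ^+ 2 * t ^+ 2 / 2) u _ _
    (is_derive_expR _) h.
  have h3 := is_derive_F c u.
  have := @is_deriveM R _ _ _ _ _ _ _ h3 h2.
  by move=> h4; apply: (@is_derive_eq _ _ _ _ _ _ _ _ h4); rewrite /GRing.scale/=; ring.
have := is_derive_0_is_cst t 0 dG; rewrite /G expr0n/= mulr0 mul0r expR0 mulr1.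
rewrite /F; under [RHS]eq_Rintegral do rewrite mul0r add0r.
rewrite Rintegral_cst//= probability_setT mulr1 => <-.
by rewrite -[RHS]mulrA -expRD subrr expR0 mulr1.
Qed.

End normal_moments.

Section normal_random_variable.
Context (R : realType) d (T : measurableType d) (P : probability T R).

Lemma integral_comp_law (X : T -> R) (nu : {measure set (measurableTypeR R) -> \bar R})
    (f : R -> R) : has_law P X nu -> measurable_fun [set: R] f ->
  (\int[P]_w (f (X w))%:E = \int[nu]_x (f x)%:E)%E.
Proof.
move=> [mX XE] mf.
have pushE (g : R -> \bar R) : measurable_fun [set: R] g ->
    (forall x, 0 <= g x)%E -> (\int[P]_w g (X w) = \int[nu]_x g x)%E.
  move=> mg g0; rewrite -(@ge0_integral_pushforward _ _ _ (measurableTypeR R) _ X mX P setT g)//.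
  by apply: eq_measure_integral => A mA _; exact: XE.
have mf' : measurable_fun [set: R] (EFin \o f) by exact/measurable_EFinP.
rewrite [LHS]integralE [RHS]integralE; congr (_ - _)%E.
  rewrite -pushE//; last exact: measurable_funepos.
  by apply: eq_integral => w _; rewrite !funeposE.
rewrite -pushE//; last exact: measurable_funeneg.
by apply: eq_integral => w _; rewrite !funenegE.
Qed.

(** The mean and the variance are those of the parameters, so a centered normal
    variable has characteristic function [exp (- v t ^ 2 / 2)], with [v] the
    variance, whatever parameters describe its law. *)
Lemma centered_normal_cos (X : T -> R) (m s v t c : R) :
  has_law P X (normal_law m s) ->
  \int[P]_w X w = 0 -> \int[P]_w (X w ^+ 2) = v ->
  \int[P]_w cos (t * X w + c) = cos c * expR (- (v * t ^+ 2 / 2)).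
Proof.
rewrite /normal_law => + X0 Xv; have [s0|s0] := eqVneq s 0.
  move=> Xm.
  have E (f : R -> R) : measurable_fun [set: R] f -> \int[P]_w f (X w) = f m.
    move=> mf; rewrite /Rintegral (@integral_comp_law X (@dirac _ (measurableTypeR R) m R))//.
    rewrite integral_dirac//=; last exact/measurable_EFinP.
    by rewrite indicT mul1r.
  have m0 : m = 0 by rewrite -X0 (E id).
  rewrite (E (fun x => cos (t * x + c))); last first.
    apply: continuous_measurable_fun => x.
    apply: (@cvg_comp _ _ _ _ cos); last exact: continuous_cos.
    apply: cvgD; last exact: cvg_cst.
    by apply: cvgM; [exact: cvg_cst|exact: cvg_id].
  have v0 : v = 0.
    by rewrite -Xv (E (fun x => x ^+ 2)) ?m0 ?expr0n//; exact: measurable_funX.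
  by rewrite m0 v0 mulr0 add0r !mul0r oppr0 expR0 mulr1.
move=> Xm.
have E (f : R -> R) : measurable_fun [set: R] f ->
    \int[P]_w f (X w) = \int[@normal_prob R m s]_x f x.
  by move=> mf; rewrite /Rintegral (@integral_comp_law X (normal_prob m s)).
have [I1 E1] := normal_mean m s0.
have m0 : m = 0.
  have := X0; rewrite (E id)//.
  have -> : \int[@normal_prob R m s]_x x = \int[@normal_prob R m s]_x (x - m + m).
    by apply: eq_Rintegral => x _; rewrite subrK.
  rewrite RintegralD//; last exact: finite_measure_integrable_cst.
  by rewrite E1 add0r Rintegral_cst//= probability_setT/= mulr1.
have vs : v = s ^+ 2.
  rewrite -Xv (E (fun x => x ^+ 2)); last exact: measurable_funX.
  rewrite -(normal_variance m s0).
  by apply: eq_Rintegral => x _; rewrite m0 subr0.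
rewrite vs -(normal_cos m s0) (E (fun x => cos (t * x + c))).
  by apply: eq_Rintegral => x _; rewrite m0 subr0.
apply: continuous_measurable_fun => x.
apply: (@cvg_comp _ _ _ _ cos); last exact: continuous_cos.
apply: cvgD; last exact: cvg_cst.
by apply: cvgM; [exact: cvg_cst|exact: cvg_id].
Qed.

End normal_random_variable.

(** * Quadratic functionals of a family with prescribed linear functionals *)

Section gaussian_linearization.
Context (R : realType).

Lemma measurable_cos : measurable_fun [set: R] (@cos R).
Proof. by apply: continuous_measurable_fun => x; exact: continuous_cos. Qed.

Context d (T : measurableType d) (P : probability T R).
Variables (n : nat) (X : nat -> T -> R).
Hypothesis mX : forall i, (i < n)%N -> measurable_fun [set: T] (X i).

Definition linear_form (a : nat -> R) (w : T) : R := \sum_(i < n) a i * X i w.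

Lemma measurable_linear_form a : measurable_fun [set: T] (linear_form a).
Proof.
apply: measurable_sum => i; apply: measurable_funM => //; exact: mX.
Qed.

Definition exp_quad (s : seq (nat -> R)) (w : T) : R :=
  expR (- (\sum_(b <- s) linear_form b w ^+ 2) / 2).

Lemma measurable_exp_quad s : measurable_fun [set: T] (exp_quad s).
Proof.
apply: (measurableT_comp (@measurable_expR R)).
apply: measurable_funM => //; apply: measurable_funN.
by apply: measurable_sum => b; apply: measurable_funX; exact: measurable_linear_form.
Qed.

Lemma exp_quad_ge0 s w : 0 <= exp_quad s w. Proof. exact: expR_ge0. Qed.

Lemma exp_quad_le1 s w : exp_quad s w <= 1.
Proof.
rewrite /exp_quad -[leRHS]expR0 ler_expR mulNr oppr_le0 divr_ge0//.
by apply: sumr_ge0 => b _; exact: sqr_ge0.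
Qed.

(** A squared linear form inside the exponential is traded for a Gaussian
    average over the phase: [exp (- l ^ 2 / 2) * cos c] is the mean of
    [cos (l g + c)] for a standard normal [g]. *)
Lemma exp_quad_cons (s : seq (nat -> R)) (a b : nat -> R) :
  \int[P]_w (exp_quad (b :: s) w * cos (linear_form a w)) =
  \int[@normal_prob R 0 1]_g \int[P]_w
    (exp_quad s w * cos (linear_form (fun i => g * b i + a i) w)).
Proof.
pose f (z : T * measurableTypeR R) :=
  exp_quad s z.1 * cos (linear_form b z.1 * z.2 + linear_form a z.1).
have fE w g : f (w, g) =
    exp_quad s w * cos (linear_form (fun i => g * b i + a i) w).
  rewrite /f/=; congr (_ * cos _); rewrite /linear_form mulr_suml -big_split/=.
  by apply: eq_bigr => i _; ring.
have mf : measurable_fun [set: T * measurableTypeR R] f.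
  apply: measurable_funM; first exact: (measurableT_comp (measurable_exp_quad s)).
  apply: (measurableT_comp measurable_cos); apply: measurable_funD.
    apply: measurable_funM; last exact: measurable_snd.
    exact: (measurableT_comp (measurable_linear_form b)).
  exact: (measurableT_comp (measurable_linear_form a)).
have f1 z : `|f z| <= 1.
  rewrite /f normrM (ger0_norm (exp_quad_ge0 _ _)) -[leRHS]mulr1.
  by apply: ler_pM; rewrite ?exp_quad_ge0 ?exp_quad_le1 ?cos_max.
transitivity (\int[P]_w \int[@normal_prob R 0 1]_g f (w, g)).
  apply: eq_Rintegral => w _.
  transitivity (exp_quad s w * \int[@normal_prob R 0 1]_g
      cos (linear_form b w * (g - 0) + linear_form a w)).
    rewrite normal_cos ?oner_neq0// expr1n mul1r mulrCA mulrC.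
    congr (_ * _); rewrite /exp_quad big_cons -expRD; congr expR; by field.
  rewrite -RintegralZl//; last first.
    apply: (@bounded_integrable _ _ _ (@normal_prob R 0 1) _ _ 1) => //.
      apply: (measurableT_comp measurable_cos); apply: measurable_funD => //.
      by apply: measurable_funM => //; exact: measurable_funB.
    by move=> g _; exact: cos_max.
  by apply: eq_Rintegral => g _; rewrite /f/= subr0.
rewrite (bounded_Fubini P (@normal_prob R 0 1) mf f1).
by apply: eq_Rintegral => g _; apply: eq_Rintegral => w _; rewrite fE.
Qed.

End gaussian_linearization.

(** Induction on the number of squares: [exp_quad_cons] removes one square at
    the price of an average over the linear form inside the cosine. *)
Lemma eq_exp_quad (R : realType) (n : nat)
    d (T : measurableType d) (P : probability T R) (X : nat -> T -> R)
    d' (T' : measurableType d') (Q : probability T' R) (Y : nat -> T' -> R) :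
  (forall i, (i < n)%N -> measurable_fun [set: T] (X i)) ->
  (forall i, (i < n)%N -> measurable_fun [set: T'] (Y i)) ->
  (forall a, \int[P]_w cos (linear_form n X a w) =
             \int[Q]_w cos (linear_form n Y a w)) ->
  forall s : seq (nat -> R),
    \int[P]_w exp_quad n X s w = \int[Q]_w exp_quad n Y s w.
Proof.
move=> mX mY XY s.
suff H a : \int[P]_w (exp_quad n X s w * cos (linear_form n X a w)) =
           \int[Q]_w (exp_quad n Y s w * cos (linear_form n Y a w)).
  have l0 (U : Type) (V : nat -> U -> R) w : cos (\sum_(i < n) cst 0 i * V i w) = 1.
    by rewrite big1 ?cos0// => i _; rewrite mul0r.
  have := H (cst 0); rewrite /linear_form.
  under eq_Rintegral do rewrite l0 mulr1.
  by under [RHS]eq_Rintegral do rewrite l0 mulr1.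
elim: s a => [|b s IH] a.
  rewrite /exp_quad.
  under eq_Rintegral do rewrite big_nil oppr0 mul0r expR0 mul1r.
  by under [RHS]eq_Rintegral do rewrite big_nil oppr0 mul0r expR0 mul1r.
rewrite (exp_quad_cons P mX) (exp_quad_cons Q mY).
by apply: eq_Rintegral => g _; exact: IH.
Qed.

(** * Pairs of variables in the unit square are determined by their moments *)

Section moment_determinacy.
Context (R : realType).

Let bernoulli_ineq (u : R) n : 0 <= u <= 1 -> 1 - n%:R * u <= (1 - u) ^+ n.
Proof.
move=> /andP[u0 u1]; elim: n => [|n IH]; first by rewrite mul0r subr0 expr0.
rewrite exprS; apply: le_trans (ler_wpM2l _ IH); last by lra.
rewrite -natr1; have : 0 <= n%:R * u ^+ 2 by rewrite mulr_ge0// sqr_ge0.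
by rewrite expr2; lra.
Qed.

Let cvg_natM_exprn (q : R) : 0 <= q < 1 ->
  n%:R * q ^+ n @[n --> \oo] --> (0 : R).
Proof.
move=> /andP[q0 q1]; pose s := Num.sqrt q.
have s0 : 0 <= s by exact: sqrtr_ge0.
have s1 : s < 1 by rewrite -[ltRHS]sqrtr1 ltr_sqrt.
have ub n : n%:R * s ^+ n * (1 - s) <= 1 - s ^+ n.
  elim: n => [|n IH]; first by rewrite expr0 !mul0r subrr.
  have sn1 : s ^+ n.+1 <= 1 by rewrite exprn_ile1// ltW.
  have h : 0 <= (1 - s) * (1 - s ^+ n.+1) by rewrite mulr_ge0 ?subr_ge0// ltW.
  have h2 := ler_wpM2l s0 IH.
  rewrite -natr1; move: h h2; rewrite exprS; nra.
have C n : `|n%:R * q ^+ n| <= (1 - s)^-1 * s ^+ n.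
  rewrite ger0_norm ?mulr_ge0 ?exprn_ge0//.
  have -> : q ^+ n = s ^+ n * s ^+ n by rewrite -exprMn -expr2 sqr_sqrtr.
  rewrite mulrA.
  rewrite ler_wpM2r ?exprn_ge0// -(ler_pM2r (x := 1 - s)) ?subr_gt0//.
  rewrite mulVf ?subr_eq0 ?gt_eqF// (le_trans (ub n))// gerBl exprn_ge0//.
have hC : (1 - s)^-1 * s ^+ n @[n --> \oo] --> (0:R).
  rewrite -[X in _ --> X](mulr0 (1 - s)^-1); apply: cvgMr.
  by apply: cvg_expr; rewrite ger0_norm.
apply: (@squeeze_cvgr _ _ _ _ (fun n => - ((1 - s)^-1 * s ^+ n))
  (fun n => (1 - s)^-1 * s ^+ n)) => //.
  by apply: nearW => n; rewrite -ler_norml.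
by rewrite -[X in _ --> X]oppr0; exact: cvgN.
Qed.

(** With [N] about [n / r ^ n], the power [(1 - u ^ n) ^ N] tends to 1 if
    [u < r], since then [N u ^ n] tends to 0, and to 0 if [u >= r], since then
    [N u ^ n >= n]. *)
Lemma ray_polynomials (r : R) : exists p : nat -> {poly R},
  (forall n u, 0 <= u <= 1 -> 0 <= (p n).[u] <= 1) /\
  (forall u, 0 <= u <= 1 -> (p n).[u] @[n --> \oo] --> ((u < r)%R%:R : R)).
Proof.
have [r0|r0] := leP r 0.
  exists (fun=> 0); split=> [n u _|u /andP[u0 _]]; first by rewrite horner0 lexx ler01.
  rewrite ltNge (le_trans r0 u0)/=.
  by under eq_fun do rewrite horner0; exact: cvg_cst.
have [r1|r1] := ltP 1 r.
  exists (fun=> 1); split=> [n u _|u /andP[_ u1]]; first by rewrite hornerC lexx ler01.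
  rewrite (le_lt_trans u1 r1).
  by under eq_fun do rewrite hornerC; exact: cvg_cst.
pose N n := (Num.truncn (n%:R / r ^+ n)).+1.
have N_ge n : n%:R / r ^+ n <= (N n)%:R.
  have /andP[_ /ltW] := truncn_itv (divr_ge0 (ler0n R n) (exprn_ge0 n (ltW r0))).
  by [].
have N_le n : (N n)%:R <= n%:R / r ^+ n + 1.
  by rewrite /N -natr1 lerD2r truncn_le divr_ge0 ?exprn_ge0 ?(ltW r0).
pose p n : {poly R} := (1 - 'X^n) ^+ N n.
have pE n u : (p n).[u] = (1 - u ^+ n) ^+ N n by rewrite !hornerE.
exists p; split=> [n u u01|u u01].
  have /andP[u0 u1] : 0 <= u ^+ n <= 1.
    by move: u01 => /andP[u0 u1]; rewrite exprn_ge0//= exprn_ile1.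
  by rewrite pE exprn_ge0 ?subr_ge0//= exprn_ile1 ?subr_ge0// gerBl.
under eq_fun do rewrite pE.
have un n : 0 <= u ^+ n <= 1.
  by move: u01 => /andP[u0 u1]; rewrite exprn_ge0//= exprn_ile1.
move: u01 => /andP[u0 u1].
have [ur|ru] := ltP u r => /=.
  have q01 : 0 <= u / r < 1 by rewrite divr_ge0 ?(ltW r0)//= ltr_pdivrMr// mul1r.
  apply: (@squeeze_cvgr _ _ _ _ (fun n => 1 - (n%:R * (u / r) ^+ n + u ^+ n))
    (fun=> 1)); last exact: cvg_cst.
  - apply: nearW => n; apply/andP; split; last first.
      by rewrite exprn_ile1 ?subr_ge0 ?(andP (un n)).2// gerBl (andP (un n)).1.
    apply: le_trans (bernoulli_ineq (N n) (un n)); rewrite lerD2l lerN2.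
    apply: le_trans (ler_wpM2r (andP (un n)).1 (N_le n)) _.
    by rewrite mulrDl mul1r expr_div_n mulrA mulrAC.
  - rewrite -[X in _ --> X]subr0; apply: cvgB; first exact: cvg_cst.
    rewrite -[X in _ --> X](addr0 0); apply: cvgD; first exact: cvg_natM_exprn.
    by apply: cvg_expr; rewrite ger0_norm// (lt_le_trans ur).
apply: (@cvg0_harmonic_bound _ _ 1) => n; rewrite mul1r.
have /andP[a0 a1] := un n.
rewrite ger0_norm ?exprn_ge0 ?subr_ge0//.
have h1 : (1 - u ^+ n) ^+ N n <= expR (- (u ^+ n)) ^+ N n.
  by apply: lerXn2r; rewrite ?nnegrE ?subr_ge0 ?expR_ge0//; exact: expR_ge1Dx.
apply: (le_trans h1); rewrite -expRM_natl mulrN expRN lef_pV2 ?posrE ?expR_gt0//.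
apply: le_trans (expR_ge1Dx _); rewrite -natr1 addrC lerD2l.
apply: le_trans (ler_wpM2r a0 (N_ge n)).
rewrite -mulrA -{1}[n%:R]mulr1 ler_wpM2l// mulrC ler_pdivlMr ?exprn_gt0// mul1r.
by apply: lerXn2r => //; rewrite nnegrE// ltW.
Qed.

(** Open left rays are stable under intersection and generate the Borel sets.
    General finite measures are needed: the restrictions of a probability to
    events are compared with it. *)
Lemma eq_law_rays d (T : measurableType d) d' (T' : measurableType d')
    (m : {measure set T -> \bar R}) (m' : {measure set T' -> \bar R})
    (U : T -> R) (U' : T' -> R) :
  (m [set: T] < +oo)%E ->
  measurable_fun [set: T] U -> measurable_fun [set: T'] U' ->
  (forall r, m (U @^-1` `]-oo, r[) = m' (U' @^-1` `]-oo, r[)) ->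
  forall A, measurable A -> m (U @^-1` A) = m' (U' @^-1` A).
Proof.
move=> moo mU mU' rays A mA.
have mUn (n : nat) : measurable (U @^-1` `]-oo, n%:R[).
  by rewrite -[X in measurable X]setTI; exact: mU.
unshelve epose (m1 := (@pushforward _ _ T (measurableTypeR R) R m U : {measure set (measurableTypeR R) -> \bar R})); first exact: mU.
unshelve epose (m2 := (@pushforward _ _ T' (measurableTypeR R) R m' U' : {measure set (measurableTypeR R) -> \bar R})); first exact: mU'.
rewrite -[LHS]/(m1 A) -[RHS]/(m2 A).
apply: (@measure_unique _ R (measurableTypeR R)
  [set A | exists r, A = `]-oo, r[%classic] (fun n => `]-oo, n%:R[%classic)
  _ _ _ _ m1 m2) => //.
- exact: RGenInftyO.measurableE.
- move=> _ _ [r ->] [s ->]; exists (Num.min r s).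
  by apply/seteqP; split => x /=; rewrite !in_itv/= lt_min => /andP.
- by move=> n; exists n%:R.
- apply/seteqP; split => // x _; exists (Num.truncn x).+1 => //=.
  rewrite in_itv/=; exact: truncnS_gt.
- by move=> _ [r ->]; exact: rays.
- move=> n; rewrite -[ltLHS]/(m (U @^-1` `]-oo, n%:R[)).
  by apply: le_lt_trans moo; apply: le_measure => //; rewrite inE.
Qed.

Variables (d : measure_display) (T : measurableType d) (P : probability T R).
Variables (d' : measure_display) (T' : measurableType d') (Q : probability T' R).
Variables (U W : T -> R) (U' W' : T' -> R).
Hypotheses (mU : measurable_fun [set: T] U) (mW : measurable_fun [set: T] W).
Hypotheses (mU' : measurable_fun [set: T'] U') (mW' : measurable_fun [set: T'] W').
Hypotheses (U01 : forall w, 0 <= U w <= 1) (W01 : forall w, 0 <= W w <= 1).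
Hypotheses (U'01 : forall w, 0 <= U' w <= 1) (W'01 : forall w, 0 <= W' w <= 1).
Hypothesis moments : forall i j,
  \int[P]_w (U w ^+ i * W w ^+ j) = \int[Q]_w (U' w ^+ i * W' w ^+ j).

Let Rintegral_horner d0 (S : measurableType d0) (m : probability S R)
    (u v : S -> R) (p q : {poly R}) :
  measurable_fun [set: S] u -> measurable_fun [set: S] v ->
  (forall w, 0 <= u w <= 1) -> (forall w, 0 <= v w <= 1) ->
  \int[m]_w (p.[u w] * q.[v w]) = \sum_(i < size p) \sum_(j < size q)
    p`_i * q`_j * \int[m]_w (u w ^+ i * v w ^+ j).
Proof.
move=> mu mv u01 v01.
have I (i j : nat) : m.-integrable [set: S] (EFin \o (fun w => u w ^+ i * v w ^+ j)).
  apply: (@bounded_integrable _ _ _ m _ _ 1) => //.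
    by apply: measurable_funM; exact: measurable_funX.
  move=> w _; have /andP[u0 u1] := u01 w; have /andP[v0 v1] := v01 w.
  by rewrite ger0_norm ?mulr_ge0 ?exprn_ge0// mulr_ile1 ?exprn_ge0 ?exprn_ile1.
transitivity (\int[m]_w \sum_(i < size p) \sum_(j < size q)
    p`_i * q`_j * (u w ^+ i * v w ^+ j)).
  apply: eq_Rintegral => w _; rewrite !horner_coef big_distrlr/=.
  by apply: eq_bigr => i _; apply: eq_bigr => j _; ring.
have J (i : 'I_(size p)) : m.-integrable [set: S] (EFin \o (fun w =>
    \sum_(j < size q) p`_i * q`_j * (u w ^+ i * v w ^+ j))) /\
    \int[m]_w (\sum_(j < size q) p`_i * q`_j * (u w ^+ i * v w ^+ j)) =
    \sum_(j < size q) p`_i * q`_j * \int[m]_w (u w ^+ i * v w ^+ j).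
  have [|I1 E1] := @Rintegral_sum _ _ _ m setT _ (index_enum 'I_(size q))
    (fun j w => p`_i * q`_j * (u w ^+ i * v w ^+ j)) measurableT.
    by move=> j _; apply: integrableRZl.
  by split => //; rewrite E1; apply: eq_bigr => j _; rewrite RintegralZl.
have [|_ ->] := @Rintegral_sum _ _ _ m setT _ (index_enum 'I_(size p))
    (fun i w => \sum_(j < size q) p`_i * q`_j * (u w ^+ i * v w ^+ j)) measurableT.
  by move=> i _; have [] := J i.
by apply: eq_bigr => i _; have [] := J i.
Qed.

Let eq_horner (p q : {poly R}) :
  \int[P]_w (p.[U w] * q.[W w]) = \int[Q]_w (p.[U' w] * q.[W' w]).
Proof.
rewrite !Rintegral_horner//.
by apply: eq_bigr => i _; apply: eq_bigr => j _; rewrite moments.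
Qed.

Let cvg_quadrant d0 (S : measurableType d0) (m : probability S R)
    (u v : S -> R) (p q : nat -> {poly R}) (r s : R) :
  measurable_fun [set: S] u -> measurable_fun [set: S] v ->
  (forall w, 0 <= u w <= 1) -> (forall w, 0 <= v w <= 1) ->
  (forall n x, 0 <= x <= 1 -> 0 <= (p n).[x] <= 1) ->
  (forall n x, 0 <= x <= 1 -> 0 <= (q n).[x] <= 1) ->
  (forall x, 0 <= x <= 1 -> (p n).[x] @[n --> \oo] --> ((x < r)%R%:R : R)) ->
  (forall x, 0 <= x <= 1 -> (q n).[x] @[n --> \oo] --> ((x < s)%R%:R : R)) ->
  \int[m]_w ((p n).[u w] * (q n).[v w]) @[n --> \oo] -->
    fine (m (u @^-1` `]-oo, r[ `&` v @^-1` `]-oo, s[)).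
Proof.
move=> mu mv u01 v01 p01 q01 pr qs.
have mhorner (k : {poly R}) (x : S -> R) : measurable_fun [set: S] x ->
    measurable_fun [set: S] (fun w => k.[x w]).
  move=> mx; apply: (measurableT_comp _ mx).
  by apply: continuous_measurable_fun => y; exact: continuous_horner.
have mA : measurable (u @^-1` `]-oo, r[ `&` v @^-1` `]-oo, s[).
  by apply: measurableI; rewrite -[X in measurable X]setTI; [exact: mu|exact: mv].
have -> : fine (m (u @^-1` `]-oo, r[ `&` v @^-1` `]-oo, s[)) =
    \int[m]_w ((u w < r)%R%:R * (v w < s)%R%:R).
  transitivity (\int[m]_w \1_(u @^-1` `]-oo, r[ `&` v @^-1` `]-oo, s[) w).
    by rewrite /Rintegral integral_indic// setIT.
  apply: eq_Rintegral => w _; rewrite indicE in_setI -natrM mulnb.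
  by congr ((_ && _)%:R); apply/idP/idP; rewrite ?inE/= in_itv.
have [||||//|_ +] := @dominated_cvg_Rintegral _ _ _ m setT
  (fun n w => (p n).[u w] * (q n).[v w])
  (fun w => (u w < r)%R%:R * (v w < s)%R%:R) (cst 1) measurableT.
- by move=> n; apply: measurable_funM; exact: mhorner.
- apply: (@measurable_fun_cvg _ _ _ _ (fun n w => (p n).[u w] * (q n).[v w])).
    by move=> n; apply: measurable_funM; exact: mhorner.
  by move=> w _; apply: cvgM; [exact: pr|exact: qs].
- by apply: aeW => w _; apply: cvgM; [exact: pr|exact: qs].
- exact: finite_measure_integrable_cst.
- move=> n w _; have /andP[p0 p1] := p01 n _ (u01 w); have /andP[q0 q1] := q01 n _ (v01 w).
  by rewrite ger0_norm ?mulr_ge0// mulr_ile1.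
- by [].
Qed.

Let eq_quadrants (r s : R) :
  P (U @^-1` `]-oo, r[ `&` W @^-1` `]-oo, s[) =
  Q (U' @^-1` `]-oo, r[ `&` W' @^-1` `]-oo, s[).
Proof.
have [p [p01 pr]] := ray_polynomials r.
have [q [q01 qs]] := ray_polynomials s.
have c1 := @cvg_quadrant _ _ P _ _ _ _ _ _ mU mW U01 W01 p01 q01 pr qs.
have c2 := @cvg_quadrant _ _ Q _ _ _ _ _ _ mU' mW' U'01 W'01 p01 q01 pr qs.
rewrite -[LHS]fineK ?fin_num_measure//; last first.
  by apply: measurableI; rewrite -[X in measurable X]setTI; [exact: mU|exact: mW].
rewrite -[RHS]fineK ?fin_num_measure//; last first.
  by apply: measurableI; rewrite -[X in measurable X]setTI; [exact: mU'|exact: mW'].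
rewrite -(cvg_lim (@Rhausdorff R) c1) -(cvg_lim (@Rhausdorff R) c2).
by congr (limn _)%:E; apply/funext => n; exact: eq_horner.
Qed.

Let eq_rectangles (A B : set R) : measurable A -> measurable B ->
  P (U @^-1` A `&` W @^-1` B) = Q (U' @^-1` A `&` W' @^-1` B).
Proof.
move=> mA mB.
have mUV d0 (S : measurableType d0) (u : S -> R) C :
    measurable_fun [set: S] u -> measurable C -> measurable (u @^-1` C).
  by move=> mu mC; rewrite -[X in measurable X]setTI; exact: mu.
have fin d0 (S : measurableType d0) (m : probability S R) D (mD : measurable D) :
    (mrestr m mD setT < +oo)%E.
  rewrite /mrestr setTI; apply: (le_lt_trans (probability_le1 m mD)).
  exact: ltry.
have half s : P (U @^-1` A `&` W @^-1` `]-oo, s[) =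
    Q (U' @^-1` A `&` W' @^-1` `]-oo, s[).
  have mD := mUV _ _ W `]-oo, s[%classic mW (measurable_itv _).
  have mD' := mUV _ _ W' `]-oo, s[%classic mW' (measurable_itv _).
  apply: (@eq_law_rays _ _ _ _ (mrestr P mD) (mrestr Q mD')) => //.
    exact: fin.
  by move=> r; exact: eq_quadrants.
rewrite setIC [in RHS]setIC.
have mD := mUV _ _ U A mU mA.
have mD' := mUV _ _ U' A mU' mA.
apply: (@eq_law_rays _ _ _ _ (mrestr P mD) (mrestr Q mD')) => //.
  exact: fin.
move=> s; have := half s; rewrite setIC [in X in _ = X -> _]setIC; exact.
Qed.

(** Polynomials in [U] and [W] have the same mean under [P] and [Q]; by
    dominated convergence so do indicators of quadrants, which generate. *)
Lemma eq_law_of_moments (g : R * R -> R) : measurable_fun [set: R * R] g ->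
  eq_in_law P Q (fun w => g (U w, W w)) (fun w => g (U' w, W' w)).
Proof.
move=> mg.
have mUW : measurable_fun [set: T] (fun w => (U w, W w)) by exact: measurable_fun_pair.
have mUW' : measurable_fun [set: T'] (fun w => (U' w, W' w)) by exact: measurable_fun_pair.
split; [exact: measurableT_comp|exact: measurableT_comp|move=> A mA].
have mgA : measurable (g @^-1` A) by rewrite -[X in measurable X]setTI; exact: mg.
pose C : set (set (R * R)) :=
  [set C | exists A, measurable A /\ exists B, measurable B /\ C = A `*` B].
unshelve epose (m1 := (pushforward P (fun w => (U w, W w)) :
  {measure set (R * R) -> \bar R})); first exact: mUW.
unshelve epose (m2 := (pushforward Q (fun w => (U' w, W' w)) :
  {measure set (R * R) -> \bar R})); first exact: mUW'.
rewrite -[LHS]/(m1 (g @^-1` A)) -[RHS]/(m2 (g @^-1` A)).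
apply: (@measure_unique _ R _ C (fun=> setT) _ _ _ _ m1 m2) => //.
- rewrite measurable_prod_measurableType //; congr (<<s _ >>).
  rewrite predeqE; split => [[X mX [Y mY <-]]|[X [mX [Y [mY ->]]]]].
    by exists X; split => //; exists Y.
  by exists X => //; exists Y.
- move=> /= _ _ [X1 [mX1 [X2 [mX2 ->]]]] [Y1 [mY1 [Y2 [mY2 ->]]]].
  rewrite -setXI; exists (X1 `&` Y1); split; first exact: measurableI.
  by exists (X2 `&` Y2); split => //; exact: measurableI.
- move=> n; exists setT; split; first exact: measurableT.
  by exists setT; split; [exact: measurableT|rewrite setXTT].
- by apply/seteqP; split => // x _; exists 0%N.
- by move=> _ [X [mX [Y [mY ->]]]]; exact: eq_rectangles.
- by move=> n; rewrite -[ltLHS]/(P setT) probability_setT ltry.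
Qed.

End moment_determinacy.

(** * Linear functionals of independent standard normal variables *)

Section weighted_law.
Context (R : realType) d (T : measurableType d) (P : probability T R).
Variables (W : T -> R) (M : R).
Hypotheses (mW : measurable_fun [set: T] W) (W0 : forall w, 0 <= W w).
Hypothesis (WM : forall w, W w <= M).

Definition weighted_measure (A : set T) : \bar R := (\int[P]_(w in A) (W w)%:E)%E.

Let weighted_measure0 : weighted_measure set0 = 0%E.
Proof. by rewrite /weighted_measure integral_set0. Qed.

Let weighted_measure_ge0 A : (0 <= weighted_measure A)%E.
Proof. by apply: integral_ge0 => w _; rewrite lee_fin. Qed.

Let weighted_measure_sigma_additive : semi_sigma_additive weighted_measure.
Proof.
apply: semi_sigma_additive_nng_induced => [|w]; first exact/measurable_EFinP.
by rewrite lee_fin.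
Qed.

HB.instance Definition _ := isMeasure.Build _ _ _ weighted_measure
  weighted_measure0 weighted_measure_ge0 weighted_measure_sigma_additive.

(** If the weight [W] does not see the law [nu] of [Z] on events, then it does
    not see it on bounded functions either. *)
Lemma Rintegral_weighted_comp (Z : T -> R) (nu : probability (measurableTypeR R) R)
    (k : R) (h : R -> R) (C : R) :
  measurable_fun [set: T] Z -> 0 <= k ->
  (forall A, measurable A ->
     \int[P]_(w in Z @^-1` A) W w = k * fine (nu A)) ->
  measurable_fun [set: R] h -> (forall x, `|h x| <= C) ->
  \int[P]_w (W w * h (Z w)) = k * \int[nu]_x h x.
Proof.
move=> mZ k0 ZA mh hC.
have mZA A : measurable A -> measurable (Z @^-1` A).
  by move=> mA; rewrite -[X in measurable X]setTI; exact: mZ.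
have ge0 (f : R -> R) : measurable_fun [set: R] f -> (forall x, 0 <= f x) ->
    (\int[P]_w (W w * f (Z w))%:E = k%:E * \int[nu]_x (f x)%:E)%E.
  move=> mf f0.
  rewrite -(@ge0_integral_mscale _ (measurableTypeR R) R nu setT measurableT (NngNum k0) (EFin \o f))//;
    last 2 first.
  - exact/measurable_EFinP.
  - by move=> x _; rewrite lee_fin.
  transitivity (\int[weighted_measure]_w (f (Z w))%:E)%E.
    rewrite [RHS](@ge0_integral_density _ T R P _ W)//.
    - by apply: eq_integral => w _; rewrite EFinM muleC.
    - by apply/measurable_EFinP; exact: measurableT_comp.
    - by move=> w; rewrite lee_fin.
  rewrite -(@ge0_integral_pushforward _ _ _ (measurableTypeR R) _ Z mZ weighted_measure setT (EFin \o f))//; last 2 first.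
  - exact/measurable_EFinP.
  - by move=> x _; rewrite lee_fin.
  apply: eq_measure_integral => A mA _; rewrite /mscale/=.
  rewrite -[LHS]fineK; last first.
    apply: integrable_fin_num; first exact: mZA.
    by apply: (@bounded_integrable _ _ _ P _ _ M) => //; [exact: mZA|exact: measurable_funTS|move=> w _; rewrite ger0_norm].
  rewrite [LHS](_ : _ = (k * fine (nu A))%:E); last by rewrite -ZA.
  by rewrite EFinM fineK// fin_num_measure.
have C0 : 0 <= C by apply: le_trans (hC 0).
have IW (f : R -> R) (D : R) : measurable_fun [set: R] f -> (forall x, `|f x| <= D) ->
    P.-integrable setT (EFin \o (fun w => W w * f (Z w))).
  move=> mf fD; apply: (@bounded_integrable _ _ _ P _ _ (M * D)) => //.
    by apply: measurable_funM => //; exact: measurableT_comp.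
  by move=> w _; rewrite normrM ler_pM// ger0_norm.
have E (f : R -> R) : measurable_fun [set: R] f -> (forall x, 0 <= f x <= C + C) ->
    \int[P]_w (W w * f (Z w)) = k * \int[nu]_x f x.
  move=> mf f0; rewrite /Rintegral ge0//; last by move=> x; have /andP[] := f0 x.
  rewrite fineM// ; apply: integrable_fin_num => //.
  apply: (@bounded_integrable _ _ _ nu _ _ (C + C)) => //.
  by move=> x _; have /andP[f1 f2] := f0 x; rewrite ger0_norm.
have E1 : \int[P]_w (W w * (h (Z w) + C)) = k * \int[nu]_x (h x + C).
  apply: (E (fun x => h x + C)); first exact: measurable_funD.
  by move=> x; have := hC x; rewrite ler_norml => /andP[? ?]; apply/andP; split; lra.
have E2 : \int[P]_w (W w * C) = k * \int[nu]_x C.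
  apply: (E (cst C)); first exact: measurable_cst.
  by move=> x; rewrite C0/= lerDl.
have Ih : nu.-integrable setT (EFin \o h) by apply: (@bounded_integrable _ _ _ nu _ _ C).
have -> : \int[P]_w (W w * h (Z w)) =
    \int[P]_w (W w * (h (Z w) + C)) - \int[P]_w (W w * C).
  rewrite -RintegralB//.
  - by apply: eq_Rintegral => w _; ring.
  - apply: (IW (fun x => h x + C) (C + C)); first exact: measurable_funD.
    by move=> x; rewrite (le_trans (ler_normD _ _))// lerD// ger0_norm.
  - apply: (IW (cst C) C); first exact: measurable_cst.
    by move=> x; rewrite ger0_norm.
rewrite E1 E2 RintegralD//; last exact: finite_measure_integrable_cst.
by ring.
Qed.

End weighted_law.

Section independent_normals.
Context (R : realType) d (T : measurableType d) (P : probability T R).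
Variable Y : nat -> T -> R.
Hypothesis mY : forall i, measurable_fun [set: T] (Y i).
Hypothesis YN : forall i, has_law P (Y i) (normal_prob 0 1).

Definition cylinder (J : seq nat) (A : nat -> set R) : set T :=
  \bigcap_(i in [set` J]) (Y i @^-1` A i).

Hypothesis indepY : forall (J : seq nat) (A : nat -> set R), uniq J ->
  (forall i, measurable (A i)) ->
  (P (cylinder J A) = \prod_(i <- J) P (Y i @^-1` A i))%E.

Let measurable_preimage i A : measurable A -> measurable (Y i @^-1` A).
Proof. by move=> mA; rewrite -[X in measurable X]setTI; exact: mY. Qed.

Let measurable_cylinder J A : (forall i, measurable (A i)) ->
  measurable (cylinder J A).
Proof.
move=> mA; rewrite /cylinder bigcap_mkcond; apply: bigcapT_measurable => i.
by case: ifP => _; [exact: measurable_preimage|exact: measurableT].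
Qed.

Let cylinder_cons (m : nat) J A (B : set R) : m \notin J ->
  Y m @^-1` B `&` cylinder J A =
  cylinder (m :: J) (fun i => if i == m then B else A i).
Proof.
move=> mJ; apply/seteqP; split => w.
  move=> [wB wJ] i /=; rewrite inE => /orP[/eqP->|iJ]; first by rewrite eqxx.
  by case: eqP => [im|_]; [rewrite -im iJ in mJ|exact: wJ].
move=> h; split; first by have := h m; rewrite /= inE !eqxx; exact.
move=> i iJ; have := h i; rewrite /= inE iJ orbT => /(_ isT).
by case: eqP => // im; rewrite -im /= iJ in mJ *.
Qed.

Let S (a : nat -> R) m w := \sum_(i < m) a i * Y i w.

Let mS a m : measurable_fun [set: T] (S a m).
Proof. by apply: measurable_sum => i; apply: measurable_funM => //; exact: mY. Qed.

Let mcosS c a m : measurable_fun [set: T] (fun w => cos (c + S a m w)).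
Proof.
by apply: (measurableT_comp (@measurable_cos R)); apply: measurable_funD.
Qed.

Let normal_sin (t : R) : \int[@normal_prob R 0 1]_x sin (t * x) = 0.
Proof.
have := @normal_cos R 0 1 (oner_neq0 R) t (- (pi / 2)).
rewrite cosN cos_pihalf mul0r; apply: etrans.
by apply: eq_Rintegral => x _; rewrite subr0 cosBpihalf.
Qed.

Let normal_cos0 (t : R) :
  \int[@normal_prob R 0 1]_x cos (t * x) = expR (- (t ^+ 2 / 2)).
Proof.
have := @normal_cos R 0 1 (oner_neq0 R) t 0.
rewrite cos0 expr1n !mul1r; apply: etrans.
by apply: eq_Rintegral => x _; rewrite subr0 addr0.
Qed.

(** Induction on [m]: the variables of index at least [m] still enter through
    arbitrary events, so that independence lets the next one be integrated out. *)
Let cos_cylinder (a : nat -> R) m c (J : seq nat) A : uniq J ->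
  (forall i, i \in J -> (m <= i)%N) -> (forall i, measurable (A i)) ->
  \int[P]_(w in cylinder J A) cos (c + S a m w) =
  cos c * expR (- (\sum_(i < m) a i ^+ 2) / 2) * fine (P (cylinder J A)).
Proof.
elim: m c J A => [|m IH] c J A uJ Jm mA.
  rewrite big_ord0 oppr0 mul0r expR0 mulr1 -Rintegral_cst; last exact: measurable_cylinder.
  by apply: eq_Rintegral => w _; rewrite /S big_ord0 addr0.
have mJ : m \notin J by apply/negP => /Jm; rewrite ltnn.
set E := cylinder J A; have mE : measurable E by exact: measurable_cylinder.
set q := expR (- (\sum_(i < m) a i ^+ 2) / 2).
have q1 : 0 <= q <= 1.
  rewrite expR_ge0 /q -[leRHS]expR0 ler_expR mulNr oppr_le0 divr_ge0//.
  by apply: sumr_ge0 => i _; exact: sqr_ge0.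
have PE B : measurable B ->
    fine (P (Y m @^-1` B `&` E)) = fine (P E) * fine (normal_prob 0 1 B).
  move=> mB; rewrite cylinder_cons// indepY ?big_cons ?eqxx//=; last 2 first.
  - by rewrite mJ.
  - by move=> i; case: eqP.
  have -> : (\prod_(i <- J) P (Y i @^-1` (if i == m then B else A i)) = P E)%E.
    rewrite indepY//; apply: eq_big_seq => i iJ.
    by case: eqP => // im; rewrite -im iJ in mJ.
  have [_ YB] := YN m.
  rewrite -[P (Y m @^-1` B)]/(pushforward P (Y m) B) YB// fineM ?fin_num_measure//.
  exact: mulrC.
have cosE c' B : measurable B -> \int[P]_(w in Y m @^-1` B `&` E) cos (c' + S a m w) =
    cos c' * q * (fine (P E) * fine (normal_prob 0 1 B)).
  move=> mB; rewrite -PE// cylinder_cons// IH//.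
  - by rewrite /= mJ.
  - by move=> i; rewrite inE => /orP[/eqP->//|/Jm/ltnW].
  - by move=> i; case: eqP.
have W1 (h : R -> R) : measurable_fun [set: R] h -> (forall x, `|h x| <= 1) ->
    \int[P]_w (\1_E w * h (Y m w)) = fine (P E) * \int[@normal_prob R 0 1]_x h x.
  move=> mh h1.
  apply: (@Rintegral_weighted_comp _ _ _ P (\1_E) 1 _ _ _ (Y m) (normal_prob 0 1) _ h 1) => //.
  - by rewrite fine_ge0.
  - move=> B mB; rewrite -PE// /Rintegral integral_indic//; last exact: measurable_preimage.
    by rewrite setIC.
have W2 c' (h : R -> R) : measurable_fun [set: R] h -> (forall x, `|h x| <= 1) ->
    \int[P]_w ((1 + cos (c' + S a m w)) * \1_E w * h (Y m w)) =
    (1 + cos c' * q) * fine (P E) * \int[@normal_prob R 0 1]_x h x.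
  move=> mh h1.
  have cge (x : R) : 0 <= 1 + cos x by have := cos_max x; rewrite ler_norml => /andP[]; lra.
  have cle (x : R) : 1 + cos x <= 2 by have := cos_max x; rewrite ler_norml => /andP[]; lra.
  apply: (@Rintegral_weighted_comp _ _ _ P _ 2 _ _ _ (Y m) (normal_prob 0 1) _ h 1) => //.
  - by apply: measurable_funM => //; exact: measurable_funD.
  - by move=> w; rewrite indicE; case: (_ \in _); rewrite ?mulr1 ?mulr0.
  - rewrite mulr_ge0 ?fine_ge0//.
    have := cos_max c'; rewrite ler_norml => /andP[? ?].
    by move: q1 => /andP[? ?]; nra.
  - move=> B mB; have mYB := measurable_preimage m mB.
    transitivity (\int[P]_(w in Y m @^-1` B `&` E) (1 + cos (c' + S a m w))).
      rewrite Rintegral_mkcondr; apply: eq_Rintegral => w _.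
      by rewrite patchE indicE; case: (_ \in _); rewrite ?mulr1 ?mulr0.
    have mBE : measurable (Y m @^-1` B `&` E) by exact: measurableI.
    rewrite RintegralD//; last 2 first.
    - exact: finite_measure_integrable_cst.
    - by apply: (@bounded_integrable _ _ _ P _ _ 1) => //; [exact: measurable_funTS|move=> w _; exact: cos_max].
    by rewrite cosE// Rintegral_cst// mul1r PE//; ring.
have bd (g h : R -> R) : (forall x, `|g x| <= 1) -> (forall x, `|h x| <= 1) ->
    forall w x y, `|g x * \1_E w * h y| <= (1 : R).
  move=> g1 h1 w x y; rewrite indicE; case: (_ \in _); last by rewrite mulr0 mul0r normr0.
  by rewrite mulr1 normrM mulr_ile1.
have mh (h : R -> R) (mh : measurable_fun [set: R] h) : measurable_fun [set: T] (fun w => h (Y m w)).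
  exact: measurableT_comp.
have W3 c' (h : R -> R) : measurable_fun [set: R] h -> (forall x, `|h x| <= 1) ->
    P.-integrable setT (EFin \o (fun w => cos (c' + S a m w) * \1_E w * h (Y m w))) /\
    \int[P]_w (cos (c' + S a m w) * \1_E w * h (Y m w)) =
    cos c' * q * fine (P E) * \int[@normal_prob R 0 1]_x h x.
  move=> mh' h1.
  have I1 : P.-integrable setT (EFin \o (fun w => cos (c' + S a m w) * \1_E w * h (Y m w))).
    apply: (@bounded_integrable _ _ _ P _ _ 1) => //.
      by apply: measurable_funM; [exact: measurable_funM|exact: mh].
    by move=> w _; apply: bd => // x; exact: cos_max.
  have I2 : P.-integrable setT (EFin \o (fun w => \1_E w * h (Y m w))).
    apply: (@bounded_integrable _ _ _ P _ _ 1) => //.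
      by apply: measurable_funM => //; exact: mh.
    move=> w _; have := @bd (cst 1) h _ h1 w 0 (Y m w); rewrite /cst mul1r; apply.
    by move=> x; rewrite normr1.
  split => //; have := W2 c' h mh' h1.
  have -> : \int[P]_w ((1 + cos (c' + S a m w)) * \1_E w * h (Y m w)) =
     \int[P]_w (\1_E w * h (Y m w)) + \int[P]_w (cos (c' + S a m w) * \1_E w * h (Y m w)).
    by rewrite -RintegralD//; apply: eq_Rintegral => w _; ring.
  by rewrite W1//; move=> h2; apply: (addrI (fine (P E) * \int[@normal_prob R 0 1]_x h x)); rewrite h2; ring.
have mcosM : measurable_fun [set: R] (fun x : R => cos (a m * x)).
  by apply: (measurableT_comp (@measurable_cos R)); exact: measurable_funM.
have msinM : measurable_fun [set: R] (fun x : R => sin (a m * x)).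
  apply: (@measurableT_comp _ _ _ _ _ _ (@sin R)); last exact: measurable_funM.
  by apply: continuous_measurable_fun => x; exact: continuous_sin.
have [I1 E1] := W3 c _ mcosM (fun x => cos_max _).
have [I2 E2] := W3 (c - pi / 2) _ msinM (fun x => sin_max _).
rewrite Rintegral_mkcond.
transitivity (\int[P]_w (cos (c + S a m w) * \1_E w * cos (a m * Y m w)) -
    \int[P]_w (cos (c - pi / 2 + S a m w) * \1_E w * sin (a m * Y m w))).
  rewrite -RintegralB//; apply: eq_Rintegral => w _.
  have -> : cos (c - pi / 2 + S a m w) = sin (c + S a m w).
    by rewrite addrAC cosBpihalf.
  have Sm : S a m.+1 w = S a m w + a m * Y m w by rewrite /S big_ord_recr.
  rewrite patchE Sm indicE; case: (_ \in _); last by rewrite !mulr0 !mul0r subrr.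
  by rewrite addrA cosD !mulr1.
rewrite E1 E2 normal_cos0 normal_sin mulr0 subr0 big_ord_recr/= /q.
move: (\sum_(i < m) a i ^+ 2) => s.
have -> : expR (- (s + a m ^+ 2) / 2) = expR (- s / 2) * expR (- (a m ^+ 2 / 2)).
  by rewrite -expRD; congr expR; field.
by ring.
Qed.

Lemma independent_normals_cos (n : nat) (a : nat -> R) :
  \int[P]_w cos (linear_form n Y a w) = expR (- (\sum_(i < n) a i ^+ 2) / 2).
Proof.
have := @cos_cylinder a n 0 [::] (fun=> setT) isT _ (fun=> measurableT).
have -> : cylinder [::] (fun=> setT) = setT.
  by apply/seteqP; split => // w _ i.
rewrite probability_setT cos0 mulr1 mul1r => <-//.
by apply: eq_Rintegral => w _; rewrite add0r.
Qed.

End independent_normals.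

(** * Almost sure convergence of random series *)

Section measurable_limit.
Context (R : realType) d (T : measurableType d).

Let cvgnP (u : nat -> R) : cvgn u <->
  forall k : nat, exists N : nat, forall n, (N <= n)%N -> `|u n - u N| <= k.+1%:R^-1.
Proof.
split=> [/cvg_ex[l /cvgrPdist_le ul] k|h].
  have e0 : 0 < (k.+1%:R^-1 / 2 : R) by rewrite divr_gt0 ?invr_gt0.
  have [N _ uN] := ul _ e0; exists N => n Nn.
  have h1 := uN n Nn; have h2 := uN N (leqnn N).
  have -> : u n - u N = (l - u N) - (l - u n) by ring.
  rewrite (le_trans (ler_normB _ _))// (le_trans (lerD h2 h1))//.
  by rewrite -splitr.
apply: cauchy_cvg; apply/cauchyP => e e0.
have [k ke] := ltr_add_invr e0; have [N uN] := h k.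
exists (u N); exists N => // n /= Nn; rewrite /ball/= distrC.
by apply: le_lt_trans (uN n Nn) _; rewrite add0r in ke.
Qed.

(** By the Cauchy criterion the set of convergence is measurable; outside it
    [limn] is constant. *)
Lemma measurable_fun_limn (f : nat -> T -> R) :
  (forall n, measurable_fun [set: T] (f n)) ->
  measurable_fun [set: T] (fun w => limn (f ^~ w)).
Proof.
move=> mf; pose C := [set w | cvgn (f ^~ w)].
have mC : measurable C.
  have -> : C = \bigcap_k \bigcup_N \bigcap_n
      [set w | (N <= n)%N -> `|f n w - f N w| <= k.+1%:R^-1].
    apply/seteqP; split => w.
      move=> /cvgnP h k _; have [N hN] := h k.
      by exists N => // n _; exact: hN.
    move=> h; apply/cvgnP => k; have [N _ hN] := h k I.
    by exists N => n; exact: hN.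
  apply: bigcapT_measurable => k; apply: bigcupT_measurable => N.
  apply: bigcapT_measurable => n; have [Nn|Nn] := leqP N n; last first.
    rewrite (_ : mkset _ = setT)//.
    by apply/seteqP; split => // w _ /=.
  rewrite (_ : mkset _ =
    (fun w => `|f n w - f N w|) @^-1` `]-oo, k.+1%:R^-1]); last first.
    apply/seteqP; split => w /=; rewrite in_itv/=; first exact.
    by move=> ? _.
  rewrite -[X in measurable X]setTI.
  have mn : measurable_fun [set: T] (fun w => `|f n w - f N w|).
    by apply: measurableT_comp => //; exact: measurable_funB.
  exact: mn.
pose g n w := if `[< C w >] then f n w else (point : R).
have mb : measurable_fun [set: T] (fun w => `[< C w >]).
  apply: (measurable_fun_bool true); rewrite setTI (_ : _ @^-1` _ = C)//.
  by apply/seteqP; split => w /= /asboolP.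
apply: (@measurable_fun_cvg _ _ _ _ g) => [n|w _].
  apply: measurable_fun_ifT => //.
rewrite /g; case: asboolP => Cw; first exact: Cw.
rewrite (_ : limn _ = point); last exact: dvgP.
exact: cvg_cst.
Qed.

End measurable_limit.

Lemma sum_inv_pronic (R : realType) (n : nat) :
  \sum_(1 <= k < n.+1) (k%:R * (k%:R + 1))^-1 = 1 - n.+1%:R^-1 :> R.
Proof.
elim: n => [|n IH]; first by rewrite big_geq// invr1 subrr.
rewrite big_nat_recr//= IH -(natr1 n.+1) -(natr1 n).
have n1 : n%:R + 1 != 0 :> R by rewrite natr1.
have n2 : n%:R + 1 + 1 != 0 :> R by rewrite natr1 natr1.
by field; rewrite n1 n2.
Qed.

Section random_series.
Context (R : realType) d (T : measurableType d) (P : probability T R).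

(** The series of the dominating variables has mean at most [D * C], as the
    coefficients [1 / (k (k + 1))] sum to 1; hence it is finite almost surely. *)
Lemma ae_cvg_dominated_series (g Y : nat -> T -> R) (D C : R) (m : nat) :
  (1 <= m)%N -> 0 <= C -> 0 <= D ->
  (forall k, (1 <= k)%N -> measurable_fun [set: T] (Y k)) ->
  (forall k w, 0 <= Y k w) ->
  (forall k, (1 <= k)%N -> (\int[P]_w (Y k w)%:E <= C%:E)%E) ->
  (forall k w, (m <= k)%N -> `|g k w| <= D / (k%:R * (k%:R + 1)) * Y k w) ->
  {ae P, forall w, cvgn (fun n => \sum_(m <= k < n) g k w)}.
Proof.
move=> m1 C0 D0 mY Y0 YC gY.
pose c k : R := if (1 <= k)%N then (k%:R * (k%:R + 1))^-1 else 0.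
have c0 k : 0 <= c k by rewrite /c; case: ifP => // _; rewrite invr_ge0 mulr_ge0.
pose f k w := c k * Y k w.
have f0 k w : 0 <= f k w by rewrite mulr_ge0.
have mf k : measurable_fun [set: T] (f k).
  rewrite /f /c; case: ifP => [k1|_]; first by apply: measurable_funM => //; exact: mY.
  by under eq_fun do rewrite mul0r; exact: measurable_cst.
have mG : measurable_fun [set: T] (fun w => (\sum_(0 <= k <oo) (f k w)%:E)%E).
  by apply: ge0_emeasurable_sum => // k; [move=> w _ _; rewrite lee_fin|move=> _; exact/measurable_EFinP].
have sumc n : \sum_(0 <= k < n) c k <= 1.
  case: n => [|n]; first by rewrite big_geq.
  rewrite big_nat_recl// {1}/c/= add0r.
  rewrite (_ : \sum_(0 <= i < n) _ = \sum_(1 <= k < n.+1) (k%:R * (k%:R + 1))^-1).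
    by rewrite sum_inv_pronic gerBl.
  by rewrite big_add1.
have IG : P.-integrable [set: T] (fun w => (\sum_(0 <= k <oo) (f k w)%:E)%E).
  apply/integrableP; split => //.
  rewrite (eq_integral (fun w => \sum_(0 <= k <oo) (f k w)%:E)%E); last first.
    by move=> w _; rewrite gee0_abs//; apply: nneseries_ge0 => k _ _; rewrite lee_fin.
  rewrite integral_nneseries//; last 2 first.
  - by move=> k; exact/measurable_EFinP.
  - by move=> k w _; rewrite lee_fin.
  apply: (@le_lt_trans _ _ C%:E); last exact: ltry.
  apply: lime_le.
    by apply: is_cvg_nneseries => k _ _; apply: integral_ge0 => w _; rewrite lee_fin.
  apply: nearW => n.
  apply: (@le_trans _ _ (\sum_(0 <= k < n) (c k * C)%:E)%E).
    apply: lee_sum => k _; under eq_integral do rewrite EFinM.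
    rewrite /c; case: ifP => k1; last first.
      by rewrite mul0r; under eq_integral do rewrite mul0e; rewrite integral0.
    rewrite ge0_integralZl//.
    - by rewrite EFinM lee_wpmul2l ?YC// lee_fin invr_ge0 mulr_ge0.
    - exact/measurable_EFinP/mY.
    - by move=> w _; rewrite lee_fin.
  by rewrite sumEFin lee_fin -mulr_suml ler_piMl.
have := integrable_ae measurableT IG.
apply: filterS => w /(_ I) Gfin.
pose u k := if (m <= k)%N then g k w else 0.
have -> : (fun n => \sum_(m <= k < n) g k w) = series u.
  apply/funext => n; rewrite /series/=.
  rewrite (@big_nat_widenl _ _ _ m 0%N)//= big_mkcond/=.
  by apply: eq_bigr => k _; rewrite /u.
apply: normed_cvg.
apply: nondecreasing_is_cvgn.
  by apply: nondecreasing_series => k _ _ /=; exact: normr_ge0.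
exists (D * fine (\sum_(0 <= k <oo) (f k w)%:E)%E) => _ [n _ <-].
apply: (@le_trans _ _ (D * \sum_(0 <= k < n) f k w)).
  rewrite /series/= mulr_sumr; apply: ler_sum => k _; rewrite /u.
  case: ifP => mk; last by rewrite normr0 mulr_ge0.
  by rewrite /f /c (leq_trans m1 mk)// mulrA; exact: gY.
rewrite ler_wpM2l// -lee_fin fineK// -sumEFin.
by apply: nneseries_lim_ge => k _; rewrite lee_fin.
Qed.

End random_series.

Section standard_normal_series.
Context (R : realType) d (T : measurableType d) (P : probability T R).
Variable Z : nat -> T -> R.
Hypothesis mZ : forall k, (1 <= k)%N -> measurable_fun [set: T] (Z k).
Hypothesis ZN : forall k, (1 <= k)%N -> has_law P (Z k) (normal_prob 0 1).

Lemma standard_normal_sqr k : (1 <= k)%N ->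
  (\int[P]_w (Z k w ^+ 2)%:E = 1)%E.
Proof.
move=> k1.
rewrite (@integral_comp_law _ _ _ P (Z k) (normal_prob 0 1) (fun x => x ^+ 2))//;
  last exact: ZN.
have e : (fun x : R => x ^+ 2) = (fun x => (x - 0) ^+ 2).
  by apply/funext => x; rewrite subr0.
rewrite -[LHS]fineK; last first.
  apply: integrable_fin_num => //.
  by have := normal_sqr_integrable 0 (oner_neq0 R); rewrite -e.
congr EFin; have := normal_variance 0 (oner_neq0 R); rewrite expr1n; apply: etrans.
by apply: eq_Rintegral => x _; rewrite subr0.
Qed.

Lemma ae_cvg_quad_series :
  {ae P, forall w, cvgn (fun n => \sum_(2 <= k < n) quad_term (fun m => Z m w) k)}.
Proof.
apply: (@ae_cvg_dominated_series _ _ _ P (fun k w => quad_term (fun m => Z m w) k)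
  (fun k w => Z k w ^+ 2) 6 1 2) => //.
- by move=> k k1; apply: measurable_funX; exact: mZ.
- by move=> k w; exact: sqr_ge0.
- by move=> k k1; rewrite standard_normal_sqr.
- move=> k w _; by rewrite /quad_term ger0_norm// mulr_ge0 ?sqr_ge0// divr_ge0//.
Qed.

Lemma lin_coeff_le (l : nat) : (1 <= l)%N ->
  `|3 * Num.sqrt (4 * l%:R + 1)
    / (l%:R * (l%:R + 1) * (2 * l%:R - 1) * (2 * l%:R + 1)) : R| <=
  3 / (l%:R * (l%:R + 1)).
Proof.
move=> l1; have x1 : (1 : R) <= l%:R by rewrite ler1n.
move: (l%:R : R) x1 => x x1.
rewrite ger0_norm; last first.
  by rewrite divr_ge0 ?mulr_ge0 ?sqrtr_ge0//; lra.
rewrite ler_pdivlMr; last by nra.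
have -> : 3 * Num.sqrt (4 * x + 1) / (x * (x + 1) * (2 * x - 1) * (2 * x + 1)) *
    (x * (x + 1)) = 3 * (Num.sqrt (4 * x + 1) / ((2 * x - 1) * (2 * x + 1))).
  by field; rewrite !lt0r_neq0//; lra.
rewrite -[leRHS]mulr1 ler_pM2l// ler_pdivrMr ?mul1r; last by nra.
rewrite -(@ler_pXn2r _ 2) ?nnegrE ?sqrtr_ge0//; last by nra.
rewrite sqr_sqrtr; last by lra.
have : 4 * x - 1 <= (2 * x - 1) * (2 * x + 1) by nra.
by move: ((2 * x - 1) * _) => y xy; nra.
Qed.

Lemma ae_cvg_lin_series :
  {ae P, forall w, cvgn (fun n => \sum_(1 <= l < n) lin_term (fun m => Z m w) l)}.
Proof.
apply: (@ae_cvg_dominated_series _ _ _ P (fun k w => lin_term (fun m => Z m w) k)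
  (fun k w => 1 + Z (2 * k)%N w ^+ 2) 3 2 1) => //.
- move=> k k1; apply: measurable_funD => //; apply: measurable_funX; apply: mZ.
  by rewrite muln_gt0.
- by move=> k w; rewrite addr_ge0// sqr_ge0.
- move=> k k1; under eq_integral do rewrite EFinD.
  rewrite ge0_integralD//.
  + rewrite standard_normal_sqr ?muln_gt0// integral_cst// mul1e.
    by rewrite [X in (X + _)%E](probability_setT P) -EFinD lee_fin.
  + by move=> w _; rewrite lee_fin sqr_ge0.
  + apply/measurable_EFinP; apply: measurable_funX; apply: mZ.
    by rewrite muln_gt0.
- move=> l w l1; rewrite /lin_term normrM.
  apply: ler_pM => //; first exact: lin_coeff_le.
  move: (Z _ w) => z; rewrite -(real_normK (num_real z)).
  by move: (`|z|) (normr_ge0 z) => y y0; nra.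
Qed.

End standard_normal_series.

(** * Shifted Legendre polynomials *)

Section polynomial_integral.
Context (R : realType).
Local Notation mu := (@lebesgue_measure R).
Implicit Types p q : {poly R}.

Definition pint p : R := \int[mu]_(t in `[0, 1]) p.[t].

Lemma continuous_horner_within p : {within `[0, 1], continuous (fun t : R => p.[t])}.
Proof. by apply: continuous_subspaceT => x; exact: continuous_horner. Qed.

Lemma integrable_horner p : mu.-integrable `[0, 1] (EFin \o (fun t => p.[t])).
Proof. by apply: continuous_integrable; exact: continuous_horner_within. Qed.

Lemma pint_deriv p : pint p^`() = p.[1] - p.[0].
Proof.
apply: (@Rintegral_FTC R 0 1 _ (horner p)) => //.
- exact: continuous_horner_within.
- exact: continuous_horner_within.
Qed.

Lemma pintD p q : pint (p + q) = pint p + pint q.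
Proof.
rewrite /pint -RintegralD//; [|exact: integrable_horner|exact: integrable_horner].
by apply: eq_Rintegral => t _; rewrite hornerD.
Qed.

Lemma pintZ c p : pint (c *: p) = c * pint p.
Proof.
rewrite /pint -RintegralZl//; last exact: integrable_horner.
by apply: eq_Rintegral => t _; rewrite hornerZ.
Qed.

Lemma pintN p : pint (- p) = - pint p.
Proof. by rewrite -scaleN1r pintZ mulN1r. Qed.

Lemma pintB p q : pint (p - q) = pint p - pint q.
Proof. by rewrite pintD pintN. Qed.

Lemma pint0 : pint 0 = 0.
Proof. by rewrite -(scale0r 0) pintZ mul0r. Qed.

Lemma pint_sum (I : Type) (s : seq I) (f : I -> {poly R}) :
  pint (\sum_(i <- s) f i) = \sum_(i <- s) pint (f i).
Proof. exact: (big_morph pint pintD pint0). Qed.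

Lemma pint1 : pint 1 = 1.
Proof.
have -> : 1 = ('X : {poly R})^`() by rewrite derivX.
by rewrite pint_deriv !hornerX subr0.
Qed.

End polynomial_integral.

Section legendre.
Context (R : realType).
Implicit Types (p q : {poly R}) (j k : nat).

(** The coefficient recurrence of the power series solution of
    [(t (1 - t) P')' = - k (k + 1) P] with value 1 at 0. *)
Fixpoint legendre_coef k j : R := if j is i.+1 then
  legendre_coef k i * (i%:R * (i%:R + 1) - k%:R * (k%:R + 1)) / (i%:R + 1) ^+ 2
  else 1.

(** [legendre k] is the Legendre polynomial of degree [k] in the variable
    [1 - 2 t]: it is 1 at [t = 0]. *)
Definition legendre k : {poly R} := \poly_(j < k.+1) legendre_coef k j.

(** The leading coefficient of the Legendre operator on the unit interval, and
    the variance of the bridge. *)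
Definition weight : {poly R} := 'X - 'X^2.

Lemma horner_weight t : weight.[t] = t * (1 - t).
Proof. by rewrite /weight hornerD hornerN hornerX hornerXn; ring. Qed.

Lemma weight0 : weight.[0] = 0. Proof. by rewrite horner_weight; ring. Qed.
Lemma weight1 : weight.[1] = 0. Proof. by rewrite horner_weight; ring. Qed.

Let nat1_neq0 j : (j%:R + 1 : R) != 0. Proof. by rewrite natr1 pnatr_eq0. Qed.

Let legendre_coef_gt k j : (k < j)%N -> legendre_coef k j = 0.
Proof.
elim: j => // j IH; rewrite ltnS leq_eqVlt => /predU1P[->|/IH /= ->].
  by rewrite /= subrr mulr0 mul0r.
by rewrite !mul0r.
Qed.

Let legendre_coef_neq0 k j : (j <= k)%N -> legendre_coef k j != 0.
Proof.
elim: j => [|j IH] jk /=; first exact: oner_neq0.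
rewrite !mulf_neq0 ?IH ?(ltnW jk) ?invr_eq0 ?expf_neq0//.
rewrite subr_eq0 !natr1 -!natrM eqr_nat ltn_eqF//.
by apply: ltn_mul.
Qed.

Lemma coef_legendre k j : (legendre k)`_j = legendre_coef k j.
Proof.
by rewrite coef_poly; case: ltnP => // kj; rewrite legendre_coef_gt.
Qed.

Lemma size_legendre k : size (legendre k) = k.+1.
Proof. by apply: size_poly_eq; exact: legendre_coef_neq0. Qed.

Definition legendre_op p : {poly R} := (weight * p^`())^`().

Lemma coef_legendre_op p j : (legendre_op p)`_j =
  (j%:R + 1) * ((j%:R + 1) * p`_j.+1 - j%:R * p`_j).
Proof.
rewrite /legendre_op coef_deriv /weight mulrBl coefB coefXM coefXnM /=.
rewrite !coef_deriv; case: j => [|j].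
  rewrite (_ : (1 < 2)%N = true)//.
  by rewrite !subr0 mul0r subr0 add0r !mul1r !mulr1n.
rewrite (_ : (j.+2 < 2)%N = false)// -[(j.+2 - 2)%N]/(j - 0)%N subn0.
rewrite -(mulr_natl _ j.+2) -(mulr_natl (p`_j.+2)) -(mulr_natl (p`_j.+1)).
by rewrite !(natr1 j.+1).
Qed.

Lemma legendre_ode k :
  legendre_op (legendre k) = - (k%:R * (k%:R + 1)) *: legendre k.
Proof.
apply/polyP => j; rewrite coef_legendre_op coefZ !coef_legendre /=.
by field; rewrite nat1_neq0.
Qed.

(** The coefficient recurrence leaves only the value at 0 free. *)
Lemma legendre_ode_unique k p : legendre_op p = - (k%:R * (k%:R + 1)) *: p ->
  p = p.[0] *: legendre k.
Proof.
move=> ode; apply/polyP; elim => [|j IH].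
  by rewrite coefZ coef_legendre/= mulr1 horner_coef0.
have := congr1 (fun q : {poly R} => q`_j) ode.
rewrite coef_legendre_op !coefZ IH !coefZ !coef_legendre/= => h.
have -> : p`_j.+1 = ((j%:R + 1) * (j%:R * (p.[0] * legendre_coef k j)) +
    - (k%:R * (k%:R + 1)) * (p.[0] * legendre_coef k j)) / (j%:R + 1) ^+ 2.
  by rewrite -h; field; rewrite nat1_neq0.
by field; rewrite nat1_neq0.
Qed.

Lemma horner_legendre0 k : (legendre k).[0] = 1.
Proof. by rewrite horner_coef0 coef_legendre. Qed.

(** The equation is invariant under [t |-> 1 - t], so the reflected polynomial
    is a multiple of the original one; leading coefficients give the factor. *)
Lemma legendre_reflect k :
  legendre k \Po (1 - 'X) = (-1) ^+ k *: legendre k.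
Proof.
set r : {poly R} := 1 - 'X.
have dr : r^`() = -1 by rewrite /r derivB derivX derivC sub0r.
have wr : weight \Po r = weight.
  by rewrite /weight comp_polyB comp_polyX comp_Xn_poly /r; ring.
have ode : legendre_op (legendre k \Po r) =
    - (k%:R * (k%:R + 1)) *: (legendre k \Po r).
  rewrite -comp_polyZ -legendre_ode /legendre_op deriv_comp dr mulrN1 mulrN derivN.
  rewrite -{1}wr -comp_polyM deriv_comp dr; ring.
have E := legendre_ode_unique ode; rewrite E; congr (_ *: _).
have sr : size r = 2.
  have -> : r = - ('X - 1%:P) by rewrite /r opprB.
  by rewrite size_polyN size_XsubC.
have lr : lead_coef r = -1.
  have -> : r = - ('X - 1%:P) by rewrite /r opprB.
  by rewrite lead_coefN lead_coefXsubC.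
have := congr1 lead_coef E; rewrite lead_coef_comp ?sr// lr size_legendre lead_coefZ/=.
rewrite mulrC; move/mulIf => <-//.
by rewrite lead_coef_eq0 -size_poly_eq0 size_legendre.
Qed.

Lemma horner_legendre_reflect k (t : R) :
  (legendre k).[1 - t] = (-1) ^+ k * (legendre k).[t].
Proof. by rewrite -hornerZ -legendre_reflect horner_comp !hornerE. Qed.

Lemma horner_legendre1 k : (legendre k).[1] = (-1) ^+ k.
Proof.
by have := horner_legendre_reflect k 0; rewrite subr0 horner_legendre0 mulr1.
Qed.

Lemma horner_deriv_legendre_reflect k (t : R) :
  (legendre k)^`().[1 - t] = - (-1) ^+ k * (legendre k)^`().[t].
Proof.
have := congr1 (fun p : {poly R} => p^`().[t]) (legendre_reflect k).
rewrite /= deriv_comp derivB derivX derivC sub0r derivZ hornerZ hornerM horner_comp.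
by rewrite !hornerE => h; rewrite mulNr -h; ring.
Qed.

(** Integration by parts; the weight cancels the boundary terms. *)
Lemma legendre_green p k : pint (weight * p^`() * (legendre k)^`()) =
  k%:R * (k%:R + 1) * pint (p * legendre k).
Proof.
have : pint (weight * (legendre k)^`() * p)^`() = 0.
  by rewrite pint_deriv !hornerM weight0 weight1 !mul0r subrr.
rewrite derivM -[(weight * _)^`()]/(legendre_op (legendre k)) legendre_ode pintD.
rewrite -scalerAl pintZ mulNr (mulrC p) => /eqP; rewrite addrC subr_eq0 => /eqP <-.
by congr pint; ring.
Qed.

(** The left-hand side of [legendre_green] is symmetric, while the eigenvalues
    [k (k + 1)] are distinct. *)
Lemma legendre_orthogonal j k : j != k -> pint (legendre j * legendre k) = 0.
Proof.
move=> jk; have h1 := legendre_green (legendre j) k.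
have h2 := legendre_green (legendre k) j.
have h : weight * (legendre j)^`() * (legendre k)^`() =
  weight * (legendre k)^`() * (legendre j)^`() by ring.
rewrite -h h1 (mulrC (legendre k)) in h2.
apply/eqP; have /eqP := h2; rewrite -subr_eq0 -mulrBl mulf_eq0 => /orP[|/eqP->//].
rewrite subr_eq0 !natr1 -!natrM eqr_nat => /eqP e.
have [lt|lt|e2] := ltngtP j k; last by rewrite e2 eqxx in jk.
- have := ltn_mul lt (lt : j.+1 < k.+1)%N.
  by rewrite e ltnn.
- have := ltn_mul lt (lt : k.+1 < j.+1)%N.
  by rewrite e ltnn.
Qed.

(** Leading terms are removed by lower Legendre polynomials. *)
Lemma legendre_orthogonal_lower k p : (size p <= k)%N -> pint (p * legendre k) = 0.
Proof.
suff H n : (n <= k)%N -> forall p, (size p <= n)%N -> pint (p * legendre k) = 0.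
  by move=> /(H k (leqnn k)).
elim: n => [|n IH] nk q sq.
  by move: sq; rewrite leqn0 size_poly_eq0 => /eqP ->; rewrite mul0r pint0.
pose c := q`_n / (legendre n)`_n.
have cn : (legendre n)`_n != 0 by rewrite coef_legendre legendre_coef_neq0.
have -> : q = (q - c *: legendre n) + c *: legendre n by rewrite subrK.
rewrite mulrDl pintD IH ?(ltnW nk)//.
  by rewrite -scalerAl pintZ legendre_orthogonal ?mulr0 ?addr0// ltn_eqF.
apply/leq_sizeP => j; rewrite leq_eqVlt => /predU1P[<-|nj].
  by rewrite coefB coefZ /c divfK// subrr.
rewrite coefB coefZ (leq_sizeP _ _ sq j nj) coef_legendre legendre_coef_gt//.
by rewrite mulr0 subrr.
Qed.

(** Integrating [(2 t - 1) P P'] by parts gives [1 - N] for [N] the squared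
    norm; [(2 t - 1) P' - 2 k P] has degree less than [k], so the same integral
    is [2 k N]. *)
Lemma legendre_norm k : pint (legendre k * legendre k) = (2 * k%:R + 1)^-1.
Proof.
set P := legendre k; set N := pint (P * P).
pose v : {poly R} := 2 *: 'X - 1.
have h1 : pint (v * (P * P))^`() = 2.
  rewrite pint_deriv /v !hornerM !hornerE horner_legendre0 horner_legendre1.
  have s2 : (-1) ^+ k * (-1) ^+ k = 1 :> R by rewrite -expr2 sqrr_sign.
  by rewrite /= -mulrA s2; ring.
have dv : v^`() = 2%:P by rewrite /v derivB derivZ derivX derivC subr0 alg_polyC.
have E : (v * (P * P))^`() = 2 *: (P * P) + 2 *: (v * P^`() * P).
  rewrite derivM dv derivM -!mul_polyC; ring.
have h2 : pint (v * P^`() * P) = 2 * k%:R * N.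
  pose r := v * P^`() - (2 * k%:R) *: P.
  have -> : v * P^`() * P = r * P + (2 * k%:R) *: (P * P).
    by rewrite /r -!mul_polyC; ring.
  rewrite pintD pintZ legendre_orthogonal_lower ?add0r//.
  apply/leq_sizeP => j kj.
  rewrite /r /v mulrBl mul1r -scalerAl !coefB !coefZ coefXM !coef_deriv.
  case: j kj => [|j] kj /=; rewrite !coef_legendre.
    by rewrite (@legendre_coef_gt k 1%N)//; move: kj; rewrite leqn0 => /eqP ->; ring.
  rewrite (@legendre_coef_gt k j.+2)//.
  move: kj; rewrite leq_eqVlt => /predU1P[->|kj].
    by rewrite mul0rn -(mulr_natl (legendre_coef _ _)); ring.
  by rewrite (@legendre_coef_gt k j.+1)// !mul0rn; ring.
move: h1; rewrite E pintD !pintZ h2 -/N => h1.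
have k1 : 2 * k%:R + 1 != 0 :> R by rewrite gt_eqF// ltr_wpDl// mulr_ge0.
apply: (mulIf k1); rewrite mulVf//; lra.
Qed.

End legendre.

(** * The logit weight and its Legendre coefficients *)

Section logit.
Context (R : realType).
Local Notation mu := (@lebesgue_measure R).
Local Notation w := (weight R).

Definition logit (t : R) : R := ln (t / (1 - t)).

(** From [- ln s <= 1 / s] at [s = sqrt t]. *)
Let ln_sqr_le (t : R) : 0 < t <= 1 -> t * ln t ^+ 2 <= 4.
Proof.
move=> /andP[t0 t1]; pose s := Num.sqrt t.
have s0 : 0 < s by rewrite sqrtr_gt0.
have ts : t = s ^+ 2 by rewrite sqr_sqrtr// ltW.
have s_gt := s0; clearbody s.
have ln0 : ln t <= 0 by exact: ln_le0.
have h : - ln t <= 2 * s^-1.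
  have -> : ln t = 2 * ln s by rewrite ts lnXn// mulr_natl.
  rewrite -mulrN ler_pM2l// -lnV ?posrE//.
  by apply/ltW/ln_sublinear; rewrite invr_gt0.
have -> : ln t ^+ 2 = (- ln t) ^+ 2 by rewrite sqrrN.
have h2 : (- ln t) ^+ 2 <= (2 * s^-1) ^+ 2.
  by apply: lerXn2r => //; rewrite nnegrE ?oppr_ge0// mulr_ge0// invr_ge0 ltW.
apply: le_trans (ler_wpM2l (ltW t0) h2) _.
by rewrite {1}ts exprMn exprVn mulrCA mulfV ?mulr1 ?expf_neq0 ?gt_eqF//; lra.
Qed.

Lemma logitE (t : R) : 0 < t < 1 -> logit t = ln t - ln (1 - t).
Proof.
move=> /andP[t0 t1]; rewrite /logit lnM ?posrE ?invr_gt0 ?subr_gt0//.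
by rewrite lnV// posrE subr_gt0.
Qed.

Lemma logit_reflect (t : R) : 0 <= t <= 1 -> logit (1 - t) = - logit t.
Proof.
move=> /andP[]; rewrite le_eqVlt => /predU1P[<- _|t0].
  by rewrite /logit !subr0 subrr mul0r invr0 mulr0 ln0// oppr0.
rewrite le_eqVlt => /predU1P[->|t1].
  by rewrite /logit !subrr mul0r invr0 mulr0 ln0// oppr0.
rewrite !logitE ?t0//; last by rewrite subr_gt0 t1 gtrBl.
by rewrite subKr opprB.
Qed.

Lemma weight_ge0 (t : R) : 0 <= t <= 1 -> 0 <= w.[t].
Proof. by move=> /andP[t0 t1]; rewrite horner_weight mulr_ge0// subr_ge0. Qed.

Lemma weight_gt0 (t : R) : 0 < t < 1 -> 0 < w.[t].
Proof. by move=> /andP[t0 t1]; rewrite horner_weight mulr_gt0// subr_gt0. Qed.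

(** The bound is 4 for each of [t * ln t ^ 2] and [(1 - t) * ln (1 - t) ^ 2], and
    [(a - b) ^ 2 <= 2 a ^ 2 + 2 b ^ 2]. *)
Lemma weight_logit_sqr_le (t : R) : 0 <= t <= 1 -> w.[t] * logit t ^+ 2 <= 16.
Proof.
move=> /andP[]; rewrite le_eqVlt => /predU1P[<- _|t0].
  by rewrite weight0 mul0r.
rewrite le_eqVlt => /predU1P[->|t1]; first by rewrite weight1 mul0r.
rewrite logitE ?t0// horner_weight.
have h1 := @ln_sqr_le t; rewrite t0 (ltW t1) in h1; have {}h1 := h1 isT.
have h2 := @ln_sqr_le (1 - t); rewrite subr_gt0 t1 gerBl (ltW t0) in h2.
have {}h2 := h2 isT.
move: (ln t) (ln (1 - t)) h1 h2 => a b h1 h2.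
have q1 : 0 <= t * a ^+ 2 by rewrite mulr_ge0 ?sqr_ge0 ?(ltW t0).
have q2 : 0 <= (1 - t) * b ^+ 2 by rewrite mulr_ge0 ?sqr_ge0 ?subr_ge0 ?(ltW t1).
have h3 : (1 - t) * (t * a ^+ 2) <= 4 by move: (t * _) q1 h1 => x ? ?; nra.
have h4 : t * ((1 - t) * b ^+ 2) <= 4 by move: (_ * b ^+ 2) q2 h2 => x ? ?; nra.
have h5 : 0 <= t * (1 - t) * (a + b) ^+ 2.
  by rewrite mulr_ge0 ?sqr_ge0 ?mulr_ge0 ?subr_ge0 ?(ltW t0) ?(ltW t1).
have -> : t * (1 - t) * (a - b) ^+ 2 =
    2 * ((1 - t) * (t * a ^+ 2)) + 2 * (t * ((1 - t) * b ^+ 2)) -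
    t * (1 - t) * (a + b) ^+ 2 by ring.
lra.
Qed.

Lemma is_derive_logit (t : R) : 0 < t < 1 -> is_derive t (1 : R) logit w.[t]^-1.
Proof.
move=> /andP[t0 t1].
have nz : 1 - t != 0 by rewrite subr_eq0 gt_eqF.
have h1 : is_derive t (1 : R) (fun x : R => 1 - x) (-1).
  by apply: is_derive_eq; rewrite add0r mul1r.
have h2 := @is_deriveV R (fun x : R => 1 - x) t _ 1 nz h1.
have h3 : is_derive t (1 : R) (fun x : R => x / (1 - x)) ((1 - t) ^- 2).
  have h4 := @is_deriveM R _ id (fun x => (1 - x)^-1) t 1 _ _ (is_derive_id t 1) h2.
  apply: (@is_derive_eq _ _ _ _ _ _ _ _ h4); rewrite /GRing.scale/=.
  by field; rewrite nz.
have p : 0 < t / (1 - t) by rewrite divr_gt0// subr_gt0.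
have h5 := @is_derive1_comp R (@ln R) (fun x : R => x / (1 - x)) t _ _
  (is_derive1_ln p) h3.
apply: (@is_derive_eq _ _ _ _ _ _ _ _ h5); rewrite horner_weight.
by field; rewrite nz gt_eqF.
Qed.

(** The singularities of [logit] are tamed by the weight:
    [(w logit) ^ 2 <= 16 w]. *)
Lemma continuous_weight_logit :
  {within `[0, 1], continuous (fun t : R => w.[t] * logit t)}.
Proof.
have cw : continuous (fun t : R => Num.sqrt (16 * w.[t])).
  move=> t; apply: (@cvg_comp _ _ _ _ (@Num.sqrt R)); last exact: sqrt_continuous.
  by apply: cvgM; [exact: cvg_cst|exact: continuous_horner].
have ub (t : R) : 0 <= t <= 1 -> `|w.[t] * logit t| <= Num.sqrt (16 * w.[t]).
  move=> t01; have w0 := weight_ge0 t01.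
  rewrite -(@ler_pXn2r _ 2) ?nnegrE ?sqrtr_ge0//.
  rewrite sqr_sqrtr ?mulr_ge0// real_normK ?num_real// exprMn expr2 -mulrA mulrC.
  by rewrite ler_wpM2r// weight_logit_sqr_le.
have cw0 : Num.sqrt (16 * w.[t]) @[t --> (0:R)^'+] --> (0:R).
  by have := cvg_at_right_filter (cw 0); rewrite weight0 mulr0 sqrtr0.
have cw1 : Num.sqrt (16 * w.[t]) @[t --> (1:R)^'-] --> (0:R).
  by have := cvg_at_left_filter (cw 1); rewrite weight1 mulr0 sqrtr0.
apply/(continuous_within_itvP _ ltr01); split.
- move=> t; rewrite in_itv/= => t01; apply: cvgM; first exact: continuous_horner.
  apply: differentiable_continuous; apply/derivable1_diffP.
  by have [] := is_derive_logit t01.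
- rewrite weight0 mul0r.
  apply: (@squeeze_cvgr _ _ _ _ (fun t => - Num.sqrt (16 * w.[t]))
    (fun t => Num.sqrt (16 * w.[t]))).
  + near=> t; rewrite -ler_norml; apply: ub; apply/andP; split => //.
    near: t; exact: nbhs_right_le.
  + rewrite -[X in _ --> X]oppr0; apply: cvgN; exact: cw0.
  + exact: cw0.
- rewrite weight1 mul0r.
  apply: (@squeeze_cvgr _ _ _ _ (fun t => - Num.sqrt (16 * w.[t]))
    (fun t => Num.sqrt (16 * w.[t]))).
  + near=> t; rewrite -ler_norml; apply: ub; apply/andP; split => //.
    near: t; exact: nbhs_left_ge.
  + rewrite -[X in _ --> X]oppr0; apply: cvgN; exact: cw1.
  + exact: cw1.
Unshelve. all: end_near. Qed.

Lemma continuous_weight_logit_horner (p : {poly R}) :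
  {within `[0, 1], continuous (fun t : R => w.[t] * logit t * p.[t])}.
Proof.
move=> t; apply: cvgM; first exact: continuous_weight_logit.
exact: continuous_horner_within.
Qed.

(** [logit] is odd and [P_k'] is even about 1/2 when [k] is odd. *)
Lemma logit_legendre_odd k : odd k ->
  \int[mu]_(t in `[0, 1]) (w.[t] * logit t * (legendre R k)^`().[t]) = 0.
Proof.
move=> ko; set G := (X in \int[mu]_(t in _) X t).
set J := \int[mu]_(t in _) _.
have : J = - J.
  rewrite {1}/J Rintegration_by_substitution_onem; last 2 first.
  - by rewrite ler01 lexx.
  - exact: continuous_weight_logit_horner.
  rewrite /unstable.onem subrr.
  rewrite (_ : - J = -1 * J); last by rewrite mulN1r.
  rewrite -RintegralZl//; last first.
    by apply: continuous_integrable; exact: continuous_weight_logit_horner.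
  apply: eq_Rintegral => t; rewrite inE/= in_itv/= => t01.
  rewrite /G logit_reflect// horner_deriv_legendre_reflect.
  rewrite -signr_odd ko expr1 opprK mul1r !horner_weight; ring.
by move=> /eqP; rewrite -addr_eq0 -mulr2n mulrn_eq0/= => /eqP.
Qed.

Let deriv_weight : (w : {poly R})^`() = 1 - 2 *: 'X.
Proof. by rewrite /weight derivB derivX derivXn expr1 scaler_nat. Qed.

(** Differentiating the Legendre equation and multiplying by [w]. *)
Let deriv_sqr_weight k : let P := legendre R k in
  (w ^+ 2 * P^`()^`())^`() = - (k%:R * (k%:R + 1) - 2) *: (w * P^`()).
Proof.
move=> P; have ode := legendre_ode R k; rewrite -/P in ode.
have := congr1 (fun p : {poly R} => p^`()) ode.
rewrite /legendre_op /= derivM derivD !derivM derivZ deriv_weight.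
have -> : (1 - 2 *: 'X : {poly R})^`() = - 2%:P.
  by rewrite derivB derivZ derivX derivC sub0r alg_polyC.
move=> h; set Q := P^`() in h *; set Q1 := Q^`() in h *.
have -> : ((1 - 2 *: 'X) * w + w * (1 - 2 *: 'X)) * Q1 + w ^+ 2 * Q1^`() =
    w * ((- 2%:P * Q + (1 - 2 *: 'X) * Q1 + ((1 - 2 *: 'X) * Q1 + w * Q1^`())) + 2%:P * Q).
  by ring.
rewrite h -!mul_polyC !polyCN polyCB; ring.
Qed.

Lemma pint_legendre k : (0 < k)%N -> pint (legendre R k) = 0.
Proof.
move=> k0; rewrite -[legendre R k]mul1r legendre_orthogonal_lower//.
by rewrite size_poly1.
Qed.

Let pint_weight_deriv2 k : (0 < k)%N -> ~~ odd k ->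
  pint (w * (legendre R k)^`()^`()) = 2.
Proof.
move=> k0 ke; set P := legendre R k.
have h1 : pint (w * P^`())^`() = 0.
  by rewrite pint_deriv !hornerM weight0 weight1 !mul0r subrr.
have h2 : pint ((1 - 2 *: 'X) * P)^`() = - 2.
  rewrite pint_deriv !hornerM horner_legendre0 horner_legendre1 -signr_odd (negbTE ke).
  by rewrite !hornerD !hornerN !hornerZ !hornerX !hornerC; ring.
have dv : (1 - 2 *: 'X : {poly R})^`() = (-2) *: 1.
  by rewrite derivB derivZ derivX derivC sub0r scaleNr.
move: h1 h2; rewrite !derivM deriv_weight dv !pintD -scalerAl mul1r pintZ pint_legendre//.
by move=> h1 h2; lra.
Qed.

(** The primitive of [w P_k'] is [- w ^ 2 P_k'' / ((k - 1) (k + 2))], and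
    [logit' = 1 / w]; one integration by parts leaves a polynomial. *)
Lemma logit_legendre_even k : (0 < k)%N -> ~~ odd k ->
  \int[mu]_(t in `[0, 1]) (w.[t] * logit t * (legendre R k)^`().[t]) =
  2 / (k%:R * (k%:R + 1) - 2).
Proof.
move=> k0 ke; set P := legendre R k; set m := k%:R * (k%:R + 1) - 2.
have k2 : (2 <= k)%N by case: k k0 ke {P m} => [//|[//|k]].
have m0 : m != 0.
  have : (2 : R) <= k%:R by rewrite ler_nat.
  by rewrite /m; move: (k%:R : R) => x x2; rewrite gt_eqF//; nra.
pose F t := - m^-1 * (w.[t] * logit t * (w * P^`()^`()).[t]).
have F0 : F 0 = 0 by rewrite /F weight0 !mul0r mulr0.
have F1 : F 1 = 0 by rewrite /F weight1 !mul0r mulr0.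
have cF : {within `[0, 1], continuous F}.
  by move=> t; apply: cvgM; [exact: cvg_cst|exact: continuous_weight_logit_horner].
have cG := @continuous_weight_logit_horner P^`().
have cH : {within `[0, 1], continuous (fun t : R => m^-1 * (w * P^`()^`()).[t])}.
  by move=> t; apply: cvgM; [exact: cvg_cst|exact: continuous_horner_within].
have dF (t : R) : t \in `]0, 1[ -> is_derive t (1 : R) F
    (w.[t] * logit t * P^`().[t] - m^-1 * (w * P^`()^`()).[t]).
  rewrite in_itv/= => t01; have w0 := weight_gt0 t01.
  have -> : F = (fun t => - m^-1 * ((w ^+ 2 * P^`()^`()).[t] * logit t)).
    by apply/funext => x; rewrite /F !hornerM; ring.
  have h1 := is_derive_poly (w ^+ 2 * P^`()^`()) t.
  have h2 := @is_deriveM R _ _ _ _ _ _ _ h1 (is_derive_logit t01).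
  have h3 := @is_deriveZ R _ _ _ (- m^-1) _ _ _ h2.
  apply: (@is_derive_eq _ _ _ _ _ _ _ _ h3).
  rewrite deriv_sqr_weight -/P -/m /GRing.scale/= !hornerZ !hornerM.
  by field; rewrite m0 gt_eqF.
have := Rintegral_FTC ler01 _ cF dF; rewrite F0 F1 subr0 RintegralB//; last 2 first.
- exact: continuous_integrable.
- exact: continuous_integrable.
rewrite RintegralZl//; last exact: integrable_horner.
rewrite -[X in _ - _ * X]/(pint _) pint_weight_deriv2// => h.
have {}h := h _; apply/eqP; rewrite -subr_eq0 [2 / m]mulrC; apply/eqP; apply: h.
by move=> t; apply: cvgB; [exact: cG|exact: cH].
Qed.

End logit.

(** * Step functions and Riemann-Stieltjes sums on the unit interval *)

Section step_functions.
Context (R : realType).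
Local Notation mu := (@lebesgue_measure R).

(** The [N]-th grid interval; the last one, for [j = N], holds the point 1. *)
Definition cell (N j : nat) : set R := `[j%:R / N%:R, j.+1%:R / N%:R[%classic.

Definition step (N : nat) (f : R -> R) (t : R) : R :=
  \sum_(j < N.+1) \1_(cell N j) t * f (j%:R / N%:R).

Definition grid_point (N : nat) (t : R) : R := (Num.truncn (t * N%:R))%:R / N%:R.

Let N0 N : (0 : R) < N.+1%:R. Proof. by rewrite ltr0n. Qed.

Let cellP N (j : nat) (t : R) : 0 <= t ->
  cell N.+1 j t <-> j = Num.truncn (t * N.+1%:R).
Proof.
move=> t0; rewrite /cell/= in_itv/= ler_pdivrMr// ltr_pdivlMr//.
have tN : 0 <= t * N.+1%:R by rewrite mulr_ge0.
split => [h|->]; last exact: truncn_itv.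
by apply/esym/truncn_def.
Qed.

Lemma step_grid_point N f t : 0 <= t <= 1 ->
  step N.+1 f t = f (grid_point N.+1 t).
Proof.
move=> /andP[t0 t1]; set j := Num.truncn (t * N.+1%:R).
have jN : (j < N.+2)%N.
  have tN : 0 <= t * N.+1%:R by rewrite mulr_ge0.
  rewrite ltnS -(ler_nat R) (@le_trans _ _ (t * N.+1%:R))//.
    by rewrite truncn_le.
  by rewrite -[leRHS]mul1r ler_wpM2r.
rewrite /step (bigD1 (Ordinal jN))//= big1 ?addr0 => [|i ij].
  by rewrite indicE mem_set ?mul1r//; exact/(cellP N _ t0).
rewrite indicE memNset ?mul0r// => /(cellP N _ t0) e.
by move: ij; rewrite -val_eqE/= e eqxx.
Qed.

Lemma grid_point_le N t : 0 <= t -> grid_point N.+1 t <= t < grid_point N.+1 t + N.+1%:R^-1.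
Proof.
move=> t0; have tN : 0 <= t * N.+1%:R by rewrite mulr_ge0.
have /andP[h1 h2] := truncn_itv tN.
rewrite /grid_point ler_pdivrMr// h1/=.
by rewrite -[X in _ < _ + X]mul1r -mulrDl ltr_pdivlMr// natr1.
Qed.

Lemma grid_point01 N t : 0 <= t <= 1 -> 0 <= grid_point N.+1 t <= 1.
Proof.
move=> /andP[t0 t1]; rewrite divr_ge0//=.
by have /andP[h _] := grid_point_le N t0; exact: le_trans h t1.
Qed.

Lemma cvg_grid_point t : 0 <= t -> grid_point n.+1 t @[n --> \oo] --> t.
Proof.
move=> t0; apply/subr_cvg0; apply: (@cvg0_harmonic_bound _ _ 1) => n.
have /andP[h1 h2] := grid_point_le n t0.
by rewrite distrC ger0_norm ?subr_ge0// mul1r lerBlDl ltW.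
Qed.

Lemma within_continuous_cvg (f : R -> R) (u : nat -> R) (t : R) :
  {within `[0, 1], continuous f} -> 0 <= t <= 1 -> (forall n, 0 <= u n <= 1) ->
  u n @[n --> \oo] --> t -> f (u n) @[n --> \oo] --> f t.
Proof.
move=> cf t01 u01 ut.
have := (subspace_continuousP _ _).1 cf t; rewrite /= in_itv/= => /(_ t01) h.
apply: cvg_trans h => A /= hA.
have := ut _ hA; rewrite /nbhs/=.
move=> [n _ hn]; exists n => // k kn; apply: hn => //=.
by rewrite in_itv/= u01.
Qed.

Lemma cvg_step (f : R -> R) (t : R) : {within `[0, 1], continuous f} -> 0 <= t <= 1 ->
  step n.+1 f t @[n --> \oo] --> f t.
Proof.
move=> cf t01; under eq_fun do rewrite step_grid_point//.
apply: within_continuous_cvg => //; first by move=> n; exact: grid_point01.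
by apply: cvg_grid_point; case/andP: t01.
Qed.

Lemma measurable_step N f : measurable_fun [set: R] (step N f).
Proof.
apply: measurable_sum => j; apply: measurable_funM; last exact: measurable_cst.
by apply: measurable_indic; exact: measurable_itv.
Qed.

Lemma within_continuous_bounded (f : R -> R) : {within `[0, 1], continuous f} ->
  exists M, forall t, 0 <= t <= 1 -> `|f t| <= M.
Proof.
move=> cf.
have [M [_ hM]] := compact_bounded (continuous_compact cf (@segment_compact R 0 1)).
exists (`|M| + 1) => t t01; apply: (hM (`|M| + 1)); first by rewrite ltr_pwDr// ler_norm.
by exists t => //=; rewrite in_itv.
Qed.

Let Rintegral_cell N j (h : {poly R}) :
  \int[mu]_(t in cell N.+1 j) h^`().[t] =
  h.[j.+1%:R / N.+1%:R] - h.[j%:R / N.+1%:R].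
Proof.
have jj : j%:R / N.+1%:R <= j.+1%:R / N.+1%:R :> R by rewrite ler_pM2r ?invr_gt0// ler_nat.
rewrite Rintegral_itv_bndo_bndc; last first.
  apply: (@integrableS _ _ _ mu `[j%:R / N.+1%:R, j.+1%:R / N.+1%:R]) => //.
    exact: subset_itv_co_cc.
  apply: continuous_integrable; apply: continuous_subspaceT => x.
  exact: continuous_horner.
apply: (@Rintegral_FTC R _ _ _ (horner h)) => //.
- by apply: continuous_subspaceT => x; exact: continuous_horner.
- by apply: continuous_subspaceT => x; exact: continuous_horner.
Qed.

Lemma Rintegral_step N f (h : {poly R}) :
  \int[mu]_(t in `[0, 1]) (step N.+1 f t * h^`().[t]) =
  \sum_(j < N.+1) f (j%:R / N.+1%:R) *
    (h.[j.+1%:R / N.+1%:R] - h.[j%:R / N.+1%:R]).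
Proof.
have mc j : measurable (cell N.+1 j) by exact: measurable_itv.
have I j : mu.-integrable `[0, 1] (EFin \o (fun t => \1_(cell N.+1 j) t * h^`().[t])).
  apply: (@le_integrableR _ _ _ mu _ _ (fun t => `|h^`().[t]|)) => //.
  - apply: measurable_funM; apply: measurable_funTS; first exact: measurable_indic (mc j).
    by apply: continuous_measurable_fun => x; exact: continuous_horner.
  - move=> t _; rewrite normrM indicE; case: (_ \in _); first by rewrite normr1 mul1r.
    by rewrite normr0 mul0r.
  - exact: integrable_abse (integrable_horner _).
transitivity (\int[mu]_(t in `[0, 1]) \sum_(j < N.+2)
    (f (j%:R / N.+1%:R) * (\1_(cell N.+1 j) t * h^`().[t]))).
  apply: eq_Rintegral => t _; rewrite /step mulr_suml.
  by apply: eq_bigr => j _; ring.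
have [|_ ->] := @Rintegral_sum _ _ _ mu `[0, 1]%classic _ (index_enum 'I_(N.+2))
    (fun j t => f (j%:R / N.+1%:R) * (\1_(cell N.+1 j) t * h^`().[t])) (measurable_itv _).
  by move=> j _; exact: integrableRZl.
rewrite -[LHS]/(\sum_(j < N.+2) _) big_ord_recr/= [X in _ + X](_ : _ = 0) ?addr0.
  apply: eq_bigr => j _; rewrite RintegralZl//; congr (_ * _).
  rewrite -Rintegral_cell [RHS]Rintegral_mkcond [LHS]Rintegral_mkcond.
  apply: eq_Rintegral => t _; rewrite !patchE indicE.
  case: ifPn => [_|/negP t01].
    by case: (_ \in _); rewrite ?mul1r ?mul0r.
  case: ifPn => // /set_mem; rewrite /cell/= in_itv/= => /andP[a b].
  exfalso; apply: t01; apply/mem_set; rewrite /= in_itv/=.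
  rewrite (le_trans _ a) ?divr_ge0//= (le_trans (ltW b))//.
  by rewrite ler_pdivrMr// mul1r ler_nat.
rewrite RintegralZl// [X in _ * X](_ : _ = 0) ?mulr0//.
transitivity (\int[mu]_(t in [set 1]) h^`().[t]); last exact: Rintegral_set1.
rewrite [RHS]Rintegral_mkcond [LHS]Rintegral_mkcond.
apply: eq_Rintegral => t _; rewrite !patchE indicE.
case: ifPn => [/set_mem|/negP t01]; rewrite ?/= ?in_itv/=; last first.
  case: ifPn => // /set_mem /= t1; exfalso; apply: t01; apply/mem_set => /=.
  by rewrite t1 in_itv/= ler01 lexx.
move=> /andP[t0 t1]; case: ifPn => [/set_mem/= ->|/negP t1'].
  by rewrite mem_set ?mul1r// /cell/= in_itv/= divff ?gt_eqF// lexx/= ltr_pdivlMr// mul1r ltr_nat.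
rewrite memNset ?mul0r// /cell/= in_itv/= divff ?gt_eqF// => /andP[a _].
by apply: t1'; apply/mem_set => /=; apply/eqP; rewrite eq_le t1 a.
Qed.

Lemma continuous_integrableM (f : R -> R) (p : {poly R}) :
  {within `[0, 1], continuous f} ->
  mu.-integrable `[0, 1] (EFin \o (fun t => f t * p.[t])).
Proof.
move=> cf; apply: continuous_integrable => t.
by apply: cvgM; [exact: cf|exact: continuous_horner_within].
Qed.

(** The sum is the integral of [step f * h'], and step functions of [f] converge
    boundedly to [f]. *)
Lemma cvg_stieltjes_sum (f : R -> R) (h : {poly R}) :
  {within `[0, 1], continuous f} ->
  \sum_(j < n.+1) f (j%:R / n.+1%:R) * (h.[j.+1%:R / n.+1%:R] - h.[j%:R / n.+1%:R])
    @[n --> \oo] --> \int[mu]_(t in `[0, 1]) (f t * h^`().[t]).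
Proof.
move=> cf; under eq_fun do rewrite -Rintegral_step.
have [M fM] := within_continuous_bounded cf.
have mp : measurable_fun (`[0, 1]%classic : set R) (fun t : R => h^`().[t]).
  by apply: measurable_funTS; apply: continuous_measurable_fun => x; exact: continuous_horner.
have [||||//|_ +] := @dominated_cvg_Rintegral _ _ _ mu `[0, 1]%classic
  (fun n t => step n.+1 f t * h^`().[t]) (fun t => f t * h^`().[t])
  (fun t => M * `|h^`().[t]|) (measurable_itv _).
- move=> n; apply: measurable_funM => //; apply: measurable_funTS; exact: measurable_step.
- by have /integrableP[/measurable_EFinP] := continuous_integrableM h^`() cf.
- apply: aeW => t; rewrite /= in_itv/= => t01; apply: cvgM; last exact: cvg_cst.
  exact: cvg_step.
- by apply: integrableRZl => //; exact: integrable_abse (integrable_horner _).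
- move=> n t; rewrite /= in_itv/= => t01; rewrite normrM ler_wpM2r//.
  by rewrite step_grid_point// fM// grid_point01.
- by [].
Qed.

Lemma cvg_riemann_sum (f : R -> R) : {within `[0, 1], continuous f} ->
  (\sum_(j < n.+1) f (j%:R / n.+1%:R)) / n.+1%:R @[n --> \oo] -->
  \int[mu]_(t in `[0, 1]) f t.
Proof.
move=> cf; have := @cvg_stieltjes_sum _ 'X cf.
rewrite [X in _ --> X](_ : _ = \int[mu]_(t in `[0, 1]) f t); last first.
  by apply: eq_Rintegral => t _; rewrite derivX hornerC mulr1.
apply: cvg_trans; apply: near_eq_cvg; apply: nearW => n.
rewrite mulr_suml; apply: eq_bigr => j _; rewrite !hornerX -mulrBl.
by rewrite -natrB ?leqnSn// subSnn mul1r.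
Qed.

End step_functions.

(** * Linear functionals of the bridge *)

Section grid_covariance.
Context (R : realType).

Let sum_below (N i : nat) : (i <= N)%N ->
  \sum_(m < N) ((m < i)%N%:R : R) = i%:R.
Proof.
move=> iN; rewrite -natr_sum; congr (_%:R).
rewrite -(subnKC iN) big_split_ord/= -[RHS]addn0; congr addn.
  by rewrite (eq_bigr (fun=> 1%N)) ?sum1_card ?card_ord// => m _; rewrite ltn_ord.
by rewrite big1// => m _; rewrite ltnNge leq_addr.
Qed.

(** The covariance of the bridge on a grid of mesh [1 / N] is that of the
    centred random walk: a Gram matrix of indicators minus a rank-one term. *)
Lemma bridge_covariance_grid (N i j : nat) : (i <= N.+1)%N -> (j <= N.+1)%N ->
  Num.min (i%:R / N.+1%:R) (j%:R / N.+1%:R) -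
    (i%:R / N.+1%:R) * (j%:R / N.+1%:R) =
  (\sum_(m < N.+1) ((m < i)%N%:R : R) * (m < j)%N%:R) / N.+1%:R -
  (\sum_(m < N.+1) ((m < i)%N%:R : R)) / N.+1%:R *
    ((\sum_(m < N.+1) (m < j)%N%:R) / N.+1%:R).
Proof.
move=> iN jN; rewrite !sum_below//; congr (_ - _).
under eq_bigr do rewrite -natrM mulnb -ltn_min.
rewrite sum_below; last by rewrite geq_min iN.
rewrite -minr_pMl ?invr_ge0//; congr (_ * _).
by rewrite natr_min.
Qed.

Let telescope_tail (h : nat -> R) (N m : nat) : (m < N)%N ->
  \sum_(i < N) (m < i)%N%:R * (h i.+1 - h i) = h N - h m.+1.
Proof.
move=> mN; rewrite -(telescope_sumr _ mN) -(big_mkord xpredT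
  (fun i => (m < i)%N%:R * (h i.+1 - h i))).
rewrite (@big_cat_nat _ _ _ m.+1 0 N)//= big_nat_cond big1 ?add0r.
  by rewrite big_nat_cond [RHS]big_nat_cond; apply: eq_bigr => i /andP[/andP[-> _] _]; rewrite mul1r.
by move=> i /andP[/andP[_]]; rewrite ltnS leqNgt => /negbTE -> _; rewrite mul0r.
Qed.

(** Summation by parts: each row of the Gram matrix telescopes to a tail
    [h (N + 1) - h (m + 1)]. *)
Lemma grid_variance (h : nat -> R) (N : nat) :
  let D (i : 'I_N.+1) := h i.+1 - h i in
  \sum_(i < N.+1) \sum_(j < N.+1) D i * D j *
    (Num.min (i%:R / N.+1%:R) (j%:R / N.+1%:R) -
       (i%:R / N.+1%:R) * (j%:R / N.+1%:R)) =
  (\sum_(m < N.+1) (h N.+1 - h m.+1) ^+ 2) / N.+1%:R -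
  ((\sum_(m < N.+1) (h N.+1 - h m.+1)) / N.+1%:R) ^+ 2.
Proof.
move=> D; set c : R := N.+1%:R^-1.
pose e (m i : 'I_N.+1) : R := (m < i)%N%:R.
have tail (m : 'I_N.+1) : h N.+1 - h m.+1 = \sum_i e m i * D i.
  by rewrite (telescope_tail h (ltn_ord m)).
under eq_bigr => i _.
  under eq_bigr => j _.
    rewrite bridge_covariance_grid ?(ltnW (ltn_ord _))//.
    rewrite mulrBr.
    over.
  rewrite sumrB.
  over.
rewrite sumrB /=; congr (_ - _).
  transitivity (\sum_i \sum_j \sum_m (e m i * D i) * (e m j * D j) * c).
    apply: eq_bigr => i _; apply: eq_bigr => j _.
    rewrite mulr_suml mulr_sumr; apply: eq_bigr => m _; rewrite /e -/c.
    by move: (D i) (D j) => x y; ring.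
  rewrite mulr_suml.
  transitivity (\sum_i \sum_m \sum_j (e m i * D i) * (e m j * D j) * c).
    by apply: eq_bigr => i _; rewrite exchange_big.
  rewrite exchange_big; apply: eq_bigr => m _; rewrite tail expr2 mulr_suml mulr_suml.
  by apply: eq_bigr => i _; rewrite mulr_sumr mulr_suml.
have -> : (\sum_(m < N.+1) (h N.+1 - h m.+1)) * c =
    \sum_i D i * ((\sum_m e m i) * c).
  under eq_bigr do rewrite tail.
  rewrite exchange_big mulr_suml; apply: eq_bigr => i _.
  by rewrite -mulr_suml mulrA [D i * _]mulrC.
rewrite expr2 mulr_suml; apply: eq_bigr => i _; rewrite mulr_sumr.
by apply: eq_bigr => j _; rewrite mulrACA.
Qed.

(** The variance does not change when [h] is replaced by [h 1 - h], and
    right-end Riemann sums differ from left-end ones by a telescoping term over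
    [n + 1]. *)
Lemma cvg_grid_variance (h : {poly R}) :
  (\sum_(m < n.+1) (h.[n.+1%:R / n.+1%:R] - h.[m.+1%:R / n.+1%:R]) ^+ 2) / n.+1%:R -
  ((\sum_(m < n.+1) (h.[n.+1%:R / n.+1%:R] - h.[m.+1%:R / n.+1%:R])) / n.+1%:R) ^+ 2
    @[n --> \oo] --> pint (h ^+ 2) - pint h ^+ 2.
Proof.
have right_sum (g : {poly R}) :
    (\sum_(m < n.+1) g.[m.+1%:R / n.+1%:R]) / n.+1%:R @[n --> \oo] --> pint g.
  have e n : (\sum_(m < n.+1) g.[m.+1%:R / n.+1%:R]) / n.+1%:R =
      (\sum_(m < n.+1) g.[m%:R / n.+1%:R]) / n.+1%:R + (g.[1] - g.[0]) * n.+1%:R^-1.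
    rewrite -mulrDl; congr (_ * _).
    have := telescope_sumr (fun i => g.[i%:R / n.+1%:R]) (leq0n n.+1).
    rewrite big_mkord sumrB divff ?pnatr_eq0// mul0r => <-.
    by rewrite addrC subrK.
  under eq_fun do rewrite e.
  rewrite -[pint g]addr0; apply: cvgD.
    apply: cvg_riemann_sum; exact: continuous_horner_within.
  by rewrite -[X in _ --> X](mulr0 (g.[1] - g.[0])); apply: cvgMr; exact: cvg_harmonic.
pose G : {poly R} := h.[1]%:P - h.
have -> : pint (h ^+ 2) - pint h ^+ 2 = pint (G ^+ 2) - pint G ^+ 2.
  have -> : G ^+ 2 = h ^+ 2 - h.[1] *: h - h.[1] *: h + (h.[1] ^+ 2) *: 1.
    by rewrite /G alg_polyC -mul_polyC polyC_exp; ring.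
  have -> : G = h.[1] *: 1 - h by rewrite /G alg_polyC.
  by rewrite pintD !pintB !pintZ pint1; ring.
apply: cvgB; [|apply: (@cvg_comp _ _ _ _ (fun x : R => x ^+ 2)); last exact: exprn_continuous].
  apply: cvg_trans (right_sum (G ^+ 2)); apply: near_eq_cvg; apply: nearW => n.
  congr (_ / _); apply: eq_bigr => m _.
  by rewrite divff ?pnatr_eq0// horner_exp hornerD hornerN hornerC.
apply: cvg_trans (right_sum G); apply: near_eq_cvg; apply: nearW => n.
congr (_ / _); apply: eq_bigr => m _.
by rewrite divff ?pnatr_eq0// hornerD hornerN hornerC.
Qed.

End grid_covariance.

Section bridge_functionals.
Context (R : realType) d (T : measurableType d) (P : probability T R).
Variable B : R -> T -> R.
Hypothesis hB : brownian_bridge P B.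
Local Notation mu := (@lebesgue_measure R).

Lemma measurable_bridge (t : R) : 0 <= t <= 1 -> measurable_fun [set: T] (B t).
Proof. by move=> t01; have [[mB _] _ _ _] := hB; apply: mB; rewrite /= in_itv. Qed.

Lemma bridge_continuous w : {within `[0, 1], continuous (fun t => B t w)}.
Proof. by have [] := hB. Qed.

Lemma integral_bridge_sqr (t : R) : 0 <= t <= 1 ->
  (\int[P]_w (B t w ^+ 2)%:E = (t - t ^+ 2)%:E)%E.
Proof.
move=> t01; have [_ _ + _] := hB => /(_ t t); rewrite in_itv/= => /(_ t01 t01).
by rewrite minxx expr2 unlock => <-; apply: eq_integral => w _; rewrite /= expr2.
Qed.

Lemma integrable_bridge_sqr (t : R) : 0 <= t <= 1 ->
  P.-integrable [set: T] (EFin \o (fun w => B t w ^+ 2)).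
Proof.
move=> t01; have mB := measurable_bridge t01; apply/integrableP; split.
  by apply/measurable_EFinP; exact: measurable_funX.
rewrite [ltLHS](_ : _ = (t - t ^+ 2)%:E) ?ltry// -integral_bridge_sqr//.
by apply: eq_integral => w _; rewrite /= ger0_norm// sqr_ge0.
Qed.

Lemma bridge_covariance (s t : R) : 0 <= s <= 1 -> 0 <= t <= 1 ->
  P.-integrable [set: T] (EFin \o (fun w => B s w * B t w)) /\
  \int[P]_w (B s w * B t w) = Num.min s t - s * t.
Proof.
move=> s01 t01; split; last first.
  have [_ _ + _] := hB => /(_ s t); rewrite !in_itv/= => /(_ s01 t01).
  by rewrite unlock /Rintegral => ->.
apply: (@le_integrableR _ _ _ P _ _ (fun w => B s w ^+ 2 + B t w ^+ 2)) => //.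
- by apply: measurable_funM; exact: measurable_bridge.
- move=> w _; rewrite normrM -[B s w ^+ 2]real_normK ?num_real//.
  rewrite -[B t w ^+ 2]real_normK ?num_real//; have := sqr_ge0 (`|B s w| - `|B t w|).
  have := normr_ge0 (B s w); have := normr_ge0 (B t w).
  by move: `|B s w| `|B t w| => x y; nra.
- by apply: integrableRD => //; exact: integrable_bridge_sqr.
Qed.

Lemma bridge_mean (t : R) : 0 <= t <= 1 ->
  P.-integrable [set: T] (EFin \o B t) /\ \int[P]_w B t w = 0.
Proof.
move=> t01; split; last first.
  have [_ + _ _] := hB => /(_ t); rewrite in_itv/= => /(_ t01).
  by rewrite unlock /Rintegral => ->.
apply: (@le_integrableR _ _ _ P _ _ (fun w => 1 + B t w ^+ 2)) => //.
- exact: measurable_bridge.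
- move=> w _; rewrite -[B t w ^+ 2]real_normK ?num_real//.
  by have := normr_ge0 (B t w); move: `|B t w| => x; have := sqr_ge0 (x - 1); nra.
- apply: integrableRD => //; last exact: integrable_bridge_sqr.
  exact: finite_measure_integrable_cst.
Qed.

Lemma bridge_combination_cos (n : nat) (t a : 'I_n -> R) :
  (forall i, 0 <= t i <= 1) ->
  \int[P]_w cos (\sum_(i < n) a i * B (t i) w) =
  expR (- (\sum_(i < n) \sum_(j < n) a i * a j *
             (Num.min (t i) (t j) - t i * t j)) / 2).
Proof.
move=> t01; have [[_ gB] _ _ _] := hB.
have [|m [s [_ XN]]] := gB n t a; first by move=> i; rewrite /= in_itv/= t01.
set X := (fun w => \sum_(i < n) a i * B (t i) w) in XN *.
have X0 : \int[P]_w X w = 0.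
  have [|_ ->] := @Rintegral_sum _ _ _ P setT _ (index_enum 'I_n)
    (fun i w => a i * B (t i) w) measurableT.
    by move=> i _; apply: integrableRZl => //; exact: (bridge_mean (t01 i)).1.
  rewrite big1// => i _; have [I E] := bridge_mean (t01 i).
  by rewrite RintegralZl// E mulr0.
have X2 : \int[P]_w (X w ^+ 2) = \sum_(i < n) \sum_(j < n) a i * a j *
             (Num.min (t i) (t j) - t i * t j).
  have I i j : P.-integrable [set: T]
      (EFin \o (fun w => a i * a j * (B (t i) w * B (t j) w))).
    by apply: integrableRZl => //; exact: (bridge_covariance (t01 i) (t01 j)).1.
  transitivity (\int[P]_w (\sum_i \sum_j a i * a j * (B (t i) w * B (t j) w))).
    apply: eq_Rintegral => w _; rewrite expr2 mulr_suml; apply: eq_bigr => i _.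
    by rewrite mulr_sumr; apply: eq_bigr => j _; rewrite mulrACA.
  have J i := @Rintegral_sum _ _ _ P setT _ (index_enum 'I_n)
    (fun j w => a i * a j * (B (t i) w * B (t j) w)) measurableT (fun j _ => I i j).
  have [_ ->] := @Rintegral_sum _ _ _ P setT _ (index_enum 'I_n)
    (fun i w => \sum_j a i * a j * (B (t i) w * B (t j) w)) measurableT
    (fun i _ => (J i).1).
  apply: eq_bigr => i _; rewrite (J i).2; apply: eq_bigr => j _.
  have [K E] := bridge_covariance (t01 i) (t01 j).
  by rewrite RintegralZl// E.
have := centered_normal_cos 1 0 XN X0 X2.
rewrite cos0 mul1r expr1n mulr1 mulNr => <-.
by apply: eq_Rintegral => w _; rewrite mul1r addr0.
Qed.

Definition bridge_functional (h : {poly R}) (w : T) : R :=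
  \int[mu]_(t in `[0, 1]) (B t w * h^`().[t]).

Let stieltjes (h : {poly R}) n w := \sum_(j < n.+1)
  B (j%:R / n.+1%:R) w * (h.[j.+1%:R / n.+1%:R] - h.[j%:R / n.+1%:R]).

Let cvg_stieltjes h w : stieltjes h n w @[n --> \oo] --> bridge_functional h w.
Proof. exact: (@cvg_stieltjes_sum R (fun t => B t w) h (@bridge_continuous w)). Qed.

Let grid01 n (j : 'I_n.+1) : 0 <= (j%:R / n.+1%:R : R) <= 1.
Proof.
by rewrite divr_ge0//= ler_pdivrMr ?ltr0n// mul1r ler_nat ltnW.
Qed.

Let measurable_stieltjes h n : measurable_fun [set: T] (stieltjes h n).
Proof.
apply: measurable_sum => j; apply: measurable_funM => //.
exact: measurable_bridge.
Qed.

Lemma measurable_bridge_functional h : measurable_fun [set: T] (bridge_functional h).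
Proof.
apply: (@measurable_fun_cvg _ _ _ _ (stieltjes h)) => //.
Qed.

(** Riemann-Stieltjes sums are finite combinations of values of the bridge, so
    they are centred normal variables; their variances converge. *)
Lemma bridge_functional_cos (h : {poly R}) :
  \int[P]_w cos (bridge_functional h w) =
  expR (- (pint (h ^+ 2) - pint h ^+ 2) / 2).
Proof.
have [||||//|_ c1] := @dominated_cvg_Rintegral _ _ _ P setT
  (fun n w => cos (stieltjes h n w)) (fun w => cos (bridge_functional h w))
  (cst 1) measurableT.
- by move=> n; apply: measurableT_comp (measurable_stieltjes h n); exact: measurable_cos.
- by apply: measurableT_comp (measurable_bridge_functional h); exact: measurable_cos.
- apply: aeW => w _; apply: (@cvg_comp _ _ _ _ (@cos R) _ _ _ (@cvg_stieltjes h w)).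
  exact: continuous_cos.
- exact: finite_measure_integrable_cst.
- by move=> n w _; rewrite ler_norml cos_geN1 cos_le1.
have c2 : expR (- ((\sum_(m < n.+1) (h.[n.+1%:R / n.+1%:R] - h.[m.+1%:R / n.+1%:R]) ^+ 2) / n.+1%:R -
  ((\sum_(m < n.+1) (h.[n.+1%:R / n.+1%:R] - h.[m.+1%:R / n.+1%:R])) / n.+1%:R) ^+ 2) / 2)
   @[n --> \oo] --> expR (- (pint (h ^+ 2) - pint h ^+ 2) / 2).
  apply: (@cvg_comp _ _ _ _ (@expR R)); last exact: continuous_expR.
  apply: cvgMl; apply: cvgN; exact: cvg_grid_variance.
rewrite -(cvg_lim _ c1)// -[RHS](cvg_lim _ c2)//; apply: (congr1 (fun u : nat -> R => limn u)).
apply/funext => n.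
rewrite -(grid_variance (fun j => h.[j%:R / n.+1%:R])) -bridge_combination_cos//.
by apply: eq_Rintegral => w _; congr cos; apply: eq_bigr => j _; rewrite mulrC.
Qed.

End bridge_functionals.

(** * Bessel's inequality and Parseval's identity for one path *)

Lemma measurable_inv (R : realType) : measurable_fun [set: R] (fun x : R => x^-1).
Proof.
have -> : [set: R] = [set x | x != 0] `|` [set 0].
  apply/seteqP; split => // x _ /=.
  by have [->|x0] := eqVneq x 0; [right|left].
have o : open [set x : R | x != 0].
  rewrite (_ : mkset _ = ~` [set 0]); last by apply/seteqP; split => x /=; move/eqP.
  by rewrite openC; exact: closed_eq.
apply/measurable_funU => //; first exact: open_measurable.
split; last exact: measurable_fun_set1.
apply: open_continuous_measurable_fun => // x /set_mem/= x0.
exact: inv_continuous.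
Qed.

Lemma measurable_logit (R : realType) : measurable_fun [set: R] (@logit R).
Proof.
apply: (measurableT_comp (@measurable_ln R)); apply: measurable_funM => //.
apply: (measurableT_comp (@measurable_inv R)); exact: measurable_funB.
Qed.

Lemma measurable_horner (R : realType) (p : {poly R}) :
  measurable_fun [set: R] (horner p).
Proof. by apply: continuous_measurable_fun => x; exact: continuous_horner. Qed.

Section one_path.
Context (R : realType).
Local Notation mu := (@lebesgue_measure R).
Local Notation w := (weight R).
Local Notation P := (legendre R).
Local Notation I := (`[0, 1]%classic : set R).

Let IZ k (f : R -> R) : mu.-integrable I (EFin \o f) ->
  mu.-integrable I (EFin \o (fun t => k * f t)).
Proof. exact: integrableRZl. Qed.

Let ID (f g : R -> R) : mu.-integrable I (EFin \o f) ->
  mu.-integrable I (EFin \o g) -> mu.-integrable I (EFin \o (fun t => f t + g t)).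
Proof. exact: integrableRD. Qed.

Let IB (f g : R -> R) : mu.-integrable I (EFin \o f) ->
  mu.-integrable I (EFin \o g) -> mu.-integrable I (EFin \o (fun t => f t - g t)).
Proof. exact: integrableRB. Qed.

(** Pointwise estimates are to be proved on the open interval, where the weight
    is positive; the end points form a null set. *)
Lemma Rintegral_ge0_oo (f : R -> R) : mu.-integrable I (EFin \o f) ->
  (forall t, 0 < t < 1 -> 0 <= f t) -> 0 <= \int[mu]_(t in I) f t.
Proof.
move=> If f0.
have Io : mu.-integrable `]0, 1[ (EFin \o f).
  by apply: integrableS If => //; exact: subset_itv_oo_cc.
have Ico : mu.-integrable `[0, 1[ (EFin \o f).
  by apply: integrableS If => //; exact: subset_itv_co_cc.
rewrite -Rintegral_itv_bndo_bndc// -Rintegral_itv_obnd_cbnd//.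
by apply: Rintegral_ge0 => t; rewrite /= in_itv/=; exact: f0.
Qed.

Lemma le_Rintegral_oo (f g : R -> R) :
  mu.-integrable I (EFin \o f) -> mu.-integrable I (EFin \o g) ->
  (forall t, 0 < t < 1 -> f t <= g t) ->
  \int[mu]_(t in I) f t <= \int[mu]_(t in I) g t.
Proof.
move=> If Ig fg; rewrite -subr_ge0 -RintegralB//.
apply: Rintegral_ge0_oo => [|t t01]; last by rewrite subr_ge0 fg.
exact: integrableRB.
Qed.

Variable f : R -> R.
Hypothesis cf : {within I, continuous f}.
Hypothesis If : mu.-integrable I (EFin \o (fun t => f t ^+ 2 / w.[t])).

Let A := \int[mu]_(t in I) (f t ^+ 2 / w.[t]).

(** The coordinate of [f] along the [k]-th Legendre direction; for the bridge
    these are independent standard normal variables. *)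
Definition legendre_coord (g : R -> R) (k : nat) : R :=
  Num.sqrt (2 * k%:R + 1) * \int[mu]_(t in I) (g t * (P k)^`().[t]).

Let xi := legendre_coord f.

Let Ifp (p : {poly R}) : mu.-integrable I (EFin \o (fun t => f t * p.[t])).
Proof. exact: (@continuous_integrableM R f p cf). Qed.

(** The orthogonal projection of [f / w] on the derivatives of the first [n]
    Legendre polynomials, in the space weighted by [w]. *)
Definition legendre_proj (n : nat) : {poly R} :=
  \sum_(1 <= k < n.+1) (Num.sqrt (2 * k%:R + 1) * xi k / (k%:R * (k%:R + 1))) *: (P k)^`().

Definition bessel_sum (n : nat) : R :=
  \sum_(1 <= k < n.+1) xi k ^+ 2 / (k%:R * (k%:R + 1)).

Let sqrt_sqr (k : nat) : Num.sqrt (2 * k%:R + 1) ^+ 2 = 2 * k%:R + 1 :> R.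
Proof. by rewrite sqr_sqrtr. Qed.

Let pronic_neq0 (k : nat) : (1 <= k)%N -> k%:R * (k%:R + 1) != 0 :> R.
Proof. by move=> k1; rewrite mulf_neq0 ?natr1 ?pnatr_eq0 -?lt0n. Qed.

Lemma Rintegral_legendre_proj n :
  \int[mu]_(t in I) (f t * (legendre_proj n).[t]) = bessel_sum n.
Proof.
transitivity (\int[mu]_(t in I) (\sum_(1 <= k < n.+1)
   Num.sqrt (2 * k%:R + 1) * xi k / (k%:R * (k%:R + 1)) * (f t * (P k)^`().[t]))).
  apply: eq_Rintegral => t _; rewrite horner_sum mulr_sumr; apply: eq_bigr => k _.
  by rewrite hornerZ mulrCA.
have [|_ ->] := @Rintegral_sum _ _ _ mu I _ (index_iota 1 n.+1) (fun k t =>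
   Num.sqrt (2 * k%:R + 1) * xi k / (k%:R * (k%:R + 1)) * (f t * (P k)^`().[t]))
   (measurable_itv _).
  by move=> k _; apply: integrableRZl => //; exact: Ifp.
apply: eq_bigr => k _; rewrite RintegralZl//.
by rewrite /xi /legendre_coord; ring.
Qed.

Lemma legendre_proj_sqr n : pint (w * legendre_proj n ^+ 2) = bessel_sum n.
Proof.
pose a k : R := Num.sqrt (2 * k%:R + 1) * xi k / (k%:R * (k%:R + 1)).
have inner j k : pint (w * (P j)^`() * (P k)^`()) =
    if j == k then k%:R * (k%:R + 1) / (2 * k%:R + 1) else 0.
  rewrite legendre_green; case: eqVneq => [->|jk]; first by rewrite legendre_norm.
  by rewrite legendre_orthogonal// mulr0.
have -> : w * legendre_proj n ^+ 2 = \sum_(1 <= j < n.+1) \sum_(1 <= k < n.+1)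
    (a j * a k) *: (w * (P j)^`() * (P k)^`()).
  rewrite expr2 {1}/legendre_proj mulr_suml mulr_sumr; apply: eq_bigr => j _.
  rewrite /legendre_proj !mulr_sumr; apply: eq_bigr => k _.
  rewrite -/(a j) -/(a k); move: (a j) (a k) (P j)^`() (P k)^`() => x y p q.
  by rewrite -scalerAl -!scalerAr scalerA mulrA.
rewrite pint_sum; apply: eq_big_nat => j /andP[j1 jn].
rewrite pint_sum (bigD1_seq j)/= ?mem_index_iota ?j1 ?iota_uniq//= big1 ?addr0.
  rewrite pintZ inner eqxx /a.
  have nz : 2 * j%:R + 1 != 0 :> R by rewrite gt_eqF.
  have nz' := pronic_neq0 j1.
  transitivity (Num.sqrt (2 * j%:R + 1) ^+ 2 / (2 * j%:R + 1) * (xi j ^+ 2 / (j%:R * (j%:R + 1)))).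
    move: (2 * j%:R + 1) (j%:R * (j%:R + 1)) nz nz' => x y x0 y0.
    by field; rewrite x0 y0.
  by rewrite sqrt_sqr divff// mul1r.
by move=> k kj; rewrite pintZ inner eq_sym (negbTE kj) mulr0.
Qed.

(** The squared distance from [f / w] to its projection, expanded: Pythagoras'
    theorem in the space weighted by [w]. The expanded form is continuous up to
    the term [f ^ 2 / w], hence integrable on the closed interval. *)
Lemma legendre_residual n :
  let g t := f t ^+ 2 / w.[t] - 2 * (f t * (legendre_proj n).[t]) +
             (w * legendre_proj n ^+ 2).[t] in
  [/\ mu.-integrable I (EFin \o g),
      forall t, 0 < t < 1 -> g t = (f t - w.[t] * (legendre_proj n).[t]) ^+ 2 / w.[t] &
      \int[mu]_(t in I) g t = A - bessel_sum n].
Proof.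
move=> g; set p := legendre_proj n in g *.
have I1 := Ifp p.
have I2 := IZ 2 I1.
have I3 := integrable_horner (w * p ^+ 2).
have I4 := IB If I2.
split.
- exact: integrableRD.
- move=> t /weight_gt0 w0; rewrite /g hornerM horner_exp.
  have wn : w.[t] != 0 by rewrite gt_eqF.
  by move: w.[t] p.[t] (f t) wn => x y z x0; field.
- rewrite /g RintegralD// RintegralB// RintegralZl//.
  rewrite -/(pint (w * p ^+ 2)) legendre_proj_sqr Rintegral_legendre_proj -/A; ring.
Qed.

Lemma bessel_le n : bessel_sum n <= A.
Proof.
have [Ig gE IE] := legendre_residual n; rewrite -subr_ge0 -IE.
apply: Rintegral_ge0_oo => // t t01; rewrite gE// divr_ge0// ?sqr_ge0//.
by rewrite ltW// weight_gt0.
Qed.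

Let mf : measurable_fun I f.
Proof. by have /integrableP[/measurable_EFinP] := continuous_integrable cf. Qed.

Let integrable_weight_logit_sqr :
  mu.-integrable I (EFin \o (fun t => w.[t] * logit t ^+ 2)).
Proof.
apply: (@le_integrableR _ _ _ mu _ _ (cst 16)) => //.
- apply: measurable_funTS; apply: measurable_funM; first exact: measurable_horner.
  by apply: measurable_funX; exact: measurable_logit.
- move=> t; rewrite /= in_itv/= => t01.
  by rewrite ger0_norm ?weight_logit_sqr_le// mulr_ge0 ?sqr_ge0 ?weight_ge0.
- apply: continuous_integrable => t; exact: cvg_cst.
Qed.

(** With [x = |f| / w], the product [|f * logit|] is [w x |logit|], at most
    [w x ^ 2 + w logit ^ 2]. *)
Lemma integrable_mul_logit : mu.-integrable I (EFin \o (fun t => f t * logit t)).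
Proof.
have l0 : logit 0 = 0 :> R by rewrite /logit mul0r ln0.
have l1 : logit 1 = 0 :> R by rewrite /logit subrr invr0 mulr0 ln0.
apply: (@le_integrableR _ _ _ mu _ _
  (fun t => f t ^+ 2 / w.[t] + w.[t] * logit t ^+ 2)) => //.
- apply: measurable_funM => //; apply: measurable_funTS; exact: measurable_logit.
- move=> t; rewrite /= in_itv/= => /andP[].
  rewrite le_eqVlt => /predU1P[<-|t0]; first by rewrite l0 mulr0 normr0 weight0 invr0 !mulr0 mul0r addr0.
  rewrite le_eqVlt => /predU1P[->|t1]; first by rewrite l1 mulr0 normr0 weight1 invr0 !mulr0 mul0r addr0.
  have w0 : 0 < w.[t] by rewrite weight_gt0// t0.
  have -> : f t ^+ 2 / w.[t] = (`|f t| / w.[t]) ^+ 2 * w.[t].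
    by rewrite -[f t ^+ 2]real_normK ?num_real//; field; rewrite gt_eqF.
  have e : `|f t| = `|f t| / w.[t] * w.[t] by rewrite divfK// gt_eqF.
  rewrite normrM -[logit t ^+ 2]real_normK ?num_real// {1}e.
  have x0 : 0 <= `|f t| / w.[t] by rewrite divr_ge0// ltW.
  move: w.[t] (`|f t| / w.[t]) `|logit t| (normr_ge0 (logit t)) w0 x0 => x y z z0 x0 y0.
  have := sqr_ge0 (y - z); have := mulr_ge0 (ltW x0) (mulr_ge0 y0 z0); nra.
- exact: integrableRD.
Qed.

(** The weighted Cauchy-Schwarz inequality between [f / w - legendre_proj n] and
    [logit], in the additive form [2 |x y| <= tau x ^ 2 + y ^ 2 / tau]. *)
Lemma mul_logit_error (n : nat) (tau : R) : 0 < tau ->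
  2 * `|\int[mu]_(t in I) (f t * logit t) -
        \int[mu]_(t in I) (w.[t] * logit t * (legendre_proj n).[t])| <=
  tau * (A - bessel_sum n) + tau^-1 * 16.
Proof.
move=> tau0; have [Ig gE IE] := legendre_residual n.
set g := (fun t => _ + _) in Ig gE IE; set p := legendre_proj n in Ig gE IE *.
have Ip : mu.-integrable I (EFin \o (fun t => w.[t] * logit t * p.[t])).
  by apply: continuous_integrable; exact: continuous_weight_logit_horner.
have If' := integrable_mul_logit.
have Id := IB If' Ip.
have It := IZ tau Ig.
have I16 : mu.-integrable I (EFin \o (cst (tau^-1 * 16))).
  by apply: continuous_integrable => t; exact: cvg_cst.
have Ib := ID It I16.
have bE : \int[mu]_(t in I) (tau * g t + cst (tau^-1 * 16) t) =
    tau * (A - bessel_sum n) + tau^-1 * 16.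
  rewrite RintegralD// RintegralZl// IE; congr (_ + _).
  transitivity (pint (tau^-1 * 16)%:P).
    by apply: eq_Rintegral => t _; rewrite hornerC.
  by rewrite -alg_polyC pintZ pint1 mulr1.
have key t : 0 < t < 1 -> 2 * `|f t * logit t - w.[t] * logit t * p.[t]| <=
    tau * g t + cst (tau^-1 * 16) t.
  move=> t01; rewrite (gE t t01 : g t = _) /cst mulrAC -mulrBl normrM.
  have w0 := weight_gt0 t01.
  have t01' : 0 <= t <= 1 by case/andP: t01 => /ltW-> /ltW->.
  have le16 : tau^-1 * (w.[t] * logit t ^+ 2) <= tau^-1 * 16.
    by rewrite ler_pM2l ?invr_gt0// weight_logit_sqr_le.
  apply: le_trans (lerD (lexx _) le16).
  have -> : (f t - w.[t] * p.[t]) ^+ 2 / w.[t] =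
     (`|f t - w.[t] * p.[t]| / w.[t]) ^+ 2 * w.[t].
    by rewrite -[(_ - _) ^+ 2]real_normK ?num_real//; field; rewrite gt_eqF.
  have e : `|f t - w.[t] * p.[t]| = `|f t - w.[t] * p.[t]| / w.[t] * w.[t].
    by rewrite divfK// gt_eqF.
  rewrite -[logit t ^+ 2]real_normK ?num_real// {1}e.
  move: w.[t] (`|_| / w.[t]) `|logit t| w0 => x y z x0.
  rewrite -subr_ge0 (_ : _ - _ = x / tau * (tau * y - z) ^+ 2).
    by rewrite mulr_ge0 ?sqr_ge0 ?divr_ge0// ltW.
  by field; rewrite gt_eqF.
have norm2 (x : R) : 2 * `|x| = `|2 * x| by rewrite normrM (ger0_norm (ler0n _ 2)).
rewrite norm2 -RintegralB// -RintegralZl//.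
have I2 := IZ 2 Id.
rewrite -bE ler_norml; apply/andP; split.
  rewrite -mulN1r -RintegralZl//; apply: le_Rintegral_oo => //.
    exact: integrableRZl.
  move=> t /key; rewrite mulN1r => h; rewrite lerNl (le_trans _ h)//.
  by rewrite norm2 -normrN ler_norm.
apply: le_Rintegral_oo => // t /key h; rewrite (le_trans _ h)//.
by rewrite norm2 ler_norm.
Qed.

Hypothesis parseval : bessel_sum n @[n --> \oo] --> A.

Lemma cvg_mul_logit :
  \int[mu]_(t in I) (w.[t] * logit t * (legendre_proj n).[t]) @[n --> \oo] -->
  \int[mu]_(t in I) (f t * logit t).
Proof.
apply/cvgrPdist_le => /= e e0.
(* This choice makes each of the two error terms at most [e]. *)
pose tau := 16 / e; have tau0 : 0 < tau by rewrite divr_gt0.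
have d0 : 0 < e ^+ 2 / 16 by rewrite divr_gt0// exprn_gt0.
have /cvgrPdist_le/(_ _ d0) := parseval.
apply: filterS => n; rewrite ler_norml => /andP[_ h].
rewrite -(@ler_pM2l _ 2)// (le_trans (mul_logit_error n tau0))//.
rewrite -(_ : tau * (e ^+ 2 / 16) + tau^-1 * 16 = 2 * e).
  by rewrite lerD2r ler_wpM2l// ltW.
by rewrite /tau; field; rewrite gt_eqF.
Qed.


Let logit_coeff (k : nat) : R :=
  Num.sqrt (2 * k%:R + 1) * xi k / (k%:R * (k%:R + 1)) *
  \int[mu]_(t in I) (w.[t] * logit t * (P k)^`().[t]).

Let logit_projE n :
  \int[mu]_(t in I) (w.[t] * logit t * (legendre_proj n).[t]) =
  \sum_(1 <= k < n.+1) logit_coeff k.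
Proof.
transitivity (\int[mu]_(t in I) (\sum_(1 <= k < n.+1)
   Num.sqrt (2 * k%:R + 1) * xi k / (k%:R * (k%:R + 1)) *
     (w.[t] * logit t * (P k)^`().[t]))).
  apply: eq_Rintegral => t _; rewrite horner_sum mulr_sumr; apply: eq_bigr => k _.
  by rewrite hornerZ mulrCA.
have Ik k : mu.-integrable I (EFin \o (fun t => w.[t] * logit t * (P k)^`().[t])).
  by apply: continuous_integrable; exact: continuous_weight_logit_horner.
have [|_ ->] := @Rintegral_sum _ _ _ mu I _ (index_iota 1 n.+1) (fun k t =>
   Num.sqrt (2 * k%:R + 1) * xi k / (k%:R * (k%:R + 1)) *
     (w.[t] * logit t * (P k)^`().[t])) (measurable_itv _).
  by move=> k _; exact: IZ.
by apply: eq_bigr => k _; rewrite RintegralZl.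
Qed.

Let logit_coeff_odd k : odd k -> logit_coeff k = 0.
Proof. by move=> ok; rewrite /logit_coeff logit_legendre_odd// mulr0. Qed.

Let logit_coeff_even (l : nat) : (1 <= l)%N -> 6 * logit_coeff (2 * l)%N = lin_term xi l.
Proof.
move=> l1; rewrite /logit_coeff logit_legendre_even ?muln_gt0//; last by rewrite oddM.
rewrite /lin_term natrM.
have -> : 2 * (2 * l%:R) + 1 = 4 * l%:R + 1 :> R by ring.
have l1' : (1 : R) <= l%:R by rewrite ler1n.
move: (xi _) (Num.sqrt _) => x s; move: (l%:R : R) l1' => y y1.
have h1 : y != 0 by rewrite gt_eqF// (lt_le_trans ltr01).
have h2 : y + 1 != 0 by apply/eqP; lra.
have h3 : 2 * y - 1 != 0 by apply/eqP; lra.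
have h4 : 2 * y + 1 != 0 by apply/eqP; lra.
have h5 : 2 * y * (2 * y + 1) - 2 != 0.
  rewrite (_ : _ - 2 = 2 * (2 * y - 1) * (y + 1)); last by ring.
  by rewrite !mulf_neq0.
by field; rewrite h1 h2 h3 h4 h5.
Qed.

(** Only even indices contribute; for [k = 2 l] the factor
    [k (k + 1) - 2] is [2 (2 l - 1) (l + 1)]. *)
Lemma cvg_lin_series_path :
  (\sum_(1 <= l < n) lin_term xi l) @[n --> \oo] -->
  \int[mu]_(t in I) log_integrand f t.
Proof.
have E n : \sum_(1 <= l < n.+1) lin_term xi l =
    6 * \int[mu]_(t in I) (w.[t] * logit t * (legendre_proj (2 * n)).[t]).
  rewrite logit_projE; elim: n => [|n IH]; first by rewrite !big_geq// mulr0.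
  rewrite mulnS add2n [in RHS]big_nat_recr//= [in RHS]big_nat_recr//=.
  rewrite big_nat_recr//= IH.
  rewrite logit_coeff_odd ?addr0; last by rewrite /= oddM.
  rewrite mulrDr; congr (_ + _).
  by have := logit_coeff_even (ltn0Sn n); rewrite mulnS add2n => <-.
have -> : \int[mu]_(t in I) log_integrand f t = 6 * \int[mu]_(t in I) (f t * logit t).
  rewrite -RintegralZl//; last exact: integrable_mul_logit.
  by apply: eq_Rintegral => t _; rewrite /log_integrand /logit mulrA.
rewrite -cvg_shiftS; under eq_fun do rewrite E.
apply: cvgMr.
apply: (@cvg_comp _ _ _ (fun n => (2 * n)%N) _ _ _ _ _ cvg_mul_logit).
move=> U [N _ NU]; exists N => // n /= Nn; apply: NU => /=.
by rewrite (leq_trans Nn)// leq_pmull.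
Qed.

Let deriv_legendre1 : (P 1)^`() = (-2)%:P.
Proof.
apply/polyP => -[|j]; rewrite coef_deriv coefC/=.
  by rewrite coef_legendre/=; field.
by rewrite nth_default ?mul0rn// size_legendre.
Qed.

(** The term [k = 1] of Parseval's identity is the squared integral of [6 f],
    because the first Legendre derivative is constant. *)
Lemma cvg_quad_series_path :
  (\sum_(2 <= k < n) quad_term xi k) @[n --> \oo] -->
  \int[mu]_(t in I) quad_integrand f t - (\int[mu]_(t in I) lin_integrand f t) ^+ 2.
Proof.
have -> : \int[mu]_(t in I) quad_integrand f t = 6 * A.
  rewrite -RintegralZl//; apply: eq_Rintegral => t _.
  by rewrite /quad_integrand horner_weight mulrA.
have -> : (\int[mu]_(t in I) lin_integrand f t) ^+ 2 = 3 * xi 1%N ^+ 2.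
  have -> : \int[mu]_(t in I) lin_integrand f t = 6 * \int[mu]_(t in I) f t.
    by rewrite -RintegralZl//; exact: continuous_integrable.
  have -> : xi 1%N = Num.sqrt (2 * 1 + 1) * (-2 * \int[mu]_(t in I) f t).
    rewrite /xi /legendre_coord deriv_legendre1; congr (_ * _).
    rewrite -RintegralZl//; last exact: continuous_integrable.
    by apply: eq_Rintegral => t _; rewrite hornerC mulrC.
  by rewrite !exprMn sqr_sqrtr//; ring.
have E n : \sum_(2 <= k < n.+2) quad_term xi k = 6 * bessel_sum n.+1 - 3 * xi 1%N ^+ 2.
  rewrite /bessel_sum [in RHS]big_ltn//= mulrDr mulr_sumr addrAC.
  rewrite [X in X + _](_ : _ = 0) ?add0r; last by field.
  by apply: eq_bigr => k _; rewrite /quad_term; ring.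
rewrite -(cvg_shiftn 2); under eq_fun do rewrite addn2 E.
apply: cvgB; last exact: cvg_cst.
by apply: cvgMr; move: parseval; rewrite -cvg_shiftS.
Qed.

Lemma integrable_quad_integrand : mu.-integrable I (EFin \o quad_integrand f).
Proof.
apply: eq_integrable (IZ 6 If) => // t _ /=.
by rewrite /quad_integrand horner_weight mulrA.
Qed.

Lemma integrable_lin_integrand : mu.-integrable I (EFin \o lin_integrand f).
Proof. by apply: IZ; exact: continuous_integrable. Qed.

Lemma integrable_log_integrand : mu.-integrable I (EFin \o log_integrand f).
Proof.
apply: eq_integrable (IZ 6 integrable_mul_logit) => // t _ /=.
by rewrite /log_integrand /logit mulrA.
Qed.

End one_path.

(** * Parseval's identity along almost every path of the bridge *)

(** The pointwise limit lies below every term, so its mean is 0. *)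
Lemma ae_cvg0_nonincreasing (R : realType) d (T : measurableType d)
    (P : {measure set T -> \bar R}) (r : nat -> T -> \bar R) :
  (forall n, measurable_fun [set: T] (r n)) ->
  (forall n w, (0 <= r n w)%E) ->
  (forall w, nonincreasing_seq (r ^~ w)) ->
  (forall n, (\int[P]_w r n w <= (n.+1%:R^-1)%:E)%E) ->
  {ae P, forall w, r n w @[n --> \oo] --> 0%E}.
Proof.
move=> mr r0 rni ri; pose l w := ereal_inf (range (r ^~ w)).
have rl w : r n w @[n --> \oo] --> l w by exact: ereal_nonincreasing_cvgn.
have ml : measurable_fun [set: T] l by apply: (emeasurable_fun_cvg r).
have l0 w : (0 <= l w)%E by apply: le_ereal_inf_tmp => _ [n _ <-].
have lr n w : (l w <= r n w)%E by apply: ereal_inf_lbound; exists n.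
have il : (\int[P]_w `|l w| = 0)%E.
  apply/eqP; rewrite eq_le; apply/andP; split; last exact: integral_ge0.
  apply/lee_addgt0Pr => e e0; rewrite add0e.
  have [n ne] : exists n, n.+1%:R^-1 <= e.
    have /cvgrPdist_le/(_ _ e0) [n _ hn] := @cvg_harmonic R.
    exists n; have := hn n (leqnn n); rewrite sub0r normrN /harmonic/= ger0_norm//.
  apply: (@le_trans _ _ (\int[P]_w r n w)%E); last first.
    by rewrite (le_trans (ri n))// lee_fin.
  apply: ge0_le_integral => //; first exact: measurableT_comp.
  by move=> w _; rewrite gee0_abs.
have [N [mN PN sN]] := (ae_eq_integral_abs P measurableT ml).1 il.
exists N; split => // w /= h; apply: sN => /= h'; apply: h.
by rewrite -(h' I); exact: rl.
Qed.

Section cosine_bound.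
Context (R : realType).

Let sin_le (y : R) : 0 <= y -> sin y <= y.
Proof.
move=> y0; have := @Rintegral_FTC R 0 y (fun t => 1 - cos t) (fun t => t - sin t) y0.
rewrite sin0 !subr0 => h; rewrite -subr_ge0 -h.
- by apply: Rintegral_ge0 => t _; rewrite subr_ge0 cos_le1.
- apply: continuous_subspaceT => t; apply: cvgB; first exact: cvg_cst.
  exact: continuous_cos.
- apply: continuous_subspaceT => t; apply: cvgB; first exact: cvg_id.
  exact: continuous_sin.
Qed.

Lemma cos_ge_quadratic (y : R) : 1 - y ^+ 2 / 2 <= cos y.
Proof.
wlog y0 : y / 0 <= y => [H|].
  have [/H//|y0] := leP 0 y.
  by rewrite -cosN -sqrrN; apply: H; rewrite oppr_ge0 ltW.
have := @Rintegral_FTC R 0 y (fun t => t - sin t) (fun t => t ^+ 2 / 2 + cos t) y0.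
rewrite cos0 expr0n/= mul0r add0r => h.
have : 0 <= y ^+ 2 / 2 + cos y - 1; last by lra.
rewrite [leRHS](_ : _ = \int[@lebesgue_measure R]_(t in `[0, y]) (t - sin t)).
  apply: Rintegral_ge0 => t; rewrite /= in_itv/= => /andP[t0 _].
  by rewrite subr_ge0 sin_le.
apply/esym/h.
- apply: continuous_subspaceT => t; apply: cvgB; first exact: cvg_id.
  exact: continuous_sin.
- apply: continuous_subspaceT => t; apply: cvgD; last exact: continuous_cos.
  by apply: cvgMl; exact: exprn_continuous.
- move=> t _; apply: is_derive_eq; rewrite /GRing.scale/=; lra.
Qed.

End cosine_bound.

(** The cosine transform of the standard normal law controls the second moment
    from below: [1 - cos] is below half the square, and
    [1 - exp (- e)] is above [e * (1 - e)]. *)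
Lemma sqr_moment_ge1 (R : realType) d (T : measurableType d)
    (P : probability T R) (X : T -> R) : measurable_fun [set: T] X ->
  (forall u, \int[P]_w cos (u * X w) = expR (- u ^+ 2 / 2)) ->
  (1 <= \int[P]_w (X w ^+ 2)%:E)%E.
Proof.
move=> mX XN; apply/lee_addgt0Pr => e e0.
have [e1|e1] := leP 1 e.
  rewrite (@le_trans _ _ e%:E)// leeDr// integral_ge0// => w _.
  by rewrite lee_fin sqr_ge0.
(* At this frequency the cosine transform is [exp (- e)]. *)
pose u := Num.sqrt (2 * e); have uu : u ^+ 2 = 2 * e by rewrite sqr_sqrtr// mulr_ge0// ltW.
have mc : measurable_fun [set: T] (fun w => cos (u * X w)).
  by apply: measurableT_comp; [exact: measurable_cos|exact: measurable_funM].
have Ic : P.-integrable [set: T] (EFin \o (fun w => cos (u * X w))).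
  apply: (@bounded_integrable _ _ _ P _ _ 1) => // w _.
  by rewrite ler_norml cos_geN1 cos_le1.
have I1 : P.-integrable [set: T] (EFin \o (fun w => e^-1 * (1 - cos (u * X w)))).
  apply: integrableRZl => //; apply: integrableRB => //.
  exact: finite_measure_integrable_cst.
have E1 : (\int[P]_w (e^-1 * (1 - cos (u * X w)))%:E = (e^-1 * (1 - expR (- e)))%:E)%E.
  rewrite -[LHS]fineK; last exact: (integrable_fin_num _ I1).
  congr EFin; rewrite -/(Rintegral _ _ _) RintegralZl//; last first.
    by apply: integrableRB => //; exact: finite_measure_integrable_cst.
  rewrite RintegralB//; last exact: finite_measure_integrable_cst.
  have -> : \int[P]_w (cst 1 w) = 1 :> R 
    by rewrite Rintegral_cst// mul1r; exact: (congr1 fine (probability_setT P)).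
  rewrite XN.
  by rewrite uu mulNr mulrAC divff// mul1r.
have le1 : ((1 - e)%:E <= \int[P]_w (X w ^+ 2)%:E)%E.
  apply: (@le_trans _ _ (e^-1 * (1 - expR (- e)))%:E).
    rewrite lee_fin [leRHS]mulrC ler_pdivlMr// expRN.
    have h := expR_ge1Dx e; have h0 := expR_gt0 e.
    rewrite -subr_ge0 (_ : _ - _ = ((1 - e + e ^+ 2) * (expR e - (1 + e)) + e ^+ 3) / expR e).
      rewrite divr_ge0 ?(ltW h0)// addr_ge0 ?exprn_ge0 ?(ltW e0)//.
      by rewrite mulr_ge0 ?subr_ge0// addr_ge0 ?sqr_ge0// subr_ge0 ltW.
    by field; rewrite gt_eqF.
  rewrite -E1; apply: ge0_le_integral => //.
  - by move=> w _; rewrite lee_fin mulr_ge0 ?invr_ge0 ?subr_ge0 ?cos_le1 ?ltW.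
  - by apply/measurable_EFinP; apply: measurable_funM => //; exact: measurable_funB.
  - by apply/measurable_EFinP; exact: measurable_funX.
  - move=> w _; rewrite lee_fin [leLHS]mulrC ler_pdivrMr//.
    have := cos_ge_quadratic (u * X w); rewrite exprMn uu; lra.
by have := leeD2r e%:E le1; rewrite -EFinD subrK.
Qed.

Section bridge_energy.
Context (R : realType) d (T : measurableType d) (P : probability T R).
Variable B : R -> T -> R.
Hypothesis hB : brownian_bridge P B.
Local Notation mu := (@lebesgue_measure R).
Local Notation I := (`[0, 1]%classic : set R).
Local Notation path w := (fun t => B t w).

(** The bridge extended by 0 outside the unit interval: on the whole product
    space it is jointly measurable. *)
Definition bridge_field (z : T * measurableTypeR R) : R := \1_I z.2 * B z.2 z.1.

Let measurable_indic_time (A : set (measurableTypeR R)) : measurable A ->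
  measurable_fun [set: T * measurableTypeR R] (fun z => \1_A z.2 : R).
Proof.
by move=> mA; apply: (@measurableT_comp _ _ _ _ (measurableTypeR R) _
  (\1_A : measurableTypeR R -> R) _ snd).
Qed.

(** Continuity of the paths: the field is a limit of step functions in time. *)
Lemma measurable_bridge_field :
  measurable_fun [set: T * measurableTypeR R] bridge_field.
Proof.
have m1 := measurable_indic_time (measurable_itv `[0, 1]).
pose S n (z : T * measurableTypeR R) := \1_I z.2 * step n.+1 (path z.1) z.2.
apply: (@measurable_fun_cvg _ _ _ _ S) => [n|z _].
  apply: measurable_funM => //; apply: measurable_sum => j; apply: measurable_funM.
    by apply: measurable_indic_time; exact: measurable_itv.
  have j01 : 0 <= (j%:R / n.+1%:R : R) <= 1.
    by rewrite divr_ge0//= ler_pdivrMr ?ltr0n// mul1r ler_nat -ltnS.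
  exact: (measurableT_comp (measurable_bridge hB j01)).
rewrite /S /bridge_field indicE; have [/set_mem|_] := boolP (z.2 \in I).
  rewrite /= in_itv/= => z01; under eq_fun do rewrite mul1r.
  by rewrite mul1r; apply: cvg_step => //; exact: (bridge_continuous hB).
by under eq_fun do rewrite mul0r; rewrite mul0r; exact: cvg_cst.
Qed.

Lemma bridge_fieldE t w : 0 <= t <= 1 -> bridge_field (w, t) = B t w.
Proof. by move=> t01; rewrite /bridge_field indicE mem_set ?mul1r// /= in_itv. Qed.

Lemma bridge_field_out t w : ~ 0 <= t <= 1 -> bridge_field (w, t) = 0.
Proof.
by move=> t01; rewrite /bridge_field indicE memNset ?mul0r//= in_itv.
Qed.

Lemma measurable_Rintegral_path (phi : T * measurableTypeR R -> R) :
  measurable_fun [set: T * measurableTypeR R] phi ->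
  measurable_fun [set: T] (fun w => \int[mu]_(t in I) phi (w, t)).
Proof.
move=> mphi.
have m1 := measurable_indic_time (measurable_itv `[0, 1]).
pose psi z := (\1_I z.2 * phi z)%:E.
have mpsi : measurable_fun setT psi by apply/measurable_EFinP; exact: measurable_funM.
have E w : \int[mu]_(t in I) phi (w, t) =
    fine (\int[mu]_t (psi^\+ (w, t)) - \int[mu]_t (psi^\- (w, t)))%E.
  rewrite /Rintegral integral_mkcond [X in fine X]integralE.
  have e t : ((fun t => (phi (w, t))%:E) \_ I) t = psi (w, t).
    by rewrite patchE /psi indicE/=; case: ifPn => _; rewrite ?mul1r ?mul0r.
  by congr (fine (_ - _)%E); apply: eq_integral => t _; rewrite ?funeposE ?funenegE e.
under eq_fun do rewrite E.
apply: (measurableT_comp (@fine_measurable R setT _)) => //.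
apply: emeasurable_funB.
  apply: (@measurable_fun_fubini_tonelli_F _ _ T (measurableTypeR R) R mu psi^\+)%E => //.
  exact: measurable_funepos.
apply: (@measurable_fun_fubini_tonelli_F _ _ T (measurableTypeR R) R mu psi^\-)%E => //.
exact: measurable_funeneg.
Qed.

Lemma measurable_V_stat : measurable_fun [set: T] (fun w => V_stat (path w)).
Proof.
have mb := measurable_bridge_field.
have path_integral (g : R -> R -> R) :
    measurable_fun [set: T * measurableTypeR R] (fun z => g (bridge_field z) z.2) ->
    measurable_fun [set: T] (fun w => \int[mu]_(t in I) g (B t w) t).
  move=> mg; have := measurable_Rintegral_path mg.
  apply: eq_measurable_fun => w _; apply: eq_Rintegral => t /set_mem.
  by rewrite /= in_itv/= => t01; rewrite bridge_fieldE.
have mt : measurable_fun [set: T * measurableTypeR R] (fun z => z.2 : R) by exact: measurable_snd.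
have mu1 : measurable_fun [set: T * measurableTypeR R] (fun z => 1 - z.2 : R).
  exact: measurable_funB.
have mi : measurable_fun [set: T * measurableTypeR R] (fun z => (1 - z.2)^-1 : R).
  exact: (measurableT_comp (@measurable_inv R)).
rewrite /V_stat; apply: measurable_funB; last first.
  apply: measurable_funX; apply: measurable_funM => //.
  apply: (path_integral (fun b t => 6 * b * ln (t / (1 - t)))).
  apply: measurable_funM; first exact: measurable_funM.
  by apply: (measurableT_comp (@measurable_ln R)); exact: measurable_funM.
apply: measurable_funM => //; apply: measurable_funB.
  apply: (path_integral (fun b t => 6 * b ^+ 2 / (t * (1 - t)))).
  apply: measurable_funM; last first.
    by apply: (measurableT_comp (@measurable_inv R)); exact: measurable_funM.
  by apply: measurable_funM => //; exact: measurable_funX.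
apply: measurable_funX; apply: (path_integral (fun b t => 6 * b)).
exact: measurable_funM.
Qed.

Definition energy (w : T) : \bar R :=
  (\int[mu]_(t in I) (B t w ^+ 2 / (weight R).[t])%:E)%E.

Let field_energy (z : T * measurableTypeR R) : \bar R :=
  (bridge_field z ^+ 2 / (weight R).[z.2])%:E.

Let measurable_field_energy :
  measurable_fun [set: T * measurableTypeR R] field_energy.
Proof.
apply/measurable_EFinP; apply: measurable_funM.
  by apply: measurable_funX; exact: measurable_bridge_field.
apply: (measurableT_comp (@measurable_inv R)).
apply: (@measurableT_comp _ _ _ _ (measurableTypeR R) _ (horner (weight R)) _ snd) => //.
exact: measurable_horner.
Qed.

Let field_energy_ge0 z : (0 <= field_energy z)%E.
Proof.
case: z => w t; rewrite /field_energy lee_fin/=.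
have [t01|/negP t01] := boolP (0 <= t <= 1).
  by rewrite mulr_ge0 ?sqr_ge0// invr_ge0 weight_ge0.
by rewrite bridge_field_out// expr0n/= mul0r.
Qed.

Let energyE w : energy w = (\int[mu]_t field_energy (w, t))%E.
Proof.
rewrite /energy integral_mkcond; apply: eq_integral => t _.
rewrite patchE /field_energy/=; case: ifPn => [/set_mem|/negP tI].
  by rewrite /= in_itv/= => t01; rewrite bridge_fieldE.
rewrite bridge_field_out ?expr0n/= ?mul0r// => t01.
by apply: tI; apply/mem_set; rewrite /= in_itv.
Qed.

Lemma measurable_energy : measurable_fun [set: T] energy.
Proof.
have := measurable_fun_fubini_tonelli_F (m2 := mu) field_energy
  measurable_field_energy field_energy_ge0.
by apply: eq_measurable_fun => w _; rewrite energyE.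
Qed.

Lemma energy_ge0 w : (0 <= energy w)%E.
Proof. by rewrite energyE; exact: integral_ge0. Qed.

(** The variance [t - t ^ 2] of the bridge is the weight itself, so by Tonelli's
    theorem the mean energy is the integral of a function that is 1 on the open
    interval. *)
Lemma energy_mean : (\int[P]_w energy w <= 1)%E.
Proof.
under eq_integral do rewrite energyE.
rewrite (fubini_tonelli field_energy measurable_field_energy field_energy_ge0).
apply: (@le_trans _ _ (\int[mu]_(t in I) (cst 1%E t))%E); last first.
  rewrite integral_cst// mul1e le_eqVlt; apply/orP; left; apply/eqP.
  apply: etrans (@lebesgue_measure_itv R `[0, 1]) _.
  by rewrite /= lte_fin ltr01 -EFinD subr0.
rewrite [leRHS]integral_mkcond; apply: ge0_le_integral => //.
- by move=> t _; exact: integral_ge0.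
- exact: (measurable_fun_fubini_tonelli_G (m1 := P) field_energy measurable_field_energy).
- by apply/(measurable_restrictT _ (measurable_itv _)); exact: measurable_cst.
move=> t _; rewrite patchE; case: ifPn => [/set_mem|/negP tI]; last first.
  rewrite integral0_eq// => w _; rewrite /field_energy bridge_field_out ?expr0n/= ?mul0r// => t01.
  by apply: tI; apply/mem_set; rewrite /= in_itv.
rewrite /= in_itv/= => t01.
have -> : (\int[P]_w field_energy (w, t) =
    \int[P]_w (((weight R).[t]^-1)%:E * (B t w ^+ 2)%:E))%E.
  by apply: eq_integral => w _; rewrite /field_energy bridge_fieldE// -EFinM mulrC.
rewrite ge0_integralZl_EFin//; last 3 first.
- by move=> w _; rewrite lee_fin sqr_ge0.
- by apply/measurable_EFinP; apply: measurable_funX; exact: (measurable_bridge hB).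
- by rewrite invr_ge0 weight_ge0.
rewrite (integral_bridge_sqr hB)// -EFinM lee_fin.
have -> : t - t ^+ 2 = (weight R).[t] by rewrite horner_weight; ring.
by have [->|w0] := eqVneq (weight R).[t] 0; rewrite ?mulr0 ?mulVf.
Qed.

Definition bridge_coord (k : nat) (w : T) : R := legendre_coord (path w) k.

Let coord_poly (n : nat) (a : nat -> R) : {poly R} :=
  \sum_(i < n) (a i * Num.sqrt (2 * i.+1%:R + 1)) *: legendre R i.+1.

Let linear_coordE n a w :
  linear_form n (fun i => bridge_coord i.+1) a w = bridge_functional B (coord_poly n a) w.
Proof.
have Ip (p : {poly R}) : mu.-integrable I (EFin \o (fun t => B t w * p.[t])).
  exact: (@continuous_integrableM R (path w) p (@bridge_continuous _ _ _ _ _ hB w)).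
transitivity (\int[mu]_(t in I) (\sum_(i < n)
   a i * Num.sqrt (2 * i.+1%:R + 1) * (B t w * (legendre R i.+1)^`().[t]))).
  have [|_ ->] := @Rintegral_sum _ _ _ mu I _ (index_enum 'I_n) (fun i t =>
     a i * Num.sqrt (2 * i.+1%:R + 1) * (B t w * (legendre R i.+1)^`().[t]))
     (measurable_itv _).
    by move=> i _; apply: integrableRZl => //; exact: Ip.
  apply: eq_bigr => i _; rewrite RintegralZl//.
  by rewrite /bridge_coord /legendre_coord mulrA.
apply: eq_Rintegral => t _; rewrite /coord_poly (big_morph (@deriv R) (@derivD R) (deriv0 R)) horner_sum mulr_sumr.
by apply: eq_bigr => i _; rewrite derivZ hornerZ mulrCA.
Qed.

Lemma measurable_bridge_coord k : (1 <= k)%N -> measurable_fun [set: T] (bridge_coord k).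
Proof.
move=> k1; have := measurable_bridge_functional hB
  (Num.sqrt (2 * k%:R + 1) *: legendre R k).
apply: eq_measurable_fun => w _; rewrite /bridge_functional /bridge_coord /legendre_coord.
rewrite -RintegralZl//; last first.
  exact: (@continuous_integrableM R (path w) _ (@bridge_continuous _ _ _ _ _ hB w)).
by apply: eq_Rintegral => t _; rewrite derivZ hornerZ mulrCA.
Qed.

(** The coordinates have the joint law of independent standard normal
    variables, because the normalized Legendre polynomials are orthonormal and
    orthogonal to constants. *)
Lemma bridge_coord_cos n (a : nat -> R) :
  \int[P]_w cos (linear_form n (fun i => bridge_coord i.+1) a w) =
  expR (- (\sum_(i < n) a i ^+ 2) / 2).
Proof.
under eq_Rintegral do rewrite linear_coordE.
rewrite (bridge_functional_cos hB); congr (expR (- _ / 2)).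
have -> : pint (coord_poly n a) = 0.
  rewrite /coord_poly pint_sum big1// => i _.
  by rewrite pintZ pint_legendre// mulr0.
rewrite expr0n/= subr0 expr2 /coord_poly mulr_suml pint_sum; apply: eq_bigr => i _.
rewrite mulr_sumr pint_sum (bigD1 i)//= big1 ?addr0.
  rewrite -scalerAl -scalerAr !pintZ legendre_norm.
  have s2 : Num.sqrt (2 * i.+1%:R + 1) ^+ 2 = 2 * i.+1%:R + 1 :> R by rewrite sqr_sqrtr.
  transitivity (a i ^+ 2 * (Num.sqrt (2 * i.+1%:R + 1) ^+ 2 / (2 * i.+1%:R + 1))).
    by ring.
  by rewrite s2 divff ?mulr1// gt_eqF.
move=> j ji; rewrite -scalerAl -scalerAr !pintZ legendre_orthogonal ?mulr0//.
by rewrite eq_sym.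
Qed.

Lemma bridge_coord_sqr k : (1 <= k)%N -> (1 <= \int[P]_w (bridge_coord k w ^+ 2)%:E)%E.
Proof.
case: k => // k _; apply: sqr_moment_ge1; first exact: measurable_bridge_coord.
move=> u; pose a i : R := if i == k then u else 0.
have := bridge_coord_cos k.+1 a.
have -> : \sum_(i < k.+1) a i ^+ 2 = u ^+ 2.
  rewrite big_ord_recr/= big1 ?add0r/a ?eqxx// => i _.
  by rewrite ltn_eqF ?expr0n.
move=> <-; apply: eq_Rintegral => w _; congr cos.
rewrite /linear_form big_ord_recr/= big1 ?add0r/a ?eqxx// => i _.
by rewrite ltn_eqF ?mul0r.
Qed.

Let measurable_path_energy w :
  measurable_fun I (fun t => B t w ^+ 2 / (weight R).[t]).
Proof.
apply: measurable_funM.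
  apply: measurable_funX.
  by have /integrableP[/measurable_EFinP] :=
    continuous_integrable (@bridge_continuous _ _ _ _ _ hB w).
apply: measurable_funTS; apply: (measurableT_comp (@measurable_inv R)).
exact: measurable_horner.
Qed.

Lemma energy_integrable w : (energy w < +oo)%E ->
  mu.-integrable I (EFin \o (fun t => B t w ^+ 2 / (weight R).[t])).
Proof.
move=> Ew; have mE := (measurable_EFinP _ _).2 (measurable_path_energy w).
apply/integrableP; split => //.
apply: le_lt_trans Ew; apply: ge0_le_integral => //.
- exact: measurableT_comp.
- move=> t; rewrite /= in_itv/= => t01.
  by rewrite lee_fin ger0_norm// divr_ge0 ?sqr_ge0// weight_ge0.
Qed.

Lemma energy_fin w : (energy w < +oo)%E ->
  energy w = (\int[mu]_(t in I) (B t w ^+ 2 / (weight R).[t]))%:E.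
Proof.
move=> Ew; rewrite /Rintegral fineK// ge0_fin_numE//.
exact: (energy_ge0 w).
Qed.

Definition residual_energy n w : \bar R := (energy w - (bessel_sum (path w) n)%:E)%E.

Let bessel_energy n w : ((bessel_sum (path w) n)%:E <= energy w)%E.
Proof.
have [Ew|] := ltP (energy w) +oo%E; last by rewrite leye_eq => /eqP ->; rewrite leey.
rewrite energy_fin// lee_fin; apply: bessel_le; last exact: energy_integrable.
exact: (@bridge_continuous _ _ _ _ _ hB w).
Qed.

Let measurable_bessel n : measurable_fun [set: T] (fun w => bessel_sum (path w) n).
Proof.
rewrite /bessel_sum; under eq_fun do rewrite big_add1 big_mkord.
apply: measurable_sum => k; apply: measurable_funM => //; apply: measurable_funX.
exact: measurable_bridge_coord.
Qed.

Let bessel_mean n : ((1 - n.+1%:R^-1)%:E <= \int[P]_w (bessel_sum (path w) n)%:E)%E.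
Proof.
rewrite -sum_inv_pronic big_add1 big_mkord -sumEFin.
have -> : (\int[P]_w (bessel_sum (path w) n)%:E = \int[P]_w
   \sum_(k < n) ((k.+1%:R * (k.+1%:R + 1))^-1%:E * (bridge_coord k.+1 w ^+ 2)%:E))%E.
  apply: eq_integral => w _; rewrite /bessel_sum big_add1 big_mkord -sumEFin.
  by apply: eq_bigr => k _; rewrite -EFinM mulrC.
have m k : measurable_fun [set: T] (fun w => (bridge_coord k.+1 w ^+ 2)%:E).
  by apply/measurable_EFinP; apply: measurable_funX; exact: measurable_bridge_coord.
rewrite ge0_integral_sum//; last 2 first.
- by move=> k; exact: measurable_funeM.
- by move=> k w _; rewrite -EFinM lee_fin mulr_ge0 ?sqr_ge0// invr_ge0 mulr_ge0.
apply: lee_sum => k _; rewrite ge0_integralZl_EFin//; last first.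
  by move=> w _; rewrite lee_fin sqr_ge0.
rewrite -[leLHS]mule1 lee_pmul2l//; exact: bridge_coord_sqr.
Qed.

(** The energy has mean at most 1, and the first [n] squared coordinates have
    mean at least [sum_(k <= n) 1 / (k (k + 1)) = 1 - 1 / (n + 1)]. *)
Lemma residual_energy_mean n : (\int[P]_w residual_energy n w <= (n.+1%:R^-1)%:E)%E.
Proof.
have r0 w : (0 <= residual_energy n w)%E by rewrite sube_ge0// bessel_energy.
have mr : measurable_fun [set: T] (residual_energy n).
  by apply: emeasurable_funB; [exact: measurable_energy|exact/measurable_EFinP].
have b0 w : (0 <= (bessel_sum (path w) n)%:E)%E.
  by rewrite lee_fin sumr_ge0// => k _; rewrite divr_ge0 ?sqr_ge0// mulr_ge0.
have : (\int[P]_w residual_energy n w + \int[P]_w (bessel_sum (path w) n)%:E <= 1)%E.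
  rewrite -ge0_integralD//; last exact/measurable_EFinP.
  apply: le_trans energy_mean; rewrite le_eqVlt; apply/orP; left; apply/eqP.
  by apply: eq_integral => w _; rewrite /residual_energy subeK.
have := bessel_mean n.
move: (\int[P]_w residual_energy n w)%E (\int[P]_w (bessel_sum (path w) n)%:E)%E.
move=> x y hy hxy.
have h : (x + (1 - n.+1%:R^-1)%:E <= 1)%E by apply: le_trans hxy; exact: leeD2l.
move: h; rewrite -leeBrDr// -EFinB opprB addrCA subrr addr0.
exact.
Qed.

(** The mean residual energy tends to zero along a monotone sequence: the
    coordinates exhaust the energy of almost every path. *)
Lemma ae_parseval : {ae P, forall w,
  mu.-integrable I (EFin \o (fun t => B t w ^+ 2 / (weight R).[t])) /\
  bessel_sum (path w) n @[n --> \oo] -->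
    \int[mu]_(t in I) (B t w ^+ 2 / (weight R).[t])}.
Proof.
have mr n : measurable_fun [set: T] (residual_energy n).
  by apply: emeasurable_funB; [exact: measurable_energy|exact/measurable_EFinP].
have r0 n w : (0 <= residual_energy n w)%E by rewrite sube_ge0// bessel_energy.
have rni w : nonincreasing_seq (residual_energy ^~ w).
  move=> m n mn; rewrite /residual_energy leeB// lee_fin /bessel_sum.
  rewrite [leRHS](@big_cat_nat _ _ _ m.+1)//= lerDl sumr_ge0// => k _.
  by rewrite divr_ge0 ?sqr_ge0// mulr_ge0.
have r_cvg := ae_cvg0_nonincreasing mr r0 rni residual_energy_mean.
have IE : P.-integrable [set: T] energy.
  apply/integrableP; split; first exact: measurable_energy.
  apply: (@le_lt_trans _ _ 1%E); last exact: ltry.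
  apply: le_trans energy_mean; rewrite le_eqVlt; apply/orP; left; apply/eqP.
  by apply: eq_integral => w _; rewrite gee0_abs// energy_ge0.
have fin := integrable_ae measurableT IE.
apply: filterS2 r_cvg fin => w rw /(_ Logic.I) Efin.
have Ew : (energy w < +oo)%E by rewrite -ge0_fin_numE// energy_ge0.
split; first exact: energy_integrable.
set a := \int[mu]_(t in I) _.
have /fine_cvg/= h : (a - bessel_sum (path w) n)%:E @[n --> \oo] --> (0:R)%:E.
  by move: rw; rewrite /residual_energy energy_fin.
rewrite -[a]subr0; have -> : bessel_sum (path w) = (fun n => a - (a - bessel_sum (path w) n)).
  by apply/funext => n; rewrite subKr.
by apply: cvgB => //; exact: cvg_cst.
Qed.

End bridge_energy.

(** * Equality of the two laws *)

Section series_law.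
Context (R : realType).

Let delta (k : nat) (c : R) (m : nat) : R := if m.+1 == k then c else 0.

Let linear_form_delta T (X : nat -> T -> R) (N k : nat) (c : R) (w : T) :
  (1 <= k <= N)%N -> \sum_(m < N) delta k c m * X m.+1 w = c * X k w.
Proof.
case: k => // k /andP[_ kN]; rewrite (bigD1 (Ordinal kN))//= {1}/delta eqxx.
rewrite big1 ?addr0// => m; rewrite -val_eqE/= => mk.
by rewrite /delta eqSS (negbTE mk) mul0r.
Qed.

Definition lin_coeff (l : nat) : R :=
  3 * Num.sqrt (4 * l%:R + 1) / (l%:R * (l%:R + 1) * (2 * l%:R - 1) * (2 * l%:R + 1)).

(** Nonnegative combinations of the partial sums of the quadratic series and of
    the squared partial sums of the linear one are sums of squared linear
    forms, whose coefficients do not depend on the variables. *)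
Lemma partial_sums_exp_quad (n i j : nat) : exists s : seq (nat -> R),
  forall d (T : measurableType d) (X : nat -> T -> R) (w : T),
  exp_quad (2 * n) (fun m => X m.+1) s w =
  expR (- (i%:R * \sum_(2 <= k < n) quad_term (fun m => X m w) k +
           j%:R * (\sum_(1 <= l < n) lin_term (fun m => X m w) l) ^+ 2)).
Proof.
pose q k := delta k (Num.sqrt (2 * i%:R * (6 / (k%:R * (k%:R + 1))))).
pose b m := \sum_(1 <= l < n) delta (2 * l) (Num.sqrt (2 * j%:R) * lin_coeff l) m.
exists (b :: [seq q k | k <- index_iota 2 n]) => d T X w.
rewrite /exp_quad big_cons big_map; congr expR.
have -> : linear_form (2 * n) (fun m => X m.+1) b w ^+ 2 =
    2 * j%:R * (\sum_(1 <= l < n) lin_term (fun m => X m w) l) ^+ 2.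
  have -> : linear_form (2 * n) (fun m => X m.+1) b w =
      Num.sqrt (2 * j%:R) * \sum_(1 <= l < n) lin_term (fun m => X m w) l.
    rewrite /linear_form /b mulr_sumr.
    under eq_bigr do rewrite mulr_suml.
    rewrite exchange_big/=; apply: eq_big_nat => l /andP[l1 ln].
    rewrite linear_form_delta; first by rewrite /lin_term -/(lin_coeff l) mulrA.
    by rewrite muln_gt0 l1/= leq_mul2l ltnW.
  by rewrite exprMn sqr_sqrtr// mulr_ge0.
have -> : \sum_(k <- index_iota 2 n) linear_form (2 * n) (fun m => X m.+1) (q k) w ^+ 2 =
    2 * i%:R * \sum_(2 <= k < n) quad_term (fun m => X m w) k.
  rewrite mulr_sumr; apply: eq_big_nat => k /andP[k2 kn].
  rewrite /linear_form linear_form_delta; last first.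
    by rewrite (ltnW k2) (leq_trans (ltnW kn))// leq_pmull.
  rewrite exprMn sqr_sqrtr; first by rewrite /quad_term -[LHS]mulrA.
  by rewrite !mulr_ge0// invr_ge0 mulr_ge0.
by field.
Qed.

Section one_sequence.
Context d (T : measurableType d) (P : probability T R).
Variable X : nat -> T -> R.
Hypothesis mX : forall k, (1 <= k)%N -> measurable_fun [set: T] (X k).

Definition quad_sum (n : nat) (w : T) : R :=
  \sum_(2 <= k < n) quad_term (fun m => X m w) k.

Definition lin_sum (n : nat) (w : T) : R :=
  \sum_(1 <= l < n) lin_term (fun m => X m w) l.

Hypothesis cvg_quad : {ae P, forall w, cvgn (quad_sum ^~ w)}.
Hypothesis cvg_lin : {ae P, forall w, cvgn (lin_sum ^~ w)}.

Lemma measurable_quad_sum n : measurable_fun [set: T] (quad_sum n).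
Proof.
rewrite /quad_sum; under eq_fun do rewrite big_nat_cond big_mkcond.
apply: measurable_sum => k; have [/andP[/andP[k2 _] _]|_] := boolP ((1 < k < n)%N && true);
  last exact: measurable_cst.
apply: measurable_funM => //; apply: measurable_funX; apply: mX; exact: ltnW.
Qed.

Lemma measurable_lin_sum n : measurable_fun [set: T] (lin_sum n).
Proof.
rewrite /lin_sum; under eq_fun do rewrite big_nat_cond big_mkcond.
apply: measurable_sum => k; have [/andP[/andP[k1 _] _]|_] := boolP ((0 < k < n)%N && true);
  last exact: measurable_cst.
by apply: measurable_funM => //; apply: mX; rewrite muln_gt0.
Qed.

Lemma quad_sum_ge0 n w : 0 <= quad_sum n w.
Proof.
apply: sumr_ge0 => k _; rewrite mulr_ge0 ?sqr_ge0// divr_ge0// mulr_ge0//.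
Qed.

(** The absolute value keeps the variable in the unit interval where the series
    diverges and its limit is an unspecified number. *)
Definition exp_quad_lim (w : T) : R := expR (- `|limn (quad_sum ^~ w)|).

Definition exp_lin_lim (w : T) : R := expR (- limn (lin_sum ^~ w) ^+ 2).

Lemma measurable_exp_quad_lim : measurable_fun [set: T] exp_quad_lim.
Proof.
apply: (measurableT_comp (@measurable_expR R)); apply: measurable_funN.
apply: measurableT_comp => //.
by apply: measurable_fun_limn => n; exact: measurable_quad_sum.
Qed.

Lemma measurable_exp_lin_lim : measurable_fun [set: T] exp_lin_lim.
Proof.
apply: (measurableT_comp (@measurable_expR R)); apply: measurable_funN.
apply: measurable_funX.
by apply: measurable_fun_limn => n; exact: measurable_lin_sum.
Qed.

Lemma exp_quad_lim01 w : 0 <= exp_quad_lim w <= 1.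
Proof. by rewrite expR_ge0 -[leRHS]expR0 ler_expR oppr_le0 normr_ge0. Qed.

Lemma exp_lin_lim01 w : 0 <= exp_lin_lim w <= 1.
Proof. by rewrite expR_ge0 -[leRHS]expR0 ler_expR oppr_le0 sqr_ge0. Qed.

Lemma cvg_mixed_moments i j :
  \int[P]_w expR (- (i%:R * quad_sum n w + j%:R * lin_sum n w ^+ 2)) @[n --> \oo] -->
  \int[P]_w (exp_quad_lim w ^+ i * exp_lin_lim w ^+ j).
Proof.
have [||||//|//] := @dominated_cvg_Rintegral _ _ _ P setT
  (fun n w => expR (- (i%:R * quad_sum n w + j%:R * lin_sum n w ^+ 2)))
  (fun w => exp_quad_lim w ^+ i * exp_lin_lim w ^+ j) (cst 1) measurableT.
- move=> n; apply: (measurableT_comp (@measurable_expR R)); apply: measurable_funN.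
  apply: measurable_funD; apply: measurable_funM => //; first exact: measurable_quad_sum.
  by apply: measurable_funX; exact: measurable_lin_sum.
- apply: measurable_funM; apply: measurable_funX.
    exact: measurable_exp_quad_lim.
  exact: measurable_exp_lin_lim.
- apply: filterS2 cvg_quad cvg_lin => w cq cl _.
  have q0 : 0 <= limn (quad_sum ^~ w).
    by apply: limr_ge => //; apply: nearW => n; exact: quad_sum_ge0.
  rewrite /exp_quad_lim /exp_lin_lim ger0_norm// -!expRM_natl -expRD.
  rewrite !mulrN -opprD.
  apply: (@cvg_comp _ _ _ _ (@expR R)); last exact: continuous_expR.
  apply: cvgN; apply: cvgD; first by apply: cvgMr; exact: cq.
  by apply: cvgMr; apply: (@cvg_comp _ _ _ _ (fun x : R => x ^+ 2) _ _ _ cl); exact: exprn_continuous.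
- exact: finite_measure_integrable_cst.
- move=> n w _; rewrite ger0_norm ?expR_ge0// -[leRHS]expR0 ler_expR oppr_le0.
  by rewrite addr_ge0// mulr_ge0 ?quad_sum_ge0 ?sqr_ge0.
Qed.

Let c : R := (pi ^+ 2 / 3 - 2)^-1.

Lemma measurable_V_series : measurable_fun [set: T] (fun w => V_series (fun m => X m w)).
Proof.
apply: measurable_funB; last apply: measurable_funX; apply: measurable_funM => //;
  apply: measurable_fun_limn => n.
  exact: measurable_quad_sum.
exact: measurable_lin_sum.
Qed.

Lemma ae_V_seriesE : {ae P, forall w, V_series (fun m => X m w) =
  c * - ln (exp_quad_lim w) - c ^+ 2 * - ln (exp_lin_lim w)}.
Proof.
apply: filterS cvg_quad => w cq.
have q0 : 0 <= limn (quad_sum ^~ w).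
  by apply: limr_ge => //; apply: nearW => n; exact: quad_sum_ge0.
by rewrite /exp_quad_lim /exp_lin_lim !expRK !opprK ger0_norm// -exprMn.
Qed.

End one_sequence.

Lemma eq_in_law_ae d (T : measurableType d) (P : probability T R)
    d' (T' : measurableType d') (Q : probability T' R)
    (X X' : T -> R) (Y Y' : T' -> R) :
  measurable_fun [set: T] X' -> measurable_fun [set: T'] Y' ->
  {ae P, forall w, X w = X' w} -> {ae Q, forall w, Y w = Y' w} ->
  eq_in_law P Q X Y -> eq_in_law P Q X' Y'.
Proof.
move=> mX' mY' XX' YY' [mX mY XY]; split => // A mA.
have ae_push d0 (S : measurableType d0) (m : probability S R) (f f' : S -> R) :
    measurable_fun [set: S] f -> measurable_fun [set: S] f' ->
    {ae m, forall w, f w = f' w} -> pushforward m f A = pushforward m f' A.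
  move=> mf mf' [N [mN N0 sN]].
  have mfA (g : S -> R) : measurable_fun [set: S] g -> measurable (g @^-1` A).
    by move=> mg; rewrite -[X in measurable X]setTI; exact: mg.
  rewrite /pushforward -(measureU0 (mfA _ mf) mN N0) -(measureU0 (mfA _ mf') mN N0).
  congr (m _); apply/seteqP; split => w /= [|Nw]; try by right.
    by have [->|/eqP ff'] := eqVneq (f w) (f' w); [left|right; exact: sN].
  by have [->|/eqP ff'] := eqVneq (f w) (f' w); [left|right; exact: sN].
by rewrite -(ae_push _ _ P X)// -(ae_push _ _ Q Y)// XY.
Qed.

(** The mixed moments of [exp_quad_lim] and [exp_lin_lim] are limits of means that
    are equal by [eq_exp_quad], and the statistic is almost surely a function of
    these two variables. *)
Lemma eq_law_V_series d (T : measurableType d) (P : probability T R)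
    d' (T' : measurableType d') (Q : probability T' R)
    (X : nat -> T -> R) (Y : nat -> T' -> R) :
  (forall k, (1 <= k)%N -> measurable_fun [set: T] (X k)) ->
  (forall k, (1 <= k)%N -> measurable_fun [set: T'] (Y k)) ->
  (forall n a, \int[P]_w cos (linear_form n (fun i => X i.+1) a w) =
               \int[Q]_w cos (linear_form n (fun i => Y i.+1) a w)) ->
  {ae P, forall w, cvgn (quad_sum X ^~ w)} ->
  {ae P, forall w, cvgn (lin_sum X ^~ w)} ->
  {ae Q, forall w, cvgn (quad_sum Y ^~ w)} ->
  {ae Q, forall w, cvgn (lin_sum Y ^~ w)} ->
  eq_in_law P Q (fun w => V_series (fun m => X m w)) (fun w => V_series (fun m => Y m w)).
Proof.
move=> mX mY XY cXq cXl cYq cYl.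
apply: (eq_in_law_ae (measurable_V_series mX) (measurable_V_series mY)
  (X := fun w => (pi ^+ 2 / 3 - 2)^-1 * - ln (exp_quad_lim X w) -
                 (pi ^+ 2 / 3 - 2)^-1 ^+ 2 * - ln (exp_lin_lim X w))
  (Y := fun w => (pi ^+ 2 / 3 - 2)^-1 * - ln (exp_quad_lim Y w) -
                 (pi ^+ 2 / 3 - 2)^-1 ^+ 2 * - ln (exp_lin_lim Y w))).
- by apply: filterS (ae_V_seriesE cXq) => w ->.
- by apply: filterS (ae_V_seriesE cYq) => w ->.
have moments i j : \int[P]_w (exp_quad_lim X w ^+ i * exp_lin_lim X w ^+ j) =
                   \int[Q]_w (exp_quad_lim Y w ^+ i * exp_lin_lim Y w ^+ j).
  have h1 := @cvg_mixed_moments _ _ P X mX cXq cXl i j.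
  have h2 := @cvg_mixed_moments _ _ Q Y mY cYq cYl i j.
  rewrite -(cvg_lim _ h1)// -[RHS](cvg_lim _ h2)//.
  apply: (congr1 (fun u : nat -> R => limn u)); apply/funext => n.
  have [s sE] := partial_sums_exp_quad n i j.
  transitivity (\int[P]_w exp_quad (2 * n) (fun m => X m.+1) s w).
    by apply: eq_Rintegral => w _; rewrite sE.
  rewrite (eq_exp_quad _ _ (XY (2 * n)%N)).
  - by apply: eq_Rintegral => w _; rewrite sE.
  - by move=> k _; exact: mX.
  - by move=> k _; exact: mY.
pose g (z : R * R) := (pi ^+ 2 / 3 - 2)^-1 * - ln z.1 - (pi ^+ 2 / 3 - 2)^-1 ^+ 2 * - ln z.2.
have mg : measurable_fun [set: R * R] g.
  apply: measurable_funB; apply: measurable_funM => //; apply: measurable_funN;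
    apply: (measurableT_comp (@measurable_ln R)).
    exact: measurable_fst.
  exact: measurable_snd.
exact: (@eq_law_of_moments _ _ _ P _ _ Q _ _ _ _
  (measurable_exp_quad_lim mX) (measurable_exp_lin_lim mX)
  (measurable_exp_quad_lim mY) (measurable_exp_lin_lim mY)
  (@exp_quad_lim01 _ _ X) (@exp_lin_lim01 _ _ X)
  (@exp_quad_lim01 _ _ Y) (@exp_lin_lim01 _ _ Y) moments g mg).
Qed.

End series_law.

Theorem theorem2 (R : realType)
    (d : measure_display) (T : measurableType d) (P : probability T R)
    (B : R -> T -> R)
    (d' : measure_display) (T' : measurableType d') (Q : probability T' R)
    (Z : nat -> T' -> R)
    (hB : brownian_bridge P B) (hZ : iid_standard_normal Q Z) :
  [/\ {ae P, forall w,
        let b := fun t => B t w in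
        [/\ (@lebesgue_measure R).-integrable `[0, 1] (EFin \o quad_integrand b),
            (@lebesgue_measure R).-integrable `[0, 1] (EFin \o lin_integrand b) &
            (@lebesgue_measure R).-integrable `[0, 1] (EFin \o log_integrand b)]},
      {ae Q, forall w,
        cvgn (fun n => \sum_(2 <= k < n) quad_term (fun m => Z m w) k)},
      {ae Q, forall w,
        cvgn (fun n => \sum_(1 <= l < n) lin_term (fun m => Z m w) l)} &
      eq_in_law P Q (fun w => V_stat (fun t => B t w))
                    (fun w => V_series (fun m => Z m w))].
Proof.
have [[mZ indepZ] ZN] := hZ.
have cB w : {within `[0, 1], continuous (fun t => B t w)} by have [_ _ _] := hB.
have cq := ae_cvg_quad_series mZ ZN.
have cl := ae_cvg_lin_series mZ ZN.
have pB := ae_parseval hB.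
split => //.
  apply: filterS pB => w [If _]; split.
  - exact: integrable_quad_integrand If.
  - exact: integrable_lin_integrand (cB w).
  - exact: integrable_log_integrand (cB w) If.
have mX k : (1 <= k)%N -> measurable_fun [set: T] (bridge_coord B k).
  by move=> k1; exact: (measurable_bridge_coord hB).
have XZ n a : \int[P]_w cos (linear_form n (fun i => bridge_coord B i.+1) a w) =
              \int[Q]_w cos (linear_form n (fun i => Z i.+1) a w).
  rewrite (bridge_coord_cos hB); apply/esym; apply: independent_normals_cos.
  - by move=> i; exact: mZ.
  - by move=> i; exact: ZN.
  - move=> J A uJ mA.
    rewrite -[RHS](big_map succn xpredT (fun k => Q (Z k @^-1` A k.-1))).
    rewrite -indepZ ?map_inj_uniq//; last 2 first.
    + by move=> k l [].
    + by move=> _ /mapP[k _ ->].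
    congr (Q _); apply/seteqP; split => w /= h k.
      by move=> /mapP[l lJ ->]; exact: h.
    by move=> kJ; apply: (h k.+1); rewrite /= map_f.
have cXq : {ae P, forall w, cvgn (quad_sum (bridge_coord B) ^~ w)}.
  apply: filterS pB => w [If pars].
  by apply/cvg_ex; eexists; exact: (cvg_quad_series_path (cB w) If pars).
have cXl : {ae P, forall w, cvgn (lin_sum (bridge_coord B) ^~ w)}.
  apply: filterS pB => w [If pars].
  by apply/cvg_ex; eexists; exact: (cvg_lin_series_path (cB w) If pars).
apply: eq_in_law_ae (eq_law_V_series mX mZ XZ cXq cXl cq cl) => //.
- exact: (measurable_V_stat hB).
- exact: measurable_V_series.
- apply: filterS pB => w [If pars]; rewrite /V_series /V_stat.
  rewrite (cvg_lim _ (cvg_quad_series_path (cB w) If pars))//.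
  by rewrite (cvg_lim _ (cvg_lin_series_path (cB w) If pars)).
- exact: aeW.
Qed.
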